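(* Let $\alpha\in(0,2)$, let $L$ be the canonical $\alpha$-stable cylindrical Lévy process in $G$ and let $(\Psi_n)_{n\in\mathbb{N}}$ be a sequence in $\mathcal{I}_{\rm prd}^{\rm HS}$. Then the following are equivalent: (a) $\displaystyle\lim_{n\to\infty}|||\Psi_n|||_{L^\alpha}=0$; (b) $\displaystyle\lim_{n\to\infty}\sup_{\Gamma\in\mathcal{S}_{\rm adp}^{1,{\rm op}}}E\Big[\Big\|\int_0^T\Gamma\Psi_n\,dL\Big\|\wedge1\Big]=0$.
   Context: **Spaces.** $G,H$ are separable Hilbert spaces (inner product $\langle\cdot,\cdot\rangle$, norm $\|\cdot\|$), identified with their duals; $T>0$ is fixed. $L(H,H)$ is the space of bounded linear operators with operator norm $\|\cdot\|_{H\to H}$; $L_2(G,H)$ is the space of Hilbert-Schmidt operators with $\|F\|_{\rm HS}^2=\sum_k\|Fa_k\|^2$ for an orthonormal basis $(a_k)$ of $G$. $(\Omega,\Sigma,P)$ is a complete probability space; $L^0_P(\Omega,H)$ is the space of equivalence classes of $H$-valued random variables with the topology of convergence in probability. $L^\alpha_{\rm Leb}([0,T],L_2(G,H))$ is the space of Borel measurable $f:[0,T]\to L_2(G,H)$ with $\int_0^T\|f(t)\|_{\rm HS}^\alpha\,dt<\infty$; put $\|f\|_{L^\alpha}=(\int_0^T\|f(t)\|_{\rm HS}^\alpha dt)^{1/\alpha}$ if $\alpha\ge1$ and $\|f\|_{L^\alpha}=\int_0^T\|f(t)\|_{\rm HS}^\alpha dt$ if $0<\alpha<1$. For a random variable $\Psi$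 with values in this space, $|||\Psi|||_{L^\alpha}:=E[\|\Psi\|_{L^\alpha}\wedge1]$. **Cylindrical Lévy process.** A cylindrical random variable in $G$ is a linear continuous map $X:G\to L^0_P(\Omega,\mathbb{R})$. A cylindrical Lévy process is a family $(L(t):t\ge0)$ of cylindrical random variables in $G$ such that for all $n$ and $g_1,\dots,g_n\in G$ the process $((L(t)g_1,\dots,L(t)g_n):t\ge0)$ is a Lévy process in $\mathbb{R}^n$. It is canonical $\alpha$-stable if $E[e^{iL(t)g}]=\exp(-t\|g\|^\alpha)$ for all $t\ge0$, $g\in G$. Its filtration is $\mathcal{F}_t=\sigma(\{L(s)g: g\in G,\ s\in[0,t]\})$. **Radonified increments.** For $F\in L_2(G,H)$ and $s<t$ there is an $H$-valued random variable $F(L(t)-L(s))$, $P$-a.s. unique, with $\langle F(L(t)-L(s)),h\rangle=(L(t)-L(s))(F^*h)$ $P$-a.s. for all $h\in H$. **Step processes.** $\mathcal{S}_{\rm adp}^{\rm HS}$ is the set of processes $\Psi:\Omega\times[0,T]\to L_2(G,H)$ of the form $$\Psi(\omega,t)=\Big(\sum_{k=1}^{N(0)}F_{0,k}\mathbb{1}_{A_{0,k}}(\omega)\Big)\mathbb{1}_{\{0\}}(t)+\sum_{i=1}^{n-1}\Big(\sum_{k=1}^{N(i)}F_{i,k}\mathbb{1}_{A_{i,k}}(\omega)\Big)\mathbb{1}_{(t_i,t_{i+1}]}(t),$$ with $0=t_1<\dots<t_n=T$, $F_{i,k}\in L_2(G,H)$, $A_{0,k}\in\mathcal{F}_0$,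 $A_{i,k}\in\mathcal{F}_{t_i}$. $\mathcal{S}_{\rm adp}^{1,{\rm op}}$ is the set of processes $\Gamma:\Omega\times[0,T]\to L(H,H)$ of the same form with $F_{i,k}\in L(H,H)$ and $\sup_{(\omega,t)}\|\Gamma(\omega,t)\|_{H\to H}\le1$. For $\Psi\in\mathcal{S}_{\rm adp}^{\rm HS}$ with representation $\Psi(\omega,t)=\big(\sum_{k=1}^{N(0)}F_{0,k}\mathbb{1}_{A_{0,k}}(\omega)\big)\mathbb{1}_{\{0\}}(t)+\sum_{i=1}^{n-1}\big(\sum_{k=1}^{N(i)}F_{i,k}\mathbb{1}_{A_{i,k}}(\omega)\big)\mathbb{1}_{(t_i,t_{i+1}]}(t)$, where $0=t_1<\dots<t_n=T$, $F_{i,k}\in L_2(G,H)$, $A_{0,k}\in\mathcal{F}_0$ and $A_{i,k}\in\mathcal{F}_{t_i}$, $\int_0^T\Psi\,dL:=\sum_{i=1}^{n-1}\sum_{k=1}^{N(i)}\mathbb{1}_{A_{i,k}}F_{i,k}(L(t_{i+1})-L(t_i))$. $\Gamma\Psi$ denotes pointwise composition. **Integrability.** $\mathcal{P}$ is the predictable $\sigma$-algebra on $\Omega\times[0,T]$, generated by the sets $B\times(s,t]$ ($s<t$, $B\in\mathcal{F}_s$) and $B\times\{0\}$ ($B\in\mathcal{F}_0$); $P_T:=P\otimes{\rm Leb}|_{[0,T]}$. A predictable process $\Psi:\Omega\times[0,T]\to L_2(G,H)$ is integrable if there is a sequence $(\Psi_n)$ in $\mathcal{S}_{\rm adp}^{\rm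 HS}$ such that (1) $\Psi_n\to\Psi$ $P_T$-a.e., and (2) $\lim_{m,n\to\infty}\sup_{\Gamma\in\mathcal{S}_{\rm adp}^{1,{\rm op}}}E\big[\|\int_0^T\Gamma(\Psi_m-\Psi_n)\,dL\|\wedge1\big]=0$. In this case $\int_0^T\Psi\,dL:=\lim_n\int_0^T\Psi_n\,dL$ in $L^0_P(\Omega,H)$. The set of integrable processes is $\mathcal{I}_{\rm prd}^{\rm HS}$. Processes in $\mathcal{I}_{\rm prd}^{\rm HS}$ have $P$-a.s. paths in $L^\alpha_{\rm Leb}([0,T],L_2(G,H))$, so $|||\Psi|||_{L^\alpha}$ makes sense for them. *)

(* Defs.v *)
From HB Require Import structures.
From mathcomp Require Import all_boot all_order all_algebra.
From mathcomp Require Import all_classical all_reals all_analysis.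

Set Implicit Arguments.
Unset Strict Implicit.
Unset Printing Implicit Defensive.

Import Order.TTheory GRing.Theory Num.Theory.
Import numFieldNormedType.Exports.

Local Open Scope classical_set_scope.
Local Open Scope ring_scope.

(* Real Hilbert spaces: the norm of a complete normed module comes from a dot
   product. *)
HB.mixin Record CompleteNormedModule_isHilbert (R : realType) H
    & CompleteNormedModule R H := {
  inner : {dot H for (@idfun R)} ;
  inner_normE : forall x : H, inner x x = `|x| ^+ 2
}.

#[short(type="hilbertType")]
HB.structure Definition Hilbert (R : realType) :=
  {H of CompleteNormedModule_isHilbert R H & CompleteNormedModule R H}.

Definition separable (X : topologicalType) :=
  exists2 D : set X, countable D & dense D.

Section operators.
Context {R : realType}.

(* The basis is a set rather than a sequence, so that finite-dimensional spaces
   are covered. *)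
Definition orthonormal_basis (H : hilbertType R) (a : set H) :=
  (forall x y, a x -> a y -> inner x y = (x == y)%:R) /\
  dense [set x : H | exists n (c : 'I_n -> R) (b : 'I_n -> H),
    (forall i, a (b i)) /\ x = \sum_(i < n) c i *: b i].

Definition bounded_op (U V : normedModType R) : set (U -> V) :=
  [set F | linear F /\ continuous F].

Definition op_norm (U V : normedModType R) (F : U -> V) : \bar R :=
  ereal_sup [set `|F x|%:E | x in [set x : U | `|x| <= 1]].

(* The vector given by the Riesz theorem; the default 0 is only reached when F
   is not a bounded operator. *)
Definition adjoint (U V : hilbertType R) (F : U -> V) (h : V) : U :=
  xget 0 [set v : U | forall g, inner (F g) h = inner g v].

(* Operators are bare functions; L(U, V) and L_2(U, V) are the sets bounded_op
   and hs_op. hs_norm is extended-real valued: it is +oo, not a junk value, when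
   the sum over the basis diverges. *)
Definition hs_norm (U V : hilbertType R) (a : set U) (F : U -> V) : \bar R :=
  sqrte (\esum_(u in a) (`|F u| ^+ 2)%:E).

Definition hs_op (U V : hilbertType R) (a : set U) : set (U -> V) :=
  [set F | bounded_op F /\ (hs_norm a F < +oo)%E].

(* Open subsets of L_2(U, V) for the Hilbert-Schmidt norm. *)
Definition hs_open (U V : hilbertType R) (a : set U) (O : set (U -> V)) :=
  O `<=` hs_op a /\
  forall F, O F -> exists2 e : R, 0 < e &
    forall F', hs_op a F' -> (hs_norm a (F' \- F)%R < e%:E)%E -> O F'.

End operators.

Section random_variables.
Context {d} {Omega : measurableType d} {R : realType} (P : probability Omega R).

Definition borel (V : topologicalType) : set (set V) := <<s open >>.

Definition borel_measurable (V : topologicalType) (X : Omega -> V) :=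
  forall B, borel B -> measurable (X @^-1` B).

Definition cvg_in_prob (V : normedModType R) (I : Type) (X : I -> Omega -> V)
    (F : set_system I) (Y : Omega -> V) :=
  forall e : R, 0 < e ->
    P [set w | e < `|X i w - Y w|] @[i --> F] --> 0%E.

Definition expect_min1 (V : normedModType R) (X : Omega -> V) : \bar R :=
  'E_P[fun w => Num.min `|X w| 1].

(* Paths are only determined up to modification, so path regularity is required
   in the form of continuity in probability. *)
Definition levy_process (n : nat) (X : R -> Omega -> 'rV[R]_n) :=
  [/\ forall t : R, 0 <= t -> borel_measurable (X t),
      {ae P, forall w, X 0 w = 0},
      (forall (m : nat) (t : nat -> R) (B : nat -> set 'rV[R]_n),
        0 <= t 0%N -> (forall i, (i < m)%N -> t i <= t i.+1) ->
        (forall i, borel (B i)) ->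
        let E i := [set w | B i (X (t i.+1) w - X (t i) w)] in
        P (\bigcap_(i in `I_m) E i) = (\prod_(i < m) P (E i))%E),
      (forall (s t : R) (B : set 'rV[R]_n), 0 <= s <= t -> borel B ->
        P [set w | B (X t w - X s w)] = P (X (t - s) @^-1` B)) &
      (forall s : R, 0 <= s -> cvg_in_prob X (within [set t | 0 <= t] (nbhs s)) (X s))].

(* Elements of L^0 are given by representatives; linearity is therefore an almost
   sure identity. *)
Definition cylindrical_rv (G : normedModType R) (X : G -> {RV P >-> R}) :=
  (forall (c : R) (g h : G),
    {ae P, forall w, X (c *: g + h) w = c * X g w + X h w}) /\
  (forall g, cvg_in_prob (X : G -> Omega -> R^o) (nbhs g) (X g)).

Definition cylindrical_levy_process (G : normedModType R)
    (L : R -> G -> {RV P >-> R}) :=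
  (forall t : R, 0 <= t -> cylindrical_rv (L t)) /\
  (forall n (g : 'I_n -> G),
    levy_process (fun t w => \row_(i < n) L t (g i) w)).

(* Real and imaginary parts of E[exp(i L(t)g)] = exp(-t |g|^alpha). *)
Definition canonical_stable (G : normedModType R) (alpha : R)
    (L : R -> G -> {RV P >-> R}) :=
  forall (t : R) (g : G), 0 <= t ->
    ('E_P[fun w => cos (L t g w)] = (expR (- (t * `|g| `^ alpha))%R)%:E)%E /\
    ('E_P[fun w => sin (L t g w)] = 0)%E.

Definition levy_filtration (G : normedModType R) (L : R -> G -> {RV P >-> R})
    (t : R) : set (set Omega) :=
  <<s [set A | exists (s : R) (g : G) (B : set R),
      [/\ 0 <= s <= t, measurable B & A = L s g @^-1` B]] >>.

End random_variables.

Section stochastic_integral.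
Context {d} {Omega : measurableType d} {R : realType} (P : probability Omega R).
Context {G H : hilbertType R} (a : set G).
Context (L : R -> G -> {RV P >-> R}) (T : R).

(* Here and in the integrals below, xget picks a representative of an almost
   surely unique random variable. *)
Definition radonified_increment (F : G -> H) (s t : R) : Omega -> H :=
  xget (cst 0) [set X | borel_measurable X /\
    forall h, {ae P, forall w,
      inner (X w) h = L t (adjoint F h) w - L s (adjoint F h) w}].

(* step_F 0 k and step_A 0 k describe the value at time 0; for 0 < i < step_n,
   step_F i k and step_A i k describe the value on ]step_t i, step_t i.+1]. The
   grid points are step_t 1, ..., step_t step_n. *)
Record step (V : Type) := Step {
  step_n : nat ;
  step_t : nat -> R ;
  step_N : nat -> nat ;
  step_F : nat -> nat -> V ;
  step_A : nat -> nat -> set Omega }.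

Definition adapted_step (V : Type) (Op : set V) (S : step V) :=
  [/\ step_t S 1 = 0, step_t S (step_n S) = T & (1 < step_n S)%N] /\
  [/\ forall i, (0 < i < step_n S)%N -> step_t S i < step_t S i.+1,
      forall i k, (i < step_n S)%N -> (k < step_N S i)%N -> Op (step_F S i k),
      forall k, (k < step_N S 0)%N -> levy_filtration L 0 (step_A S 0 k) &
      forall i k, (0 < i < step_n S)%N -> (k < step_N S i)%N ->
        levy_filtration L (step_t S i) (step_A S i k)].

Definition step_value (U : Type) (S : step (U -> H)) (w : Omega) (t : R) (u : U)
    : H :=
  \1_[set 0] t *: (\sum_(k < step_N S 0) \1_(step_A S 0 k) w *: step_F S 0 k u)
  + \sum_(1 <= i < step_n S) \1_(`]step_t S i, step_t S i.+1]) t *: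
      (\sum_(k < step_N S i) \1_(step_A S i k) w *: step_F S i k u).

(* Processes are indexed by R, but only their values at times in [0, T] matter. *)
Definition represents (U : Type) (S : step (U -> H)) (Psi : Omega -> R -> U -> H) :=
  forall w t, 0 <= t <= T -> Psi w t = step_value S w t.

Definition step_hs : set (Omega -> R -> G -> H) :=
  [set Psi | exists2 S, adapted_step (hs_op a) S & represents S Psi].

Definition step_op1 : set (Omega -> R -> H -> H) :=
  [set Gam | (exists2 S, adapted_step (@bounded_op R H H) S & represents S Gam)
    /\ forall w t, 0 <= t <= T -> (op_norm (Gam w t) <= 1)%E].

Definition step_sum (S : step (G -> H)) (w : Omega) : H :=
  \sum_(1 <= i < step_n S) \sum_(k < step_N S i)
    \1_(step_A S i k) w *:
      radonified_increment (step_F S i k) (step_t S i) (step_t S i.+1) w.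

Definition step_integral (Psi : Omega -> R -> G -> H) : Omega -> H :=
  xget (cst 0) [set I | exists S,
    [/\ adapted_step (hs_op a) S, represents S Psi & I = step_sum S]].

(* A sigma-algebra on the subset setT `*` [0, T] of Omega * R. *)
Definition predictable_sigma : set (set (Omega * R)) :=
  <<s setT `*` `[0, T],
    [set C | (exists (s t : R) B, [/\ 0 <= s, s < t, t <= T, levy_filtration L s B &
               C = B `*` `]s, t]]) \/
             (exists2 B, levy_filtration L 0 B & C = B `*` [set 0])] >>.

Definition predictable (Psi : Omega -> R -> G -> H) :=
  (forall w t, 0 <= t <= T -> hs_op a (Psi w t)) /\
  forall O, <<s hs_op a, hs_open a >> O ->
    predictable_sigma [set z | 0 <= z.2 <= T /\ O (Psi z.1 z.2)].

Definition op_comp (Gam : Omega -> R -> H -> H) (Psi : Omega -> R -> G -> H) :=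
  fun w t => Gam w t \o Psi w t.

Definition approximates (Psis : nat -> Omega -> R -> G -> H)
    (Psi : Omega -> R -> G -> H) :=
  [/\ forall n, step_hs (Psis n),
      {ae (P \x @lebesgue_measure R)%E, forall z, 0 <= z.2 <= T ->
        hs_norm a (Psis n z.1 z.2 \- Psi z.1 z.2) @[n --> \oo] --> 0%E} &
      ereal_sup [set expect_min1 P (step_integral
          (op_comp Gam (fun w t => Psis mn.1 w t \- Psis mn.2 w t)))
        | Gam in step_op1] @[mn --> (\oo, \oo)] --> 0%E].

Definition hs_integrable : set (Omega -> R -> G -> H) :=
  [set Psi | predictable Psi /\ exists Psis, approximates Psis Psi].

Definition stoch_integral (Psi : Omega -> R -> G -> H) : Omega -> H :=
  xget (cst 0) [set I | borel_measurable I /\ exists2 Psis,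
    approximates Psis Psi &
    cvg_in_prob P (fun n => step_integral (Psis n)) \oo I].

Definition Lalpha_norm (alpha : R) (f : R -> G -> H) : \bar R :=
  let I := (\int[lebesgue_measure]_(t in `[0%R, T]) (hs_norm a (f t) `^ alpha))%E
  in if 1 <= alpha then (I `^ alpha^-1)%E else I.

Definition Lalpha_triple_norm (alpha : R) (Psi : Omega -> R -> G -> H) : \bar R :=
  (\int[P]_w Order.min (Lalpha_norm alpha (Psi w)) 1)%E.

End stochastic_integral.

(* Main.v *)
Require Import Defs.
From mathcomp Require Import all_boot all_order all_algebra.
From mathcomp Require Import all_classical all_reals all_analysis.
From mathcomp Require Import measurable_realfun.
From mathcomp Require Import ring lra.

Set Implicit Arguments.
Unset Strict Implicit.
Unset Printing Implicit Defensive.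

Import Order.TTheory GRing.Theory Num.Theory.
Import numFieldNormedType.Exports.

Local Open Scope classical_set_scope.
Local Open Scope ring_scope.

(** * Hilbert spaces *)

Section hilbert.
Context {R : realType} {H : hilbertType R}.
Implicit Types (x y z : H) (c : R).

Lemma innerDl x y z : inner (x + y) z = inner x z + inner y z.
Proof. exact: linearDl. Qed.

Lemma innerDr x y z : inner z (x + y) = inner z x + inner z y.
Proof. exact: linearDr. Qed.

Lemma innerZl c x z : inner (c *: x) z = c * inner x z.
Proof. exact: linearZl_LR. Qed.

Lemma innerZr c x z : inner z (c *: x) = c * inner z x.
Proof. exact: linearZr_LR. Qed.

Lemma innerC x y : inner x y = inner y x.
Proof. by rewrite hermC /= expr0 mul1r. Qed.

Lemma inner0l x : inner 0 x = 0. Proof. exact: linear0l. Qed.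
Lemma inner0r x : inner x 0 = 0. Proof. exact: linear0r. Qed.

Lemma innerNl x y : inner (- x) y = - inner x y. Proof. exact: linearNl. Qed.
Lemma innerNr x y : inner x (- y) = - inner x y. Proof. exact: linearNr. Qed.

Lemma innerBl x y z : inner (x - y) z = inner x z - inner y z.
Proof. exact: linearBl. Qed.

Lemma innerBr x y z : inner z (x - y) = inner z x - inner z y.
Proof. exact: linearBr. Qed.

Lemma inner_suml I (r : seq I) (E : I -> H) z :
  inner (\sum_(i <- r) E i) z = \sum_(i <- r) inner (E i) z.
Proof. exact: linear_sumlz. Qed.

Lemma inner_sumr I (r : seq I) (E : I -> H) z :
  inner z (\sum_(i <- r) E i) = \sum_(i <- r) inner z (E i).
Proof. exact: linear_sumr. Qed.

Lemma sqr_normD x y : `|x + y| ^+ 2 = `|x| ^+ 2 + 2 * inner x y + `|y| ^+ 2.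
Proof.
rewrite -!inner_normE !innerDl !innerDr (innerC y x); ring.
Qed.

Lemma sqr_normB x y : `|x - y| ^+ 2 = `|x| ^+ 2 - 2 * inner x y + `|y| ^+ 2.
Proof. rewrite sqr_normD innerNr normrN; ring. Qed.

Lemma cauchy_schwarz x y : `|inner x y| <= `|x| * `|y|.
Proof.
have [->|y0] := eqVneq y 0; first by rewrite inner0r !normr0 mulr0.
have yp : 0 < `|y| ^+ 2 by rewrite exprn_gt0 ?normr_gt0.
rewrite -(@ler_pXn2r _ 2) ?nnegrE ?mulr_ge0// exprMn real_normK ?num_real//.
have := sqr_ge0 `| `|y| ^+ 2 *: x - inner x y *: y|.
rewrite sqr_normB innerZl innerZr !normrZ !exprMn.
rewrite !(real_normK (num_real _)).
set n := `|y| ^+ 2; set m := `|x| ^+ 2; set i := inner x y => h.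
have : 0 <= n * (m * n - i ^+ 2) by apply: le_trans h _; lra.
by rewrite pmulr_rge0// subr_ge0.
Qed.

Lemma cvg_inner (T : Type) (F : set_system T) {FF : Filter F} (u : T -> H) x h :
  u @ F --> x -> inner (u t) h @[t --> F] --> inner x h.
Proof.
move=> ux; apply/cvgrPdist_lt => e e0.
have p : 0 < `|h| + 1 by rewrite ltr_pwDr.
move/cvgrPdist_lt : ux => /(_ (e / (`|h| + 1)) (divr_gt0 e0 p)).
apply: filterS => t ht; rewrite -innerBl.
apply: le_lt_trans (cauchy_schwarz _ _) _.
rewrite ltr_pdivlMr// in ht; apply: le_lt_trans ht.
by rewrite ler_wpM2l// lerDl.
Qed.

Lemma inner_eq x y : (forall z, inner x z = inner y z) -> x = y.
Proof.
move=> h; apply/subr0_eq/normr0_eq0/eqP; rewrite -sqrf_eq0; apply/eqP.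
by rewrite -inner_normE innerBl h subrr.
Qed.

End hilbert.
Arguments cvg_inner {R H T F FF u x} h _.

Lemma nat_cauchy_cvg (R : realType) (V : completeNormedModType R) (u : nat -> V) :
  (forall e : R, 0 < e -> exists N, forall m n, (N <= m)%N -> (N <= n)%N ->
     `|u m - u n| < e) -> cvgn u.
Proof.
move=> h; apply: cauchy_cvg; apply: cauchy_exP => e e0.
have [N hN] := h _ e0; exists (u N).
exists N => // n /= Nn; rewrite -ball_normE /=; exact: hN.
Qed.

(** ** Orthonormal families *)

(** Zero vectors are allowed, so that the Gram-Schmidt process can be indexed
    by all of nat whatever the dimension. *)
Definition orthonormal0 (R : realType) (H : hilbertType R) (I : eqType)
    (D : set I) (e : I -> H) :=
  (forall i j, D i -> D j -> i != j -> inner (e i) (e j) = 0) /\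
  (forall i, D i -> inner (e i) (e i) = 0 \/ inner (e i) (e i) = 1).

Section orthonormal.
Context {R : realType} {H : hilbertType R} {I : choiceType}.
Variables (D : set I) (e : I -> H).
Hypothesis oe : orthonormal0 D e.

Lemma inner_orth_sum (X : seq I) (c : I -> R) j : uniq X -> {in X, forall i, D i} ->
  j \in X -> inner (\sum_(i <- X) c i *: e i) (e j) = c j * inner (e j) (e j).
Proof.
move=> uX XD jX; rewrite inner_suml (bigD1_seq j)//= innerZl big1_seq ?addr0//.
move=> i /andP[ij iX]; rewrite innerZl (oe.1 i j) ?mulr0//; exact: XD.
Qed.

Lemma inner_orth_idem j x : D j ->
  inner x (e j) * inner (e j) (e j) = inner x (e j).
Proof.
move=> Dj; case: (oe.2 _ Dj) => E; last by rewrite E mulr1.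
move: E; rewrite inner_normE => /eqP; rewrite sqrf_eq0 normr_eq0 => /eqP ->.
by rewrite inner0r mul0r.
Qed.

Lemma sqr_norm_orth_sum (X : seq I) (c : I -> R) : uniq X -> {in X, forall i, D i} ->
  `|\sum_(i <- X) c i *: e i| ^+ 2 = \sum_(i <- X) c i ^+ 2 * inner (e i) (e i).
Proof.
move=> uX XD; rewrite -inner_normE inner_sumr; apply: eq_big_seq => j jX.
rewrite innerZr inner_orth_sum//; ring.
Qed.

Lemma sqr_norm_orth_sum_le (X : seq I) (c : I -> R) : uniq X ->
  {in X, forall i, D i} ->
  `|\sum_(i <- X) c i *: e i| ^+ 2 <= \sum_(i <- X) c i ^+ 2.
Proof.
move=> uX XD; rewrite sqr_norm_orth_sum// big_seq [leRHS]big_seq.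
apply: ler_sum => i iX; case: (oe.2 _ (XD _ iX)) => ->; rewrite ?mulr1// mulr0.
exact: sqr_ge0.
Qed.

Lemma bessel_eq (X : seq I) x : uniq X -> {in X, forall i, D i} ->
  `|x - \sum_(i <- X) inner x (e i) *: e i| ^+ 2 =
  `|x| ^+ 2 - \sum_(i <- X) inner x (e i) ^+ 2.
Proof.
move=> uX XD; rewrite sqr_normB sqr_norm_orth_sum// inner_sumr.
have -> : \sum_(i <- X) inner x (e i) ^+ 2 * inner (e i) (e i) =
    \sum_(i <- X) inner x (e i) ^+ 2.
  by apply: eq_big_seq => i iX; rewrite expr2 -mulrA inner_orth_idem//; exact: XD.
have -> : \sum_(i <- X) inner x (inner x (e i) *: e i) =
    \sum_(i <- X) inner x (e i) ^+ 2.
  by apply: eq_big_seq => i iX; rewrite innerZr expr2.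
ring.
Qed.

(** The orthogonal projection is the best approximation. *)
Lemma bessel_approx (X : seq I) (c : I -> R) x : uniq X -> {in X, forall i, D i} ->
  `|x| ^+ 2 - \sum_(i <- X) inner x (e i) ^+ 2 <=
  `|x - \sum_(i <- X) c i *: e i| ^+ 2.
Proof.
move=> uX XD; rewrite sqr_normB inner_sumr sqr_norm_orth_sum//.
rewrite -addrA lerD2l lerNl opprD opprK mulr_sumr -sumrB.
rewrite big_seq [leRHS]big_seq; apply: ler_sum => i iX.
rewrite innerZr; have := inner_orth_idem x (XD _ iX).
case: (oe.2 _ (XD _ iX)) => ->; first by rewrite !mulr0 => <-; nra.
have := sqr_ge0 (inner x (e i) - c i); nra.
Qed.

Lemma bessel (X : seq I) x : uniq X -> {in X, forall i, D i} ->
  \sum_(i <- X) inner x (e i) ^+ 2 <= `|x| ^+ 2.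
Proof. by move=> uX XD; rewrite -subr_ge0 -bessel_eq// sqr_ge0. Qed.

End orthonormal.

(** ** Parseval's identity *)

Section orthonormal_seq.
Context {R : realType} {H : hilbertType R}.

Definition total_seq (e : nat -> H) :=
  orthonormal0 [set: nat] e /\
  forall x (r : R), 0 < r -> exists N (c : nat -> R),
    `|x - \sum_(k < N) c k *: e k| < r.

Lemma iota_setT n : {in index_iota 0 n, forall i, [set: nat] i}.
Proof. by []. Qed.

Lemma gram_schmidt_step (d : nat -> H) :
  exists e : nat -> H, orthonormal0 [set: nat] e /\
    forall n, exists c : nat -> R, d n = \sum_(k < n.+1) c k *: e k.
Proof.
pose r (d : H) (s : seq H) := d - \sum_(v <- s) inner d v *: v.
pose g := fix g n := if n is m.+1 then rcons (g m) (`|r (d m) (g m)|^-1 *: r (d m) (g m)) else [::].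
pose e n := `|r (d n) (g n)|^-1 *: r (d n) (g n).
have gE n : g n = map e (iota 0 n).
  elim: n => [//|n IH]; rewrite -[in RHS]addn1 iotaD map_cat -IH.
  by rewrite /= cats1 add0n.
have rE n : r (d n) (g n) = d n - \sum_(k <- index_iota 0 n) inner (d n) (e k) *: e k.
  by rewrite /r gE big_map /index_iota subn0.
have eN n : inner (e n) (e n) = 0 \/ inner (e n) (e n) = 1.
  rewrite /e; set v := r _ _; have [->|v0] := eqVneq v 0.
    by left; rewrite scaler0 inner0l.
  right; rewrite innerZl innerZr inner_normE expr2.
  have : `|v| != 0 by rewrite normr_eq0.
  move=> ?; by field.
have orth n : forall i, (i < n)%N -> inner (e n) (e i) = 0.
  elim/ltn_ind: n => n IH i lin.
  have on : orthonormal0 [set k | (k < n)%N] e.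
    split=> [j k /= jn kn jk|j _]; last exact: eN.
    move: jk; rewrite neq_ltn => /orP[]jk; last exact: IH.
    by rewrite innerC; exact: IH.
  rewrite {1}/e innerZl rE innerBl.
  rewrite (inner_orth_sum on) ?iota_uniq ?mem_index_iota//; last first.
    by move=> k; rewrite mem_index_iota.
  by rewrite (inner_orth_idem on)// subrr mulr0.
exists e; split.
  split=> [i j _ _|i _]; last exact: eN.
  by rewrite neq_ltn => /orP[]ij; [rewrite innerC|]; exact: orth.
move=> n; exists (fun k => if k == n then `|r (d n) (g n)| else inner (d n) (e k)).
rewrite big_ord_recr /= eqxx.
have -> : `|r (d n) (g n)| *: e n = r (d n) (g n).
  rewrite /e scalerA; have [->|v0] := eqVneq (r (d n) (g n)) 0; first by rewrite scaler0.
  by rewrite divff ?scale1r// normr_eq0.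
rewrite rE big_mkord addrC -[LHS](subrK (\sum_(i < n) inner (d n) (e i) *: e i)).
congr (_ + _); apply: eq_bigr => i _; by rewrite ltn_eqF.
Qed.

Lemma separable_total_seq : separable H -> exists e : nat -> H, total_seq e.
Proof.
case=> D cD dD.
have [d dE] : exists d : nat -> H, D `<=` range d.
  have [f fi] := countable_injP _ cD.
  exists (fun n => xget 0 [set x | D x /\ f x = n]) => x Dx; exists (f x) => //.
  have [Dy fy] := xgetPex 0 (ex_intro _ x (conj Dx erefl) : exists y, D y /\ f y = f x).
  by apply: fi => //; rewrite inE.
have [e [oe de]] := gram_schmidt_step d.
exists e; split => // x r r0.
have [||y [yB Dy]] := dD (ball x r); first by exists x; exact: ballxx.
  exact: ball_open.
have [n _ dn] := dE _ Dy; have [c cE] := de n.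
exists n.+1, c; rewrite -cE dn.
by move: yB; rewrite -ball_normE.
Qed.

Context (e : nat -> H) (te : total_seq e).

Lemma total_bessel x N : \sum_(k < N) inner x (e k) ^+ 2 <= `|x| ^+ 2.
Proof.
by rewrite -(big_mkord predT (fun k => inner x (e k) ^+ 2))
  (bessel te.1)// iota_uniq.
Qed.

Lemma total_residual x N : `|x - \sum_(k < N) inner x (e k) *: e k| ^+ 2 =
  `|x| ^+ 2 - \sum_(k < N) inner x (e k) ^+ 2.
Proof.
rewrite -(big_mkord predT (fun k => inner x (e k) ^+ 2)).
rewrite -(big_mkord predT (fun k => inner x (e k) *: e k)).
by rewrite (bessel_eq te.1)// iota_uniq.
Qed.

Lemma sum_sqr_cvg x : \sum_(k < N) inner x (e k) ^+ 2 @[N --> \oo] --> `|x| ^+ 2.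
Proof.
apply/cvgrPdist_lt => r r0.
have sr0 : 0 < Num.sqrt r by rewrite sqrtr_gt0.
have [N [c hN]] := te.2 x _ sr0; exists N => // n /= Nn.
rewrite ger0_norm ?subr_ge0 ?total_bessel//.
apply: (@le_lt_trans _ _ (`|x| ^+ 2 - \sum_(k < N) inner x (e k) ^+ 2)).
  rewrite lerD2l lerN2 -!(big_mkord predT (fun k => inner x (e k) ^+ 2)).
  rewrite (@big_cat_nat _ _ _ N _ n)//= lerDl sumr_ge0// => i _; exact: sqr_ge0.
rewrite -(big_mkord predT (fun k => inner x (e k) ^+ 2)).
apply: (@le_lt_trans _ _ (`|x - \sum_(k < N) c k *: e k| ^+ 2)).
  rewrite -(big_mkord predT (fun k => c k *: e k)).
  by apply: (bessel_approx te.1) => //; rewrite iota_uniq.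
by rewrite -[ltRHS]sqr_sqrtr 1?ltW// ltr_pXn2r ?nnegrE// ltW.
Qed.

Lemma expansion_cvg x : \sum_(k < N) inner x (e k) *: e k @[N --> \oo] --> x.
Proof.
apply/cvgrPdist_lt => r r0; have r20 : 0 < r ^+ 2 by rewrite exprn_gt0.
have /cvgrPdist_lt/(_ _ r20) := @sum_sqr_cvg x.
apply: filterS => n; rewrite ger0_norm ?subr_ge0 ?total_bessel// -total_residual.
by rewrite ltr_pXn2r ?nnegrE// ltW.
Qed.

Lemma total_inner_eq x y : (forall k, inner x (e k) = inner y (e k)) -> x = y.
Proof.
move=> h; have h1 := @expansion_cvg x; have h2 := @expansion_cvg y.
have E : (fun N => \sum_(k < N) inner x (e k) *: e k) =
    (fun N => \sum_(k < N) inner y (e k) *: e k).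
  by apply/funext => N; apply: eq_bigr => k _; rewrite h.
by rewrite E in h1; exact: (norm_cvg_unique h1 h2).
Qed.

Lemma orth_series_cvg (c : nat -> R) (M : R) :
  (forall N, \sum_(k < N) c k ^+ 2 <= M) ->
  cvgn (fun N => \sum_(k < N) c k *: e k).
Proof.
move=> cM; pose s N := \sum_(k < N) c k ^+ 2.
have sle m n : (m <= n)%N -> s m <= s n.
  move=> mn; rewrite /s -!(big_mkord predT (fun k => c k ^+ 2)).
  rewrite (@big_cat_nat _ _ _ m _ n)//= lerDl sumr_ge0// => i _; exact: sqr_ge0.
have cs : cvgn s.
  apply: nondecreasing_is_cvgn; first exact: sle.
  by exists M => _ [n _ <-]; exact: cM.
apply: nat_cauchy_cvg => r r0.
have r20 : 0 < r ^+ 2 by rewrite exprn_gt0.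
move/cvgrPdist_lt : (cs) => /(_ _ r20) [N _ hN].
have hlt m n : (N <= m)%N -> (m <= n)%N ->
   `|\sum_(k < n) c k *: e k - \sum_(k < m) c k *: e k| < r.
  move=> Nm mn; rewrite -!(big_mkord predT (fun k => c k *: e k)).
  rewrite (@big_cat_nat _ _ _ m _ n)//=. rewrite addrAC subrr add0r.
  rewrite -(@ltr_pXn2r _ 2) ?nnegrE ?normr_ge0 1?ltW//.
  apply: le_lt_trans (sqr_norm_orth_sum_le te.1 _ _ _) _ => //; first exact: iota_uniq.
  have -> : \sum_(m <= i < n) c i ^+ 2 = s n - s m.
    rewrite /s -!(big_mkord predT (fun k => c k ^+ 2)).
    rewrite [X in _ = X - _](@big_cat_nat _ _ _ m _ n)//=.
    by rewrite addrAC subrr add0r.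
  apply: le_lt_trans (hN _ Nm); rewrite /= ger0_norm.
    by rewrite lerD2r (nondecreasing_cvgn_le sle cs n).
  by rewrite subr_ge0 (nondecreasing_cvgn_le sle cs m).
exists N => m n Nm Nn; case: (leqP m n) => [mn|/ltnW nm]; last exact: hlt.
by rewrite distrC; exact: hlt.
Qed.

(** The limit has the prescribed coordinates. A zero vector of the family must
    come with the coefficient zero. *)
Lemma orth_series_inner (c : nat -> R) x :
  (forall k, c k * inner (e k) (e k) = c k) ->
  \sum_(k < N) c k *: e k @[N --> \oo] --> x -> forall k, inner x (e k) = c k.
Proof.
move=> ck cx k; have h : inner (\sum_(j < N) c j *: e j) (e k) @[N --> \oo] --> inner x (e k).
  exact: cvg_inner.
suff h2 : inner (\sum_(k < N) c k *: e k) (e k) @[N --> \oo] --> c k.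
  exact: (cvg_unique (@Rhausdorff R) h h2).
apply/cvgrPdist_lt => r r0; exists k.+1 => // n /= kn.
rewrite -(big_mkord predT (fun k => c k *: e k)) (inner_orth_sum te.1)//.
- by rewrite ck subrr normr0.
- exact: iota_uniq.
- by rewrite mem_index_iota.
Qed.

End orthonormal_seq.

Section orthonormal_basis_theory.
Context {R : realType} {H : hilbertType R} (a : set H).
Hypothesis ba : orthonormal_basis a.

Lemma basis_orthonormal0 : orthonormal0 a id.
Proof.
split=> [i j ai aj ij|i ai]; first by rewrite (ba.1 _ _ ai aj) (negPf ij).
by right; rewrite (ba.1 _ _ ai ai) eqxx.
Qed.

Lemma basis_parseval x : (`|x| ^+ 2)%:E = \esum_(u in a) (inner x u ^+ 2)%:E.
Proof.
apply/eqP; rewrite eq_le; apply/andP; split; last first.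
  apply: ge_ereal_sup => _ [X [fX Xa] <-].
  rewrite fsbig_finite//= sumEFin lee_fin (bessel basis_orthonormal0)//.
  by move=> i; rewrite in_fset_set// inE => /Xa.
apply/lee_addgt0Pr => r r0; rewrite -leeBlDr//.
have sr0 : 0 < Num.sqrt r by rewrite sqrtr_gt0.
have [||y [yB [n [c [b [bA yE]]]]]] := ba.2 (ball x (Num.sqrt r)).
- by exists x; exact: ballxx.
- exact: ball_open.
pose X := undup [seq b i | i : 'I_n].
have Xa : {in X, forall i, a i}.
  by move=> i; rewrite mem_undup => /mapP[j _ ->]; exact: bA.
have fX : finite_set [set` X] by exact: finite_seq.
apply: esum_ge; exists [set` X].
  by split => // i /= iX; exact: Xa.
rewrite -fsbig_seq ?undup_uniq// sumEFin -EFinB lee_fin lerBlDl -lerBlDr.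
pose c' u := \sum_(i < n | b i == u) c i.
have yE' : y = \sum_(u <- X) c' u *: u.
  rewrite yE /c'; under [RHS]eq_bigr do rewrite scaler_suml.
  rewrite (exchange_big_dep predT)//=; apply: eq_bigr => i _.
  rewrite big_mkcond (bigD1_seq (b i)) ?undup_uniq ?eqxx//=; last first.
    by rewrite mem_undup; apply/mapP; exists i => //; rewrite mem_enum.
  by rewrite big1 ?addr0// => j; rewrite eq_sym => /negPf ->.
apply: le_trans (bessel_approx basis_orthonormal0 c' _ _ Xa) _; first exact: undup_uniq.
rewrite -yE'; move: yB; rewrite -ball_normE /= => /ltW yB.
by rewrite -[leRHS](sqr_sqrtr (ltW r0)) ler_pXn2r ?nnegrE ?sqrtr_ge0.
Qed.

End orthonormal_basis_theory.

(** * Bounded operators and adjoints *)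

Section linear_props.
Context {R : realType} {U V : normedModType R} (F : U -> V).
Hypothesis lF : linear F.

Lemma lin0 : F 0 = 0.
Proof. by have := lF 1 0 0; rewrite !scale1r addr0 -[LHS]addr0 => /addrI. Qed.

Lemma linD x y : F (x + y) = F x + F y.
Proof. by have := lF 1 x y; rewrite !scale1r. Qed.

Lemma linZ c x : F (c *: x) = c *: F x.
Proof. by have := lF c x 0; rewrite lin0 !addr0. Qed.

Lemma linN x : F (- x) = - F x.
Proof. by rewrite -scaleN1r linZ scaleN1r. Qed.

Lemma linB x y : F (x - y) = F x - F y.
Proof. by rewrite linD linN. Qed.

Lemma lin_sum I (r : seq I) (E : I -> U) :
  F (\sum_(i <- r) E i) = \sum_(i <- r) F (E i).
Proof.
by elim: r => [|i r IH]; rewrite ?big_nil ?lin0// !big_cons linD IH.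
Qed.

End linear_props.

Section bounded_ops.
Context {R : realType}.

Lemma bounded_opP (U V : normedModType R) (F : U -> V) :
  bounded_op F <-> linear F /\ exists2 C : R, 0 < C & forall x, `|F x| <= C * `|x|.
Proof.
split=> [[lF cF]|[lF [C C0 hC]]]; split => //.
  have := cF 0; rewrite /continuous_at (lin0 lF) => /cvgrPdist_lt/(_ 1 ltr01).
  case/nbhs_ballP => d /= d0 hd.
  exists (2 / d) => [|x]; first by rewrite divr_gt0.
  have [->|x0] := eqVneq x 0; first by rewrite (lin0 lF) !normr0 mulr0.
  have xp : 0 < `|x| by rewrite normr_gt0.
  pose c := d / 2 / `|x|.
  have c0 : 0 < c by rewrite !divr_gt0.
  have : `|F (c *: x)| < 1.
    rewrite -[ltLHS]normrN -sub0r; apply: hd; rewrite -ball_normE /= sub0r normrN.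
    rewrite normrZ gtr0_norm// /c divfK ?gt_eqF//.
    by rewrite ltr_pdivrMr// ltr_pMr// ltr1n.
  rewrite (linZ lF) normrZ (gtr0_norm c0) => /ltW.
  rewrite -ler_pdivlMl// mulr1 => /le_trans; apply.
  by rewrite /c !invfM !invrK (mulrC _ 2).
move=> x; apply/cvgrPdist_lt => e e0.
have eC : 0 < e / C by rewrite divr_gt0.
apply/nbhs_ballP; exists (e / C) => // y; rewrite -ball_normE /= => xy.
rewrite -(linB lF); apply: le_lt_trans (hC _) _.
by rewrite -ltr_pdivlMl// mulrC.
Qed.

Lemma bounded_op_lin (U V : normedModType R) (F : U -> V) : bounded_op F -> linear F.
Proof. by case. Qed.

Lemma bounded_opZ (U V : normedModType R) (F : U -> V) (c : R) :
  bounded_op F -> bounded_op (fun x => c *: F x).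
Proof.
case/bounded_opP => lF [C C0 hC]; apply/bounded_opP; split=> [k u v|].
  by rewrite lF scalerDr !scalerA mulrC.
exists (`|c| * C + 1) => [|x].
  by rewrite ltr_wpDl// mulr_ge0// ltW.
rewrite normrZ mulrDl mul1r -mulrA; apply: ler_wpDr => //.
by rewrite ler_wpM2l.
Qed.

Lemma bounded_opD (U V : normedModType R) (F F' : U -> V) :
  bounded_op F -> bounded_op F' -> bounded_op (fun x => F x + F' x).
Proof.
move=> /bounded_opP[lF [C C0 hC]] /bounded_opP[lF' [C' C'0 hC']].
apply/bounded_opP; split=> [k u v|]; first by rewrite lF lF' scalerDr addrACA.
exists (C + C') => [|x]; first by rewrite addr_gt0.
by rewrite mulrDl (le_trans (ler_normD _ _))// lerD.
Qed.

Lemma bounded_op0 (U V : normedModType R) : bounded_op (fun _ : U => 0 : V).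
Proof.
apply/bounded_opP; split=> [k u v|]; first by rewrite scaler0 addr0.
by exists 1 => // x; rewrite normr0 mul1r.
Qed.

Lemma bounded_op_id (U : normedModType R) : bounded_op (fun x : U => x).
Proof. by apply/bounded_opP; split => //; exists 1 => // x; rewrite mul1r. Qed.

Lemma bounded_op_comp (U V W : normedModType R) (F : U -> V) (G : V -> W) :
  bounded_op G -> bounded_op F -> bounded_op (G \o F).
Proof.
move=> /bounded_opP[lG [C C0 hC]] /bounded_opP[lF [C' C'0 hC']].
apply/bounded_opP; split=> [k u v|]; first by rewrite /= lF lG.
exists (C * C') => [|x]; first by rewrite mulr_gt0.
by rewrite (le_trans (hC _))// -mulrA ler_wpM2l// ltW.
Qed.

Lemma op_norm_le1P (U : normedModType R) (F : U -> U) : linear F ->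
  (op_norm F <= 1)%E <-> forall x, `|F x| <= `|x|.
Proof.
move=> lF; split=> [h x|h]; last first.
  by apply: ge_ereal_sup => _ [x /= x1 <-]; rewrite lee_fin (le_trans (h _)).
have [->|x0] := eqVneq x 0; first by rewrite (lin0 lF).
have xp : 0 < `|x| by rewrite normr_gt0.
have x1 : `| `|x|^-1 *: x| <= 1.
  by rewrite normrZ normfV normr_id mulVf ?gt_eqF.
have : (`|F (`|x|^-1 *: x)|%:E <= 1)%E.
  by apply: le_trans h; apply: ereal_sup_ubound; exists (`|x|^-1 *: x).
rewrite lee_fin (linZ lF) normrZ normfV normr_id.
by rewrite -ler_pdivlMl ?invr_gt0// invrK mulr1.
Qed.

End bounded_ops.

Section riesz.
Context {R : realType} {U : hilbertType R}.

(** The Fourier coefficients of a bounded functional are square summable, so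
    they are those of a vector. *)
Lemma riesz (phi : U -> R) (C : R) : separable U ->
  (forall c u v, phi (c *: u + v) = c * phi u + phi v) ->
  (forall x, `|phi x| <= C * `|x|) ->
  exists v, forall g, phi g = inner g v.
Proof.
move=> /separable_total_seq[e te] lphi bphi.
have lp : linear (phi : U -> R^o) by [].
pose s (N : nat) := \sum_(k < N) phi (e k) ^+ 2.
have s0 N : 0 <= s N by apply: sumr_ge0 => i _; exact: sqr_ge0.
have sC N : s N <= C ^+ 2.
  have C0 : 0 <= C ^+ 2 by exact: sqr_ge0.
  pose w := \sum_(k < N) phi (e k) *: e k.
  have w2 : `|w| ^+ 2 <= s N.
    rewrite /w /s -(big_mkord predT (fun k => phi (e k) *: e k)).
    rewrite -(big_mkord predT (fun k => phi (e k) ^+ 2)).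
    by apply: (sqr_norm_orth_sum_le te.1); rewrite ?iota_uniq.
  have pw : phi w = s N.
    rewrite /w (lin_sum lp); apply: eq_bigr => k _.
    by rewrite (linZ lp) expr2.
  have := bphi w; rewrite pw ger0_norm// => h.
  have : s N ^+ 2 <= C ^+ 2 * s N.
    apply: (@le_trans _ _ ((C * `|w|) ^+ 2)).
      by rewrite ler_pXn2r ?nnegrE// (le_trans _ h).
    by rewrite exprMn ler_wpM2l.
  have [->//|sn0] := eqVneq (s N) 0.
  by rewrite expr2 ler_pM2r// lt_def sn0 s0.
have /cvg_ex[/= v hv] := orth_series_cvg te (c := fun k => phi (e k)) sC.
have ek k : phi (e k) * inner (e k) (e k) = phi (e k).
  case: (te.1.2 k I) => E; last by rewrite E mulr1.
  move: E; rewrite inner_normE => /eqP; rewrite sqrf_eq0 normr_eq0 => /eqP ->.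
  by rewrite (lin0 lp) mul0r.
have ve k := @orth_series_inner _ _ _ te (fun k => phi (e k)) v ek hv k.
exists v => g.
have h1 : phi (\sum_(k < N) inner g (e k) *: e k) @[N --> \oo] --> phi g.
  apply/cvgrPdist_lt => r r0.
  have C1 : 0 < `|C| + 1 by rewrite ltr_wpDl.
  move/cvgrPdist_lt : (expansion_cvg te (x := g)) => /(_ _ (divr_gt0 r0 C1)).
  apply: filterS => N hN; rewrite -(linB lp).
  apply: le_lt_trans (bphi _) _; rewrite ltr_pdivlMr// in hN.
  apply: le_lt_trans hN; rewrite mulrC ler_wpM2l//.
  by rewrite (le_trans (ler_norm _))// lerDl.
have h2 : inner (\sum_(k < N) inner g (e k) *: e k) v @[N --> \oo] --> inner g v.
  by apply: cvg_inner; exact: (expansion_cvg te).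
have E : (fun N : nat => phi (\sum_(k < N) inner g (e k) *: e k)) =
    (fun N : nat => inner (\sum_(k < N) inner g (e k) *: e k) v).
  apply/funext => N; rewrite (lin_sum lp) inner_suml; apply: eq_bigr => k _.
  by rewrite (linZ lp) innerZl (innerC (e k)) ve.
rewrite E in h1; exact: (cvg_unique (@Rhausdorff R) h1 h2).
Qed.

End riesz.

Section adjoints.
Context {R : realType} {U V : hilbertType R}.
Hypothesis sepU : separable U.
Implicit Types F : U -> V.

Lemma adjointP F : bounded_op F -> forall h g, inner (F g) h = inner g (adjoint F h).
Proof.
case/bounded_opP => lF [C C0 hC] h.
have /(xgetPex 0) : exists v, forall g, inner (F g) h = inner g v.
  apply: (@riesz _ _ _ (C * `|h|) sepU) => [c u v|x].
    by rewrite lF innerDl innerZl.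
  rewrite (le_trans (cauchy_schwarz _ _))// mulrAC ler_wpM2r//.
by [].
Qed.

Lemma adjoint_unique F h v : bounded_op F ->
  (forall g, inner (F g) h = inner g v) -> adjoint F h = v.
Proof.
by move=> bF hv; apply: inner_eq => g; rewrite innerC -adjointP// hv innerC.
Qed.

Lemma adjoint_linear F c h k : bounded_op F ->
  adjoint F (c *: h + k) = c *: adjoint F h + adjoint F k.
Proof.
move=> bF; apply: adjoint_unique => // g.
by rewrite !innerDr !innerZr !adjointP.
Qed.

Lemma adjoint0r F : bounded_op F -> adjoint F 0 = 0.
Proof. by move=> bF; apply: adjoint_unique => // g; rewrite !inner0r. Qed.

Lemma adjointZr F c h : bounded_op F -> adjoint F (c *: h) = c *: adjoint F h.
Proof.
by move=> bF; have := adjoint_linear c h 0 bF; rewrite adjoint0r// !addr0.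
Qed.

Lemma adjointDr F h k : bounded_op F -> adjoint F (h + k) = adjoint F h + adjoint F k.
Proof. by move=> bF; have := adjoint_linear 1 h k bF; rewrite !scale1r. Qed.

Lemma adjointNr F h : bounded_op F -> adjoint F (- h) = - adjoint F h.
Proof. by move=> bF; rewrite -scaleN1r adjointZr// scaleN1r. Qed.

Lemma adjointD F F' h : bounded_op F -> bounded_op F' ->
  adjoint (fun x => F x + F' x) h = adjoint F h + adjoint F' h.
Proof.
move=> bF bF'; apply: adjoint_unique; first exact: bounded_opD.
by move=> g; rewrite innerDl innerDr !adjointP.
Qed.

Lemma adjointZ F c h : bounded_op F ->
  adjoint (fun x => c *: F x) h = c *: adjoint F h.
Proof.
move=> bF; apply: adjoint_unique; first exact: bounded_opZ.
by move=> g; rewrite innerZl innerZr !adjointP.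
Qed.

Lemma adjoint_op0 h : adjoint (fun _ : U => 0 : V) h = 0.
Proof.
apply: adjoint_unique; first exact: bounded_op0.
by move=> g; rewrite inner0l inner0r.
Qed.

Lemma adjoint_sum (I : Type) (r : seq I) (E : I -> U -> V) h :
  (forall i, bounded_op (E i)) ->
  bounded_op (fun x => \sum_(i <- r) E i x) /\
  adjoint (fun x => \sum_(i <- r) E i x) h = \sum_(i <- r) adjoint (E i) h.
Proof.
move=> bE; elim: r => [|i r [b1 IH]].
  rewrite (_ : (fun _ => _) = (fun=> 0)); last by apply/funext => x; rewrite big_nil.
  by rewrite big_nil adjoint_op0; split => //; exact: bounded_op0.
rewrite (_ : (fun _ => _) = (fun x => E i x + \sum_(j <- r) E j x)); last first.
  by apply/funext => x; rewrite big_cons.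
by rewrite big_cons adjointD// IH; split => //; exact: bounded_opD.
Qed.

End adjoints.

(** * Hilbert-Schmidt operators *)

Section hs.
Context {R : realType} {U V : hilbertType R}.
Hypothesis sepU : separable U.
Context (a : set U) (ba : orthonormal_basis a) (e : nat -> V) (te : total_seq e).
Implicit Types F : U -> V.

Lemma total_parseval (x : V) :
  (`|x| ^+ 2)%:E = \esum_(k in [set: nat]) (inner x (e k) ^+ 2)%:E.
Proof.
rewrite -nneseries_esumT => [|n]; last by rewrite lee_fin sqr_ge0.
apply/esym/cvg_lim => //.
under eq_fun do rewrite sumEFin big_mkord.
by apply: cvg_EFin; [exact: nearW|exact: sum_sqr_cvg].
Qed.

Lemma exchange_esum (T1 T2 : choiceType) (A : set T1) (B : set T2)
    (f : T1 -> T2 -> \bar R) : (forall i j, (0 <= f i j)%E) ->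
  \esum_(i in A) \esum_(j in B) f i j = \esum_(j in B) \esum_(i in A) f i j.
Proof.
move=> f0; rewrite (@esum_esum _ _ _ A (fun=> B)) //.
rewrite (@esum_esum _ _ _ B (fun=> A)) //.
rewrite (@reindex_esum _ _ _ (B `*`` fun=> A) _ (fun p => (p.2, p.1)))//.
split=> [[x y] [? ?]//||[x y] [? ?]]; first by move=> [x y] [x' y'] _ _ [-> ->].
by exists (y, x).
Qed.

(** Expanding both ways the double sum of the squared matrix entries. *)
Lemma hs_parseval F : bounded_op F ->
  \esum_(u in a) (`|F u| ^+ 2)%:E =
  \esum_(k in [set: nat]) (`|adjoint F (e k)| ^+ 2)%:E.
Proof.
move=> bF; under eq_esum do rewrite total_parseval.
rewrite exchange_esum => [|i j]; last by rewrite lee_fin sqr_ge0.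
apply: eq_esum => k _; rewrite (basis_parseval ba); apply: eq_esum => u _.
by rewrite adjointP// innerC.
Qed.

Definition hsq F N : R := \sum_(k < N) `|adjoint F (e k)| ^+ 2.

Lemma hsq_ge0 F N : 0 <= hsq F N.
Proof. by apply: sumr_ge0 => i _; exact: sqr_ge0. Qed.

Lemma hsq_nd F : {homo hsq F : m n / (m <= n)%N >-> m <= n}.
Proof.
move=> m n mn; rewrite /hsq -!(big_mkord predT (fun k => `|adjoint F (e k)| ^+ 2)).
rewrite (@big_cat_nat _ _ _ m _ n)//= lerDl sumr_ge0// => i _; exact: sqr_ge0.
Qed.

Lemma hs_norm_ge0 F : (0 <= hs_norm a F)%E.
Proof. exact: sqrte_ge0. Qed.

Lemma hsq_cvg F : bounded_op F -> ((hsq F N)%:E @[N --> \oo] --> hs_norm a F ^+ 2)%E.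
Proof.
move=> bF; rewrite /hs_norm sqr_sqrte; last first.
  by apply: esum_ge0 => i _; rewrite lee_fin sqr_ge0.
rewrite hs_parseval// -nneseries_esumT => [|n]; last by rewrite lee_fin sqr_ge0.
under eq_fun do rewrite -sumEFin -(big_mkord predT (fun k => (`|adjoint F (e k)| ^+ 2)%:E)).
by apply: is_cvg_nneseries => n _ _; rewrite lee_fin sqr_ge0.
Qed.

Lemma hs_normP F (C : R) : bounded_op F -> 0 <= C ->
  (hs_norm a F <= C%:E)%E <-> forall N, hsq F N <= C ^+ 2.
Proof.
move=> bF C0; split=> [h N|h].
  have : (hs_norm a F ^+ 2 <= (C ^+ 2)%:E)%E.
    by rewrite EFin_expe lee_sqr// ?hs_norm_ge0 ?lee_fin.
  rewrite -lee_fin; apply: le_trans; have hc := hsq_cvg bF.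
  rewrite -(cvg_lim _ hc)//; apply: lime_ge; first by apply/cvg_ex; eexists; exact: hc.
  by exists N => // M /= NM; rewrite lee_fin; exact: hsq_nd.
have hc := hsq_cvg bF.
have : (hs_norm a F ^+ 2 <= (C ^+ 2)%:E)%E.
  rewrite -(cvg_lim _ hc)//; apply: lime_le; first by apply/cvg_ex; eexists; exact: hc.
  by apply: nearW => N; rewrite lee_fin.
by rewrite EFin_expe lee_sqr// ?hs_norm_ge0 ?lee_fin.
Qed.

Definition hsn F : R := fine (hs_norm a F).

Lemma hs_opE F : hs_op a F -> hs_norm a F = (hsn F)%:E.
Proof. by case=> _ h; rewrite fineK// fin_numE; move: h (hs_norm_ge0 F); case: hs_norm. Qed.

Lemma hsn_ge0 F : 0 <= hsn F.
Proof. by rewrite fine_ge0 ?hs_norm_ge0. Qed.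

Lemma hsq_le F N : hs_op a F -> hsq F N <= hsn F ^+ 2.
Proof.
by move=> hF; have [+ _] := hs_normP hF.1 (hsn_ge0 F); rewrite hs_opE//; apply.
Qed.

Lemma hsq_cvgR F : hs_op a F -> hsq F N @[N --> \oo] --> hsn F ^+ 2.
Proof.
move=> hF; have := hsq_cvg hF.1; rewrite hs_opE// -EFin_expe => h.
exact: (fine_cvg h).
Qed.

Lemma hs_op_leP F C : bounded_op F -> 0 <= C -> (hs_norm a F <= C%:E)%E ->
  hs_op a F /\ hsn F <= C.
Proof.
move=> bF C0 h; have hF : hs_op a F by split=> //; exact: le_lt_trans h (ltry _).
by split=> //; rewrite -lee_fin -hs_opE.
Qed.

Lemma hs_norm0 : hs_norm a (fun _ : U => 0 : V) = 0%E.
Proof.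
by rewrite /hs_norm esum1 ?sqrte0// => i _; rewrite normr0 expr0n.
Qed.

Lemma hs_op0 : hs_op a (fun _ : U => 0 : V).
Proof. by split; [exact: bounded_op0|rewrite hs_norm0]. Qed.

Lemma hs_norm_contract (W : hilbertType R) F (F' : U -> W) :
  (forall x, `|F' x| <= `|F x|) -> (hs_norm a F' <= hs_norm a F)%E.
Proof.
move=> h; rewrite /hs_norm lee_sqrt; last by apply: esum_ge0 => i _; rewrite lee_fin sqr_ge0.
by apply: le_esum => u _; rewrite lee_fin ler_pXn2r ?nnegrE.
Qed.

Lemma hs_opZ F c : hs_op a F ->
  hs_op a (fun x => c *: F x) /\ hsn (fun x => c *: F x) <= `|c| * hsn F.
Proof.
move=> hF; apply: hs_op_leP; first exact/bounded_opZ/hF.1.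
  by rewrite mulr_ge0// hsn_ge0.
have C0 : 0 <= `|c| * hsn F by rewrite mulr_ge0// hsn_ge0.
apply: (hs_normP (bounded_opZ c hF.1) C0).2 => N.
rewrite exprMn real_normK ?num_real//.
apply: (@le_trans _ _ (c ^+ 2 * hsq F N)); last by rewrite ler_wpM2l ?sqr_ge0 ?hsq_le.
rewrite /hsq mulr_sumr; apply: ler_sum => k _.
by rewrite adjointZ ?normrZ ?exprMn ?real_normK ?num_real//; exact: hF.1.
Qed.

Lemma hs_opD F F' : hs_op a F -> hs_op a F' ->
  hs_op a (fun x => F x + F' x) /\ hsn (fun x => F x + F' x) <= hsn F + hsn F'.
Proof.
move=> hF hF'; have bD := bounded_opD hF.1 hF'.1.
apply: hs_op_leP => //; first by rewrite addr_ge0// hsn_ge0.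
apply/lee_addgt0Pr => r r0; rewrite -EFinD.
have r2 : 0 < r / 2 by rewrite divr_gt0.
set A := hsn F; set B := hsn F'.
have -> : A + B + r = (A + r / 2) + (B + r / 2) by field.
have A0 : 0 < A + r / 2 by rewrite ltr_wpDl// hsn_ge0.
have B0 : 0 < B + r / 2 by rewrite ltr_wpDl// hsn_ge0.
have hA N : hsq F N <= (A + r / 2) ^+ 2.
  apply: le_trans (hsq_le _ hF) _.
  by rewrite ler_pXn2r ?nnegrE ?hsn_ge0 ?(ltW A0)// lerDl ltW.
have hB N : hsq F' N <= (B + r / 2) ^+ 2.
  apply: le_trans (hsq_le _ hF') _.
  by rewrite ler_pXn2r ?nnegrE ?hsn_ge0 ?(ltW B0)// lerDl ltW.
move: (A + _) (B + _) A0 B0 hA hB => p q p0 q0 hA hB.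
have pq0 : 0 <= p + q by rewrite addr_ge0// ltW.
apply: (hs_normP bD pq0).2 => N.
(* 2xy <= (q/p) x^2 + (p/q) y^2 *)
apply: (@le_trans _ _ ((1 + q / p) * hsq F N + (1 + p / q) * hsq F' N)).
  rewrite /hsq !mulr_sumr -big_split/=; apply: ler_sum => k _.
  rewrite adjointD; [|exact: sepU|exact: hF.1|exact: hF'.1].
  set x := adjoint F _; set y := adjoint F' _.
  apply: (@le_trans _ _ ((`|x| + `|y|) ^+ 2)).
    by rewrite ler_pXn2r ?nnegrE ?addr_ge0// ler_normD.
  rewrite -subr_ge0.
  have -> : (1 + q / p) * `|x| ^+ 2 + (1 + p / q) * `|y| ^+ 2 - (`|x| + `|y|) ^+ 2 =
      (q * `|x| - p * `|y|) ^+ 2 / (p * q).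
    by field; rewrite !gt_eqF.
  by rewrite divr_ge0 ?sqr_ge0// mulr_ge0// ltW.
apply: (@le_trans _ _ ((1 + q / p) * p ^+ 2 + (1 + p / q) * q ^+ 2)).
  by rewrite lerD// ler_wpM2l// addr_ge0// divr_ge0// ltW.
rewrite le_eqVlt; apply/orP; left; apply/eqP.
by field; rewrite !gt_eqF.
Qed.

Lemma hs_opB F F' : hs_op a F -> hs_op a F' ->
  hs_op a (fun x => F x - F' x) /\ hsn (fun x => F x - F' x) <= hsn F + hsn F'.
Proof.
move=> hF hF'; have [h1 h2] := hs_opZ (-1) hF'.
have [h3 h4] := hs_opD hF h1.
have -> : (fun x => F x - F' x) = (fun x => F x + -1 *: F' x).
  by apply/funext => x; rewrite scaleN1r.
split=> //; apply: le_trans h4 _; rewrite lerD2l (le_trans h2)//.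
by rewrite normrN1 mul1r.
Qed.

Lemma hs_op_sum (I : Type) (r : seq I) (E : I -> U -> V) :
  (forall i, hs_op a (E i)) -> hs_op a (fun x => \sum_(i <- r) E i x).
Proof.
move=> hE; elim: r => [|i r IH].
  rewrite (_ : (fun _ => _) = (fun=> 0)); first exact: hs_op0.
  by apply/funext => x; rewrite big_nil.
rewrite (_ : (fun _ => _) = (fun x => E i x + \sum_(j <- r) E j x)).
  exact: (hs_opD (hE i) IH).1.
by apply/funext => x; rewrite big_cons.
Qed.

Lemma hs_op_comp F (G : V -> V) : bounded_op G -> hs_op a F -> hs_op a (G \o F).
Proof.
move=> bG hF; have /bounded_opP[lG [C C0 hC]] := bG.
split; first exact: bounded_op_comp bG hF.1.
have [h _] := hs_opZ C hF; apply: le_lt_trans h.2.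
by apply: hs_norm_contract => x; rewrite /= normrZ gtr0_norm.
Qed.

End hs.


(** * Averages over random signs *)

Section scalar_inequalities.
Context {R : realType}.
Implicit Types x y z : R.

Lemma sin_ge_mulr_cos z : 0 <= z -> exists2 c : R, 0 <= c <= z & sin z = cos c * z.
Proof.
move=> z0.
have [|c] := @MVT_segment R sin cos 0 z z0 (fun x _ => is_derive_sin x).
- by apply: continuous_subspaceT => x; exact: continuous_sin.
- by rewrite in_itv/= => cz; rewrite sin0 !subr0 => ->; exists c.
Qed.

Lemma sin_le_id z : 0 <= z -> `|sin z| <= z.
Proof.
move=> z0; have [c _ ->] := sin_ge_mulr_cos z0.
by rewrite normrM (ger0_norm z0) ler_piMl ?cos_max.
Qed.

Lemma sqr_sin_le z : sin z ^+ 2 <= z ^+ 2.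
Proof.
wlog z0 : z / 0 <= z.
  move=> h; have [/h//|/ltW z0] := leP 0 z.
  by have := h (- z); rewrite oppr_ge0 sinN !sqrrN; apply.
by rewrite -real_normK ?num_real// ler_pXn2r ?nnegrE ?sin_le_id.
Qed.

Lemma cos_half z : cos z = 1 - 2 * sin (z / 2) ^+ 2.
Proof.
rewrite [in LHS](_ : z = (z / 2) *+ 2); last by rewrite -mulr_natr; field.
rewrite cos_mulr2n; have := cos2Dsin2 (z / 2); rewrite -mulr_natr; lra.
Qed.

Lemma oneB_cos_le z : 1 - cos z <= z ^+ 2 / 2.
Proof. by rewrite cos_half; have := sqr_sin_le (z / 2); rewrite expr_div_n; lra. Qed.

Lemma cos_small z : z ^+ 2 <= 1 -> 0 <= cos z /\ cos z <= expR (- (z ^+ 2 / 4)).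
Proof.
move=> z1; split; first by have := oneB_cos_le z; lra.
suff: cos z <= 1 + - (z ^+ 2 / 4).
  by move=> /le_trans; apply; exact: expR_ge1Dx.
wlog z0 : z z1 / 0 <= z.
  move=> h; have [/(h _ z1)//|/ltW z0] := leP 0 z.
  by have := h (- z); rewrite sqrrN oppr_ge0 cosN; apply.
rewrite cos_half.
have z2 : 0 <= z / 2 by rewrite divr_ge0.
have [c /andP[c0 cz] ->] := sin_ge_mulr_cos z2.
have c4 : c ^+ 2 <= 4^-1 by nra.
have cc : 7 / 8 <= cos c by have := oneB_cos_le c; lra.
have : (7 / 8) ^+ 2 <= cos c ^+ 2 by rewrite ler_pXn2r// nnegrE; lra.
rewrite [(cos c * _) ^+ 2]exprMn => hc.
have := sqr_ge0 (z / 2).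
have -> : z ^+ 2 / 4 = (z / 2) ^+ 2 by field.
move: (cos c ^+ 2) hc ((z / 2) ^+ 2) => p hp q q0; nra.
Qed.

Lemma oneB_prod_le (I : Type) (r : seq I) (c : I -> R) :
  (forall i, `|c i| <= 1) ->
  `|\prod_(i <- r) c i| <= 1 /\ 1 - \prod_(i <- r) c i <= \sum_(i <- r) (1 - c i).
Proof.
move=> c1; elim: r => [|i r [IH1 IH2]]; first by rewrite !big_nil normr1 subrr.
rewrite !big_cons; set p := \prod_(_ <- _) _ in IH1 IH2 *.
split; first by rewrite normrM mulr_ile1.
have := c1 i; rewrite ler_norml => /andP[h1 h2].
move: IH1; rewrite ler_norml => /andP[h3 h4].
nra.
Qed.

Lemma oneB_expR_ge x : 0 <= x -> Num.min x 1 / 2 <= 1 - expR (- x).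
Proof.
move=> x0; have [x1|x1] := leP x 1.
  have : expR (- x) <= (1 + x)^-1.
    by rewrite expRN lef_pV2 ?posrE ?expR_gt0 ?expR_ge1Dx// ltr_wpDr.
  move=> h; have : 1 - (1 + x)^-1 <= 1 - expR (- x) by rewrite lerD2l lerN2.
  apply: le_trans; have -> : 1 - (1 + x)^-1 = x / (1 + x) by field; lra.
  by rewrite ler_wpM2l// lef_pV2 ?posrE; lra.
have h2 : expR (- x) <= 2^-1.
  rewrite expRN lef_pV2 ?posrE ?expR_gt0//.
  have := expR_ge1Dx x; lra.
lra.
Qed.

Lemma min1_sqr x : 0 <= x -> Num.min (x ^+ 2) 1 = Num.min x 1 ^+ 2.
Proof.
move=> x0; rewrite /Num.min; have [x1|x1] := ltP x 1.
  by rewrite expr_lt1// x1.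
by rewrite ltNge (exprn_ege1 _ x1) expr1n.
Qed.

End scalar_inequalities.

Section sign_average.
Context {R : realType}.

(** The expectation of f (x + sum of e_i v_i) for independent random signs
    e_i. *)
Fixpoint savg (V : lmodType R) (f : V -> R) (s : seq V) (x : V) : R :=
  if s is v :: s' then (savg f s' (x + v) + savg f s' (x - v)) / 2 else f x.

Lemma savg_le (V : lmodType R) (f g : V -> R) s x :
  (forall y, f y <= g y) -> savg f s x <= savg g s x.
Proof.
move=> fg; elim: s x => [|v s IH] x //=.
by rewrite ler_pM2r ?invr_gt0// lerD.
Qed.

Lemma eq_savg (V : lmodType R) (f g : V -> R) s x :
  f =1 g -> savg f s x = savg g s x.
Proof. by move=> fg; rewrite (_ : f = g)//; apply/funext. Qed.

Lemma savg_lin (V : lmodType R) (f g : V -> R) (c d : R) s x :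
  savg (fun y => c * f y + d * g y) s x = c * savg f s x + d * savg g s x.
Proof. by elim: s x => [|v s IH] x //=; rewrite !IH; field. Qed.

Lemma savg_cst (V : lmodType R) (c : R) (s : seq V) x : savg (fun=> c) s x = c.
Proof. by elim: s x => [|v s IH] x //=; rewrite !IH; field. Qed.

Lemma savg_affine (V : lmodType R) (f : V -> R) (c d : R) s x :
  savg (fun y => c * f y + d) s x = c * savg f s x + d.
Proof.
by have := savg_lin f (fun=> 1) c d s x; rewrite savg_cst mulr1 => <-.
Qed.

Lemma savg_sum (V : lmodType R) (I : Type) (r : seq I) (c : I -> R) (f : I -> V -> R) s x :
  savg (fun y => \sum_(i <- r) c i * f i y) s x = \sum_(i <- r) c i * savg (f i) s x.
Proof.
elim: r => [|i r IH].
  by rewrite big_nil -[RHS](savg_cst 0 s x); apply: eq_savg => y; rewrite big_nil.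
rewrite big_cons -IH -[X in _ + X]mul1r -savg_lin.
by apply: eq_savg => y; rewrite big_cons mul1r.
Qed.

Lemma savg_map (V W : lmodType R) (phi : V -> W) (f : W -> R) s x :
  (forall y z, phi (y + z) = phi y + phi z) -> (forall y, phi (- y) = - phi y) ->
  savg (f \o phi) s x = savg f (map phi s) (phi x).
Proof.
by move=> hD hN; elim: s x => [|v s IH] x //=; rewrite !IH !hD hN.
Qed.

Lemma savg_cos (s : seq R) (x : R) :
  savg (cos : R^o -> R) s x = cos x * \prod_(v <- s) cos v.
Proof.
elim: s x => [|v s IH] x /=; first by rewrite big_nil mulr1.
by rewrite !IH big_cons cosD cosB; field.
Qed.

Section hilbert_average.
Context {H : hilbertType R}.
Implicit Types (s : seq H) (x : H).

Lemma savg_sqr s x :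
  savg (fun y => `|y| ^+ 2) s x = `|x| ^+ 2 + \sum_(v <- s) `|v| ^+ 2.
Proof.
elim: s x => [|v s IH] x /=; first by rewrite big_nil addr0.
by rewrite !IH big_cons sqr_normD sqr_normB; field.
Qed.

(** The fourth moment is at most three times the squared second moment. *)
Lemma savg_pow4 s x : savg (fun y => (`|y| ^+ 2) ^+ 2) s x <=
  (`|x| ^+ 2) ^+ 2 + 6 * `|x| ^+ 2 * \sum_(v <- s) `|v| ^+ 2 +
  3 * (\sum_(v <- s) `|v| ^+ 2) ^+ 2.
Proof.
elim: s x => [|v s IH] x /=; first by rewrite big_nil expr0n /= !mulr0 !addr0.
rewrite big_cons; have := IH (x + v); have := IH (x - v).
rewrite sqr_normB sqr_normD; set S := \sum_(_ <- _) _.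
have : inner x v ^+ 2 <= `|x| ^+ 2 * `|v| ^+ 2.
  rewrite -exprMn -(real_normK (num_real (inner x v))).
  by rewrite ler_pXn2r ?nnegrE ?mulr_ge0// cauchy_schwarz.
set p := `|x| ^+ 2; set q := `|v| ^+ 2; set i := inner x v => hi h1 h2.
have q0 : 0 <= q by exact: sqr_ge0.
rewrite ler_pdivrMr//; nra.
Qed.

(** Paley-Zygmund: from the second and fourth moments via
    min (z, 1) >= z - z^2 / 4. *)
Lemma savg_min1 s : Num.min (\sum_(v <- s) `|v| ^+ 2) 1 / 3 <=
  savg (fun y => Num.min (`|y| ^+ 2) 1) s 0.
Proof.
set S := \sum_(_ <- _) _.
have S0 : 0 <= S by apply: sumr_ge0 => i _; exact: sqr_ge0.
pose l := 2 / 3 / Num.max S 1.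
have M1 : 1 <= Num.max S 1 by rewrite le_max lexx orbT.
have M0 : 0 < Num.max S 1 by exact: lt_le_trans M1.
have l0 : 0 <= l by rewrite divr_ge0// ltW.
have l1 : l <= 1.
  by rewrite ler_pdivrMr// mul1r; apply: le_trans M1; lra.
apply: (@le_trans _ _ (savg (fun y => l * `|y| ^+ 2 + (- (l ^+ 2 / 4)) * (`|y| ^+ 2) ^+ 2) s (0 : H))); last first.
  apply: savg_le => y; have := sqr_ge0 `|y|; set z := `|y| ^+ 2 => z0.
  rewrite le_min; apply/andP; split; first by nra.
  have := sqr_ge0 (l * z - 2); nra.
rewrite savg_lin savg_sqr normr0 expr0n add0r /= -/S.
have h4 := savg_pow4 s 0; rewrite normr0 expr0n /= -/S in h4.
have h4' : savg (fun y => (`|y| ^+ 2) ^+ 2) s 0 <= 3 * S ^+ 2.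
  by apply: le_trans h4 _; rewrite expr0n/=; lra.
apply: (@le_trans _ _ (l * S - l ^+ 2 / 4 * (3 * S ^+ 2))); last first.
  rewrite lerD2l mulNr lerN2 ler_wpM2l//; have := sqr_ge0 l; lra.
rewrite /l; have [S1|S1] := ltP S 1.
  rewrite divr1; nra.
rewrite le_eqVlt; apply/orP; left; apply/eqP.
by field; lra.
Qed.

Context (alpha : R).
Hypotheses (alpha0 : 0 < alpha) (alpha2 : alpha < 2).

Lemma powR_half (x : R) : 0 <= x -> (x ^+ 2) `^ (alpha / 2) = x `^ alpha.
Proof.
move=> x0; by rewrite -(powR_mulrn 2 x0) -powRrM; congr (_ `^ _); field.
Qed.

Lemma powR_half_le1 : 0 <= alpha / 2 <= 1.
Proof.
apply/andP; split; first by rewrite divr_ge0// ltW.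
by rewrite ler_pdivrMr// mul1r ltW.
Qed.

Lemma savg_powR_le s : savg (fun y => `|y| `^ alpha) s 0 <=
  2 * (\sum_(v <- s) `|v| ^+ 2) `^ (alpha / 2).
Proof.
set S := \sum_(_ <- _) _.
have S0 : 0 <= S by apply: sumr_ge0 => i _; exact: sqr_ge0.
have [SE|SN] := eqVneq S 0.
  have E : {in s, forall v, v = 0}.
    move=> v vs; apply/normr0_eq0/eqP; rewrite -sqrf_eq0; move/eqP : SE.
    rewrite /S psumr_eq0 => [/allP/(_ _ vs)//|i _]; exact: sqr_ge0.
  have {E} : savg (fun y : H => `|y| `^ alpha) s 0 = 0.
    elim: s E {S S0 SE} => [_|v s IH E] /=; first by rewrite normr0 powR0 ?gt_eqF.
    have IH' : savg (fun y : H => `|y| `^ alpha) s 0 = 0.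
      by apply: IH => w ws; apply: E; rewrite inE ws orbT.
    by rewrite (E v (mem_head _ _)) subrr addr0 IH' addr0 mul0r.
  by move=> ->; rewrite mulr_ge0// powR_ge0.
have Sp : 0 < S by rewrite lt_def SN.
have [b0 b1] := andP powR_half_le1.
apply: (@le_trans _ _ (savg (fun y => S `^ (alpha / 2) / S * `|y| ^+ 2 + S `^ (alpha / 2)) s (0 : H))); last first.
  rewrite savg_affine savg_sqr normr0 expr0n add0r -/S divfK//; lra.
apply: savg_le => y; rewrite -powR_half//.
have -> : `|y| ^+ 2 = S * (`|y| ^+ 2 / S) by field.
have : 0 <= `|y| ^+ 2 / S by rewrite divr_ge0 ?sqr_ge0.
set t := `|y| ^+ 2 / S => t0; rewrite powRM// -mulrA (mulrA S^-1) mulVf// mul1r.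
rewrite -[X in _ <= _ + X]mulr1 -mulrDr ler_wpM2l ?powR_ge0//.
have [t1|t1] := leP t 1; last first.
  by rewrite (le_trans (ler1_powR (ltW t1) b1))// lerDl.
have /= := @ge0_ler_powR R (alpha / 2) b0 t 1; rewrite !nnegrE powR1 => h.
by rewrite (le_trans (h _ _ t1))// lerDr.
Qed.

Lemma savg_oneB_expR_ge s (tau : R) : 0 <= tau ->
  Num.min (tau * (\sum_(v <- s) `|v| ^+ 2) `^ (alpha / 2)) 1 / 6 <=
  savg (fun y => 1 - expR (- (tau * `|y| `^ alpha))) s 0.
Proof.
move=> tau0; set S := \sum_(_ <- _) _; set v := tau * _.
have S0 : 0 <= S by apply: sumr_ge0 => i _; exact: sqr_ge0.
have v0 : 0 <= v by rewrite mulr_ge0// powR_ge0.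
have [b0 b1] := andP powR_half_le1.
have [SE|SN] := eqVneq S 0.
  apply: (@le_trans _ _ 0).
    rewrite /v SE powR0; last by rewrite gt_eqF// divr_gt0.
    by rewrite mulr0 min_l// mul0r.
  rewrite -(savg_cst 0 s (0 : H)); apply: savg_le => y.
  rewrite subr_ge0 -[leRHS]expR0 ler_expR lerNl oppr0.
  by rewrite mulr_ge0// powR_ge0.
have Sp : 0 < S by rewrite lt_def SN.
pose c := (Num.sqrt S)^-1.
have sS0 : 0 < Num.sqrt S by rewrite sqrtr_gt0.
have c0 : 0 < c by rewrite invr_gt0.
have c2 : c ^+ 2 = S^-1 by rewrite /c exprVn sqr_sqrtr.
pose m := Num.min v 1.
apply: (@le_trans _ _ (savg (fun y => m / 2 * Num.min (`|y| ^+ 2) 1 + 0) (map (fun x : H => c *: x) s) (c *: 0))); last first.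
  rewrite -savg_map; [|by move=> *; rewrite scalerDr|by move=> *; rewrite scalerN].
  apply: savg_le => y /=; rewrite addr0 normrZ exprMn (gtr0_norm c0) c2.
  have -> : `|y| `^ alpha = S `^ (alpha / 2) * (S^-1 * `|y| ^+ 2) `^ (alpha / 2).
    rewrite -powR_half// -powRM ?mulr_ge0 ?invr_ge0 ?sqr_ge0//; congr (_ `^ _).
    by field.
  rewrite mulrA -/v; set t := S^-1 * _.
  have t0 : 0 <= t by rewrite mulr_ge0 ?invr_ge0 ?sqr_ge0.
  have tb : Num.min t 1 <= t `^ (alpha / 2).
    have [t1|t1] := leP t 1; last first.
      by rewrite -[leLHS](powRr0 t) ler_powR// ltW.
    have [->|tn] := eqVneq t 0; first by rewrite powR_ge0.
    by rewrite ger1_powR// lt_def tn t0.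
  apply: le_trans (oneB_expR_ge _); last by rewrite mulr_ge0// powR_ge0.
  rewrite mulrAC ler_wpM2r// le_min; apply/andP; split.
    apply: (@le_trans _ _ (v * Num.min t 1)); last by rewrite ler_wpM2l.
    by rewrite ler_wpM2r ?ge_min ?lexx// le_min t0 ler01.
  by rewrite mulr_ile1 ?le_min ?v0 ?t0 ?ler01// ge_min lexx orbT.
rewrite scaler0 savg_affine addr0.
have := savg_min1 (map (fun x : H => c *: x) s).
have -> : \sum_(v0 <- map (fun x : H => c *: x) s) `|v0| ^+ 2 = 1.
  rewrite big_map; under eq_bigr do rewrite normrZ exprMn (gtr0_norm c0) c2.
  by rewrite -mulr_sumr mulVf.
rewrite minxx => h.
have m0 : 0 <= m by rewrite le_min v0 ler01.
rewrite -/m; apply: (@le_trans _ _ (m / 2 * (1 / 3))); first by lra.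
by rewrite ler_wpM2l// divr_ge0.
Qed.

End hilbert_average.
End sign_average.

(** * Expectations of bounded random variables *)

Section expectation.
Context {d} {Omega : measurableType d} {R : realType} (P : probability Omega R).
Implicit Types (f g : Omega -> R) (A : set Omega).

Definition bounded_rv f :=
  measurable_fun [set: Omega] f /\ exists M : R, forall w, `|f w| <= M.

Definition EE f : R := \int[P]_w f w.

Lemma brv_meas f : bounded_rv f -> measurable_fun [set: Omega] f.
Proof. by case. Qed.

Lemma brv_cst (c : R) : bounded_rv (fun=> c).
Proof. by split; [exact: measurable_cst|exists `|c|]. Qed.

Lemma brvD f g : bounded_rv f -> bounded_rv g -> bounded_rv (fun w => f w + g w).
Proof.
move=> [mf [M fM]] [mg [N gN]]; split; first exact: measurable_funD.
by exists (M + N) => w; rewrite (le_trans (ler_normD _ _))// lerD.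
Qed.

Lemma brvM f g : bounded_rv f -> bounded_rv g -> bounded_rv (fun w => f w * g w).
Proof.
move=> [mf [M fM]] [mg [N gN]]; split; first exact: measurable_funM.
by exists (M * N) => w; rewrite normrM ler_pM.
Qed.

Lemma brvZ (c : R) f : bounded_rv f -> bounded_rv (fun w => c * f w).
Proof. by move=> bf; apply: brvM => //; exact: brv_cst. Qed.

Lemma brvB f g : bounded_rv f -> bounded_rv g -> bounded_rv (fun w => f w - g w).
Proof.
move=> bf /(brvZ (-1)) bg; have := brvD bf bg.
by rewrite (_ : (fun w => f w + _) = (fun w => f w - g w))//; apply/funext => w; rewrite mulN1r.
Qed.

Lemma brv_sum (I : Type) (r : seq I) (F : I -> Omega -> R) :
  (forall i, bounded_rv (F i)) -> bounded_rv (fun w => \sum_(i <- r) F i w).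
Proof.
move=> bF; elim: r => [|i r IH].
  by under eq_fun do rewrite big_nil; exact: brv_cst.
by under eq_fun do rewrite big_cons; exact: brvD.
Qed.

Lemma brv_indic A : measurable A -> bounded_rv (\1_A : Omega -> R).
Proof.
move=> mA; split; first exact: measurable_indic.
by exists 1 => w; rewrite indicE; case: (_ \in _); rewrite ?normr1 ?normr0.
Qed.

Lemma brv_cos f : measurable_fun [set: Omega] f -> bounded_rv (fun w => cos (f w)).
Proof.
move=> mf; split; last by exists 1 => w; exact: cos_max.
by apply: measurableT_comp mf; apply: continuous_measurable_fun; exact: continuous_cos.
Qed.

Lemma brv_sin f : measurable_fun [set: Omega] f -> bounded_rv (fun w => sin (f w)).
Proof.
move=> mf; split; last by exists 1 => w; exact: sin_max.
by apply: measurableT_comp mf; apply: continuous_measurable_fun; exact: continuous_sin.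
Qed.

Lemma brv_min1 f : measurable_fun [set: Omega] f -> (forall w, 0 <= f w) ->
  bounded_rv (fun w => Num.min (f w) 1).
Proof.
move=> mf f0; split; first exact: measurable_minr.
by exists 1 => w; rewrite ger0_norm ?ge_min ?lexx ?orbT// le_min f0 ler01.
Qed.

Lemma brv_expRN f : measurable_fun [set: Omega] f -> (forall w, 0 <= f w) ->
  bounded_rv (fun w => expR (- f w)).
Proof.
move=> mf f0; split; last first.
  exists 1 => w; rewrite ger0_norm ?expR_ge0// -[leRHS]expR0 ler_expR.
  by rewrite oppr_le0.
by apply: measurableT_comp => //; exact: measurableT_comp.
Qed.

Lemma brv_integrable f : bounded_rv f -> P.-integrable [set: Omega] (EFin \o f).
Proof.
move=> [mf [M fM]]; apply: (@le_integrable _ _ _ _ _ _ _ (EFin \o cst M)) => //.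
- exact/measurable_EFinP.
- by move=> w _ /=; rewrite lee_fin (le_trans (fM w))// ler_norm.
- exact: (finite_measure_integrable_cst P M measurableT).
Qed.

Lemma EE_fin f : bounded_rv f -> (EE f)%:E = (\int[P]_w (f w)%:E)%E.
Proof.
by move=> bf; rewrite /EE /Rintegral fineK//; apply: integrable_fin_num => //; exact: brv_integrable.
Qed.

Lemma EED f g : bounded_rv f -> bounded_rv g ->
  EE (fun w => f w + g w) = EE f + EE g.
Proof. by move=> bf bg; apply: RintegralD => //; exact: brv_integrable. Qed.

Lemma EEB f g : bounded_rv f -> bounded_rv g ->
  EE (fun w => f w - g w) = EE f - EE g.
Proof. by move=> bf bg; apply: RintegralB => //; exact: brv_integrable. Qed.

Lemma EEZ c f : bounded_rv f -> EE (fun w => c * f w) = c * EE f.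
Proof. by move=> bf; apply: RintegralZl => //; exact: brv_integrable. Qed.

Lemma EE_cst c : EE (fun=> c) = c.
Proof.
rewrite /EE Rintegral_cst//. have h : fine (P [set: Omega]) = 1 by rewrite probability_setT.
by rewrite [X in c * X]h mulr1.
Qed.

Lemma EE_sum (I : Type) (r : seq I) (F : I -> Omega -> R) :
  (forall i, bounded_rv (F i)) ->
  EE (fun w => \sum_(i <- r) F i w) = \sum_(i <- r) EE (F i).
Proof.
move=> bF; elim: r => [|i r IH].
  by rewrite big_nil; under eq_fun do rewrite big_nil; rewrite EE_cst.
rewrite big_cons -IH -EED//; last exact: brv_sum.
by congr EE; apply/funext => w; rewrite big_cons.
Qed.

Lemma EE_le f g : bounded_rv f -> bounded_rv g -> (forall w, f w <= g w) ->
  EE f <= EE g.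
Proof. by move=> bf bg fg; apply: le_Rintegral => //; exact: brv_integrable. Qed.

Lemma EE_ge0 f : (forall w, 0 <= f w) -> 0 <= EE f.
Proof. by move=> f0; apply: Rintegral_ge0. Qed.

Lemma EE_ae f g : bounded_rv f -> bounded_rv g -> {ae P, forall w, f w = g w} ->
  EE f = EE g.
Proof.
move=> [mf _] [mg _] fg; rewrite /EE /Rintegral; congr fine.
apply: ae_eq_integral => //; [exact/measurable_EFinP|exact/measurable_EFinP|].
by apply: filterS fg => w /= -> _.
Qed.

Lemma EE_indic A : measurable A -> EE \1_A = fine (P A).
Proof.
move=> mA; rewrite /EE /Rintegral integral_indic// setIT//.
Qed.

Lemma EE_ler_norm f c : bounded_rv f -> (forall w, `|f w| <= c) -> `|EE f| <= c.
Proof.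
move=> bf fc; rewrite ler_norml; apply/andP; split.
  rewrite -(EE_cst (- c)); apply: EE_le => // [|w]; first exact: brv_cst.
  by have := fc w; rewrite ler_norml => /andP[].
rewrite -(EE_cst c); apply: EE_le => // [|w]; first exact: brv_cst.
by have := fc w; rewrite ler_norml => /andP[].
Qed.

Lemma EE_min1_markov f (c : R) : measurable_fun [set: Omega] f ->
  (forall w, 0 <= f w) -> 0 < c -> c <= 1 ->
  EE \1_[set w | c < f w] <= EE (fun w => Num.min (f w) 1) / c.
Proof.
move=> mf f0 c0 c1; rewrite mulrC -EEZ; last exact: brv_min1.
have mA : measurable [set w | c < f w].
  by rewrite -[X in measurable X]setTI; exact: measurable_fun_ltr.
apply: EE_le => [||w]; [exact: brv_indic|exact/brvZ/brv_min1|].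
rewrite indicE; case: (boolP (_ \in _)) => [|_]; last first.
  by rewrite mulr_ge0 ?invr_ge0 ?(ltW c0)// le_min f0 ler01.
rewrite inE /= => cf; rewrite -ler_pdivrMl ?invr_gt0// invrK mulr1.
by rewrite le_min (ltW cf).
Qed.

End expectation.

(** * Sub-sigma-algebras *)

Section sub_sigma_algebra.
Context {d} {Omega : measurableType d} {R : realType} (P : probability Omega R).
Variable (Gen : set (set Omega)).
Hypothesis Genm : Gen `<=` measurable.

Definition sub_meas (f : Omega -> R) :=
  measurable_fun [set: g_sigma_algebraType Gen] f.

Lemma sub_sigma_measurable C : <<s Gen >> C -> measurable C.
Proof. by move: C; apply: smallest_sub => //; exact: sigma_algebra_measurable. Qed.

Lemma sub_meas_measurable f : sub_meas f -> measurable_fun [set: Omega] f.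
Proof.
move=> mf _ B mB; rewrite setTI; apply: sub_sigma_measurable.
by have := mf measurableT B mB; rewrite setTI.
Qed.

Lemma sum_ltn m k : (k <= m)%N -> \sum_(j < m) (if (j < k)%N then 1 else 0) = k%:R :> R.
Proof.
elim: m k => [|m IH] k; first by rewrite leqn0 => /eqP ->; rewrite big_ord0.
rewrite leq_eqVlt => /orP[/eqP ->|km].
  by rewrite (eq_bigr (fun=> 1)) ?sumr_const ?card_ord// => i _; rewrite ltn_ord.
by rewrite big_ord_recr /= IH// ltnNge -ltnS km addr0.
Qed.

(** Orthogonality to indicators extends to bounded functions, which are uniform
    limits of averages of the indicators of {Y >= j / n}. *)
Lemma sub_orthogonal (Z Y : Omega -> R) : bounded_rv Z ->
  (forall C, <<s Gen >> C -> EE P (fun w => \1_C w * Z w) = 0) ->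
  sub_meas Y -> (exists M : R, forall w, `|Y w| <= M) ->
  EE P (fun w => Y w * Z w) = 0.
Proof.
move=> bZ hZ mY [M YM].
have mYO := sub_meas_measurable mY.
have bY : bounded_rv Y by split => //; exists M.
have [K0 K0p ZKle] : exists2 K : R, 0 < K & forall w, `|Z w| <= K.
  case: bZ => _ [K ZK]; exists (`|K| + 1) => [|w]; first by rewrite ltr_wpDl.
  by rewrite (le_trans (ZK w))// (le_trans (ler_norm K))// lerDl.
pose c := `|M| + 1.
have c0 : 0 < c by rewrite ltr_wpDl.
(* U takes its values in [0, 1] *)
pose U w := (Y w / c + 1) / 2.
have U01 w : 0 <= U w < 1.
  have : `|Y w| < c by rewrite (le_lt_trans (YM w))// (le_lt_trans (ler_norm M))// ltrDl.
  rewrite ltr_norml => /andP[h1 h2].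
  have h3 : Y w / c < 1 by rewrite ltr_pdivrMr// mul1r.
  have h4 : -1 < Y w / c by rewrite ltr_pdivlMr// mulN1r.
  rewrite /U; lra.
have UE w : Y w = 2 * c * U w - c by rewrite /U; field; rewrite gt_eqF.
have mU : sub_meas U.
  by apply: measurable_funM => //; apply: measurable_funD => //; exact: measurable_funM.
have bU : bounded_rv U.
  split; first exact: sub_meas_measurable.
  by exists 1 => w; have /andP[h1 /ltW h2] := U01 w; rewrite ger0_norm.
have EZ0 : EE P Z = 0.
  have := hZ setT; rewrite (_ : (fun w => _) = Z).
    by apply; exact: (@measurableT _ (g_sigma_algebraType Gen)).
  by apply/funext => w; rewrite indicT mul1r.
suff EU : EE P (fun w => U w * Z w) = 0.
  rewrite (_ : (fun w => _) = (fun w => (2 * c) * (U w * Z w) - c * Z w)); last first.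
    by apply/funext => w; rewrite UE; ring.
  rewrite EEB ?EEZ ?EU ?EZ0 ?mulr0 ?subrr//; [exact: brvM|exact/brvZ/brvM|exact: brvZ].
pose C (n j : nat) := [set w | j.+1%:R / n.+1%:R <= U w].
have sC n j : <<s Gen >> (C n j).
  have := @measurable_fun_ler _ (g_sigma_algebraType Gen) R setT (cst (j.+1%:R / n.+1%:R)) U.
  move=> /(_ (measurable_cst _) mU measurableT [set true] I).
  by rewrite setTI.
pose Un n w := n.+1%:R^-1 * \sum_(j < n.+1) (\1_(C n j) w : R).
have UUn n w : `|U w - Un n w| <= n.+1%:R^-1.
  have /andP[u0 u1] := U01 w.
  have n0 : 0 < n.+1%:R :> R by rewrite ltr0n.
  pose k := Num.truncn (U w * n.+1%:R).
  have un0 : 0 <= U w * n.+1%:R by rewrite mulr_ge0// ltW.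
  have /andP[k1 k2] := truncn_itv un0.
  have kn : (k < n.+1)%N.
    rewrite -(ltr_nat R) (le_lt_trans k1)// -[ltRHS]mul1r ltr_pM2r//.
  have -> : Un n w = k%:R / n.+1%:R.
    rewrite /Un mulrC; congr (_ / _).
    rewrite (eq_bigr (fun j : 'I_n.+1 => if (j < k)%N then 1 else 0 : R)); last first.
      move=> j _; rewrite indicE /C; case: ltnP => jk.
        rewrite mem_set//= ler_pdivrMr// (le_trans _ k1)// ler_nat.
        exact: jk.
      rewrite memNset//= => h; move: h; rewrite ler_pdivrMr// => h.
      have := le_lt_trans h k2; rewrite ltr_nat ltnS => h'.
      by move: jk; rewrite leqNgt h'.
    by rewrite sum_ltn// ltnW.
  have -> : U w - k%:R / n.+1%:R = (U w * n.+1%:R - k%:R) / n.+1%:R.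
    by field; rewrite gt_eqF.
  rewrite normrM normfV (gtr0_norm n0) -[leRHS]mul1r ler_pM2r ?invr_gt0//.
  rewrite ger0_norm ?subr_ge0// lerBlDl ltW//.
  by rewrite natr1.
apply/eqP; rewrite -normr_le0; apply/ler_addgt0Pl => r r0; rewrite addr0.
have [n hn] : exists n : nat, K0 / n.+1%:R <= r.
  exists (Num.truncn (K0 / r)); rewrite ler_pdivrMr ?ltr0n// mulrC -ler_pdivrMr//.
  by rewrite ltW// truncnS_gt.
rewrite (_ : (fun w => _) = (fun w => (U w - Un n w) * Z w + Un n w * Z w)); last first.
  by apply/funext => w; rewrite mulrBl subrK.
have bUn : bounded_rv (Un n).
  by apply: brvZ; apply: brv_sum => j; apply: brv_indic; exact: sub_sigma_measurable (sC _ _).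
rewrite EED; [|by apply: brvM => //; exact: brvB|exact: brvM].
have -> : EE P (fun w => Un n w * Z w) = 0.
  rewrite (_ : (fun w => _) = (fun w => n.+1%:R^-1 * \sum_(j < n.+1) \1_(C n j) w * Z w)).
    rewrite EEZ; last first.
      by apply: brv_sum => j; apply: brvM => //; apply: brv_indic; exact: sub_sigma_measurable (sC _ _).
    rewrite EE_sum => [|j]; last first.
      by apply: brvM => //; apply: brv_indic; exact: sub_sigma_measurable (sC _ _).
    by rewrite big1 ?mulr0// => j _; exact: hZ.
  by apply/funext => w; rewrite /Un -mulrA mulr_suml.
rewrite addr0; apply: EE_ler_norm => [|w]; first by apply: brvM => //; exact: brvB.
apply: le_trans hn; rewrite normrM mulrC ler_pM//; exact: ZKle.
Qed.

End sub_sigma_algebra.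

(** * Increments are independent of the past *)

Section borel_sets.
Context {R : realType}.

Lemma borel_preimage (V W : topologicalType) (f : V -> W) (B : set W) :
  continuous f -> borel B -> borel (f @^-1` B).
Proof.
move=> cf; move: B; apply: (@smallest_sub _ _ _ [set B | borel (f @^-1` B)]).
  have := @sigma_algebra_image _ _ setT f (@borel V).
  rewrite /image_set_system; under eq_fun do rewrite setTI.
  by apply; exact: smallest_sigma_algebra.
by move=> O oO; apply: sub_sigma_algebra; exact: open_comp.
Qed.

Lemma measurable_borelE (B : set R) : measurable B <-> borel B.
Proof.
split=> [mB|bB].
  have : (RGenOpens.G (R := R)).-sigma.-measurable B by rewrite -RGenOpens.measurableE.
  move: B {mB}; apply: smallest_sub; first exact: smallest_sigma_algebra.
  move=> _ [x [y ->]]; apply: sub_sigma_algebra; exact: interval_open.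
move: B bB; apply: smallest_sub; first exact: sigma_algebra_measurable.
exact: open_measurable.
Qed.

Lemma borelT (V : topologicalType) : borel [set: V].
Proof. by apply: sub_sigma_algebra; exact: openT. Qed.

Lemma borelI (V : ptopologicalType) (A B : set V) : borel A -> borel B -> borel (A `&` B).
Proof. exact: (@measurableI _ (g_sigma_algebraType (@open V))). Qed.

Lemma borel_coord n (k : 'I_n) (B : set R) : measurable B ->
  borel [set x : 'rV[R]_n | B (x 0 k)].
Proof.
move=> /measurable_borelE bB.
by apply: (@borel_preimage _ _ (fun x : 'rV[R]_n => x 0 k)) => //; exact: coord_continuous.
Qed.

End borel_sets.

Section pi_lambda.
Context {d} {Omega : measurableType d} {R : realType} (P : probability Omega R).

Lemma ae_eq_prob (A B : set Omega) : measurable A -> measurable B ->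
  {ae P, forall w, A w <-> B w} -> P A = P B.
Proof.
move=> mA mB AB; rewrite -[LHS]fineK ?fin_num_measure//.
rewrite -[RHS]fineK ?fin_num_measure// -!EE_indic//; congr (_%:E).
apply: EE_ae; [exact: brv_indic|exact: brv_indic|].
by apply: filterS AB => w AB; rewrite !indicE; congr (nat_of_bool _)%:R; apply/idP/idP; rewrite !inE => /AB.
Qed.

Definition indep_of (E : set Omega) : set (set Omega) :=
  [set C | P (C `&` E) = (P C * P E)%E].

Lemma indep_pi_lambda (Gen : set (set Omega)) E : measurable E ->
  Gen `<=` measurable -> setI_closed Gen -> Gen setT -> Gen `<=` indep_of E ->
  <<s Gen >> `<=` indep_of E.
Proof.
move=> mE Gm GI GT Gi C sC; rewrite /indep_of /=.
pose r : {nonneg R} := NngNum (fine_ge0 (measure_ge0 P E)).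
have rE : r%:num%:E = P E by rewrite fineK// fin_num_measure.
have GC : \bigcup_(k : nat) [set: Omega] = setT by rewrite bigcup_const//; exists 0%N.
rewrite muleC -rE.
apply: (@g_sigma_algebra_measure_unique _ _ _ Gen Gm (fun=> setT) (fun=> GT) GC
  (mrestr P mE) (mscale r P) GI _ _ _ sC) => [A GA|_].
  suff h : P (A `&` E) = (r%:num%:E * P A)%E by exact: h.
  by rewrite rE muleC; exact: Gi.
by rewrite /mrestr (le_lt_trans (probability_le1 _ _)) ?ltry//; exact: measurableI.
Qed.

End pi_lambda.

Section levy_independence.
Context {d} {Omega : measurableType d} {R : realType} (P : probability Omega R).
Context {G : normedModType R} (L : R -> G -> {RV P >-> R}).
Hypothesis levyL : cylindrical_levy_process L.

Definition levy_gen (t : R) : set (set Omega) :=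
  [set A | exists (s : R) (g : G) (B : set R),
      [/\ 0 <= s <= t, measurable B & A = L s g @^-1` B]].

Lemma levy_filtrationE t : levy_filtration L t = <<s levy_gen t >>.
Proof. by []. Qed.

Lemma levy_gen_measurable t : levy_gen t `<=` measurable.
Proof.
by move=> _ [s [g [B [_ mB ->]]]]; rewrite -[X in measurable X]setTI; exact: measurable_funPT.
Qed.

Lemma levy_filtration_measurable t A : levy_filtration L t A -> measurable A.
Proof. exact: (sub_sigma_measurable (@levy_gen_measurable t)). Qed.

Lemma levy_filtration_mono s t : s <= t -> levy_filtration L s `<=` levy_filtration L t.
Proof.
move=> st; apply: smallest_sub; first exact: smallest_sigma_algebra.
move=> A [u [g [B [/andP[u0 us] mB ->]]]]; apply: sub_sigma_algebra.
by exists u, g, B; rewrite u0 (le_trans us st).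
Qed.

Lemma levy_sub_meas s t g : 0 <= s <= t -> sub_meas (levy_gen t) (L s g).
Proof.
by move=> st _ B mB; rewrite setTI; apply: sub_sigma_algebra; exists s, g, B.
Qed.

Lemma levy0 g : {ae P, forall w, L 0 g w = 0}.
Proof.
have [_ h _ _ _] := levyL.2 1%N (fun=> g); apply: filterS h => w /rowP/(_ ord0).
by rewrite !mxE.
Qed.

Definition incr (s t : R) (g : G) (w : Omega) : R := L t g w - L s g w.

Lemma measurable_incr s t g : measurable_fun [set: Omega] (incr s t g).
Proof. by apply: measurable_funB. Qed.

(** The cylinder events in the past of s form a pi-system; for a fixed one, the
    values that it involves are sums of increments over a common grid, up to the
    null set where L 0 is nonzero. *)
Let cylinder (s : R) : set (set Omega) :=
  [set C | exists (J : finType) (u : J -> R) (g : J -> G) (B : J -> set R),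
    [/\ forall i, 0 <= u i <= s, forall i, measurable (B i) &
      C = [set w | forall i, B i (L (u i) (g i) w)]]].

Let cylinder_indep s t g B : 0 <= s <= t -> measurable B ->
  cylinder s `<=` indep_of P (incr s t g @^-1` B).
Proof.
move=> /andP[s0 st] mB _ [J [u [gg [BB [us mBB ->]]]]].
pose v := sort <=%R (0 :: s :: [seq u i | i <- enum J]).
pose tt := nth t v.
pose n := #|J|.+1.
pose gv (k : 'I_n) := nth g (map gg (enum J)) k.
have [mX X0 Xind _ _] := levyL.2 n gv.
have sv : sorted <=%R v by apply: sort_sorted; exact: le_total.
have vin x : x \in v -> 0 <= x <= s.
  rewrite mem_sort !inE => /or3P[/eqP->|/eqP->|/mapP[i _ ->]]; rewrite ?lexx ?s0//.
have v0 : 0 \in v by rewrite mem_sort inE eqxx.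
have vs : s \in v by rewrite mem_sort !inE eqxx orbT.
have vu i : u i \in v by rewrite mem_sort !inE map_f ?orbT// mem_enum.
have szv : size v = #|J|.+2 by rewrite size_sort /= size_map -cardE.
have nthmono i j : (i <= j)%N -> (j < size v)%N -> tt i <= tt j.
  move=> ij jv; apply: (sorted_leq_nth le_trans lexx t sv); rewrite ?inE//.
  exact: leq_ltn_trans ij jv.
have tt0 : tt 0%N = 0.
  apply/eqP; rewrite eq_le; apply/andP; split; last first.
    by have /vin/andP[] : tt 0%N \in v by apply: mem_nth; rewrite szv.
  by rewrite -[leRHS](nth_index t v0); apply: nthmono => //; rewrite index_mem.
pose K := #|J|.+1.
have ttK : tt K = s.
  apply/eqP; rewrite eq_le; apply/andP; split.
    by have /vin/andP[] : tt K \in v by apply: mem_nth; rewrite szv.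
  rewrite -[leLHS](nth_index t vs); apply: nthmono => //; last by rewrite szv.
  by rewrite -ltnS /K -szv index_mem.
have ttS : tt K.+1 = t by rewrite /tt nth_default// szv.
have ttmono i : (i < K.+1)%N -> tt i <= tt i.+1.
  rewrite ltnS leq_eqVlt => /orP[/eqP ->|iK]; first by rewrite ttK ttS.
  by apply: nthmono => //; rewrite szv ltnS.
set E := incr s t g @^-1` B.
have mE : measurable E by rewrite -[X in measurable X]setTI; exact: measurable_incr.
pose X (r : R) w : 'rV[R]_n := \row_i L r (gv i) w.
pose Ev (D : nat -> set 'rV[R]_n) i := [set w | D i (X (tt i.+1) w - X (tt i) w)].
pose rect (A : nat -> 'I_n -> set R) i := [set x : 'rV[R]_n | forall k, A i k (x 0 k)].
have brect A : (forall i k, measurable (A i k)) -> forall i, borel (rect A i).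
  move=> mA i; have -> : rect A i =
      \bigcap_(k in [set: 'I_n]) [set x : 'rV[R]_n | A i k (x 0 k)].
    by apply/seteqP; split=> [x h k _|x h k]; [exact: h|exact: (h k I)].
  apply: (@fin_bigcap_measurable _ (g_sigma_algebraType (@open 'rV[R]_n))).
    exact: finite_finset.
  by move=> k _; exact: borel_coord.
pose Gen : set (set Omega) := [set C | exists2 A : nat -> 'I_n -> set R,
  (forall i k, measurable (A i k)) & C = \bigcap_(i in `I_K) Ev (rect A) i].
have incr_meas k i (A : set R) : measurable A ->
    Gen [set w | A (L (tt i.+1) (gv k) w - L (tt i) (gv k) w)] \/ (K <= i)%N.
  move=> mA; have [Ki|iK] := leqP K i; [by right|left].
  exists (fun j l => if (j == i) && (l == k) then A else setT).
    by move=> j l; case: ifP.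
  apply/seteqP; split=> [w /= Aw j jK l|w /(_ i iK)/(_ k)]; rewrite /=.
    by case: ifP => // /andP[/eqP -> /eqP ->] /=; rewrite /X !mxE.
  by rewrite !eqxx /= /X !mxE.
have EvI A : (forall i k, measurable (A i k)) -> forall i, measurable (Ev (rect A) i).
  move=> mA i; have -> : Ev (rect A) i = \bigcap_(k in [set: 'I_n])
      (incr (tt i) (tt i.+1) (gv k) @^-1` A i k).
    apply/seteqP; split=> [w h k _|w h k]; first by have := h k; rewrite /X !mxE.
    by have := h k I; rewrite /= /X !mxE.
  apply: fin_bigcap_measurable; first exact: finite_finset.
  by move=> k _; rewrite -[X in measurable X]setTI; exact: measurable_incr.
have Gm : Gen `<=` measurable.
  move=> _ [D bD ->]; apply: bigcap_measurable; first by exists 0%N.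
  by move=> i _; exact: EvI.
have GI : setI_closed Gen.
  move=> _ _ [A mA ->] [A' mA' ->]; exists (fun i k => A i k `&` A' i k).
    by move=> i k; exact: measurableI.
  rewrite -bigcapI; apply: eq_bigcapr => i _.
  by apply/seteqP; split=> [w [h1 h2] k|w h]; [split; [exact: h1|exact: h2]|split=> k; exact: (h k).1 || exact: (h k).2].
have GT : Gen setT.
  exists (fun _ _ => setT); first by move=> _.
  by apply/seteqP; split.
have Gind : Gen `<=` indep_of P E.
  move=> _ [A mA ->]; rewrite /indep_of /=.
  have bD := brect _ mA; set D := rect A in bD *.
  pose D' i := if i == K then [set x : 'rV[R]_n | B (x 0 ord_max)] else D i.
  have bD' i : borel (D' i) by rewrite /D'; case: ifP => _; [exact: borel_coord|].
  have tt00 : 0 <= tt 0%N by rewrite tt0.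
  have h1 := Xind K.+1 tt D' tt00 ttmono bD'.
  have h2 := Xind K tt D tt00 (fun i iK => ttmono i (ltnW iK)) bD.
  rewrite /= in h1 h2; rewrite -[X in P (X `&` _)]/(\bigcap_(i in `I_K) Ev D i).
  have EK : E = Ev D' K.
    have gE : gv ord_max = g by rewrite /gv nth_default// size_map -cardE.
    by apply/seteqP; split=> w; rewrite /Ev /D' eqxx /= /X !mxE gE ttS ttK.
  have -> : \bigcap_(i in `I_K) Ev D i `&` E = \bigcap_(i in `I_K.+1) Ev D' i.
    rewrite EK; apply/seteqP; split=> [w [h hK] i|w h].
      rewrite /= ltnS leq_eqVlt => /orP[/eqP ->//|iK].
      by rewrite /Ev /D' (ltn_eqF iK); exact: h.
    split; last by apply: h => /=.
    by move=> i /= iK; have := h i (ltnW iK); rewrite /Ev /D' (ltn_eqF iK).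
  rewrite h1 big_ord_recr /=; congr (_ * _)%E; last by rewrite EK.
  rewrite h2.
  by apply: eq_bigr => i _; congr (P _); rewrite /D' (ltn_eqF (ltn_ord i)).
have sind := indep_pi_lambda mE Gm GI GT Gind.
(* the increments from time 0 *)
have sub i k : (i <= K)%N -> sub_meas Gen (fun w => L (tt i) (gv k) w - L 0 (gv k) w).
  elim: i => [_|i IH iK].
    by rewrite tt0; under eq_fun do rewrite subrr; exact: measurable_cst.
  rewrite (_ : (fun w => _) = (fun w => (L (tt i) (gv k) w - L 0 (gv k) w) +
     (L (tt i.+1) (gv k) w - L (tt i) (gv k) w))); last by apply/funext => w; ring.
  apply: measurable_funD; first exact: IH (ltnW iK).
  move=> _ A mA; rewrite setTI; apply: sub_sigma_algebra.
  by case: (incr_meas k i A mA) => //; rewrite leqNgt iK.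
have gvE i (ik : (enum_rank i < n)%N) : gv (Ordinal ik) = gg i.
  by rewrite /gv /= (nth_map i) -?cardE// nth_enum_rank.
set C := [set w | _].
pose C' := [set w | forall i, BB i (L (u i) (gg i) w - L 0 (gg i) w)].
have sC' : <<s Gen >> C'.
  have -> : C' = \bigcap_(i in [set: J]) [set w | BB i (L (u i) (gg i) w - L 0 (gg i) w)].
    by apply/seteqP; split=> [w h i _|w h i]; [exact: h|exact: (h i I)].
  apply: (@fin_bigcap_measurable _ (g_sigma_algebraType Gen)).
    exact: finite_finset.
  move=> i _.
  have ik : (enum_rank i < n)%N by rewrite ltnS ltnW.
  have := sub (index (u i) v) (Ordinal ik).
  rewrite gvE.
  rewrite /tt nth_index//; have iv : (index (u i) v <= K)%N.
    by rewrite -ltnS /K -szv index_mem.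
  by move=> /(_ iv measurableT _ (mBB i)); rewrite setTI.
have mC' : measurable C' := sub_sigma_measurable Gm sC'.
have mC : measurable C.
  have -> : C = \bigcap_(i in [set: J]) [set w | BB i (L (u i) (gg i) w)].
    by apply/seteqP; split=> [w h i _|w h i]; [exact: h|exact: (h i I)].
  apply: fin_bigcap_measurable; first exact: finite_finset.
  by move=> i _; rewrite -[X in measurable X]setTI; exact: measurable_funPT.
have CC' : {ae P, forall w, C w <-> C' w}.
  have : {ae P, forall w, forall i : J, L 0 (gg i) w = 0}.
    apply: filterS X0 => w /rowP X0w i.
    have ik : (enum_rank i < n)%N by rewrite ltnS ltnW.
    by have := X0w (Ordinal ik); rewrite !mxE gvE.
  by apply: filterS => w h; split=> hC i; have := hC i; rewrite h subr0.
rewrite /indep_of /=.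
have PC A : measurable A -> P (C `&` A) = P (C' `&` A).
  move=> mA; apply: ae_eq_prob; [exact: measurableI|exact: measurableI|].
  by apply: filterS CC' => w h; split=> -[/h].
have := sind _ sC'; rewrite /indep_of /= -PC// => ->.
by have := PC _ measurableT; rewrite !setIT => ->.
Qed.

Lemma incr_indep s t g B C : 0 <= s <= t -> measurable B -> levy_filtration L s C ->
  P (C `&` (incr s t g @^-1` B)) = (P C * P (incr s t g @^-1` B))%E.
Proof.
move=> st mB FC.
have mE : measurable (incr s t g @^-1` B).
  by rewrite -[X in measurable X]setTI; exact: measurable_incr.
apply: (@indep_pi_lambda _ _ _ P (cylinder s) _ mE).
- move=> _ [J [u [gg [BB [us mBB ->]]]]].
  rewrite (_ : [set w | _] = \bigcap_(i in [set: J]) [set w | BB i (L (u i) (gg i) w)]); last first.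
    by apply/seteqP; split=> [w h i _|w h i]; [exact: h|exact: (h i I)].
  apply: fin_bigcap_measurable; first exact: finite_finset.
  by move=> i _; rewrite -[X in measurable X]setTI; exact: measurable_funPT.
- move=> _ _ [J1 [u [g1 [B1 [us m1 ->]]]]] [J2 [v [g2 [B2 [vs m2 ->]]]]].
  exists (J1 + J2)%type, (fun k => match k with inl i => u i | inr j => v j end),
    (fun k => match k with inl i => g1 i | inr j => g2 j end),
    (fun k => match k with inl i => B1 i | inr j => B2 j end).
  split; [by case|by case|].
  apply/seteqP; split=> [w [h1 h2] [i|j]|w h]; [exact: h1|exact: h2|].
  by split=> i; [exact: (h (inl i))|exact: (h (inr i))].
- exists void, (fun=> 0), (fun=> 0), (fun=> setT); split; [by case|by case|].
  by apply/seteqP; split => // w _ [].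
- exact: cylinder_indep.
- move: C FC; apply: smallest_sub; first exact: smallest_sigma_algebra.
  move=> _ [u [gg [D [us mD ->]]]]; apply: sub_sigma_algebra.
  exists unit, (fun=> u), (fun=> gg), (fun=> D); split; [by []|by []|].
  apply/seteqP; split=> w /=; last by move=> h; exact: (h tt).
  by move=> h _; exact: h.
Qed.

End levy_independence.

Section conditional_law.
Context {d} {Omega : measurableType d} {R : realType} (P : probability Omega R).
Context {G : normedModType R} (L : R -> G -> {RV P >-> R}).
Hypothesis levyL : cylindrical_levy_process L.
Context (alpha : R).
Hypothesis stableL : canonical_stable alpha L.

Lemma measurable_cos_comp (D : Omega -> R) : measurable_fun [set: Omega] D ->
  measurable_fun [set: Omega] (fun w => cos (D w)).
Proof. by move=> /brv_cos[]. Qed.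

(** Independence of events carries over to the expectation of a bounded Borel
    function of D. *)
Lemma indep_expectation (C : set Omega) (D : Omega -> R) (phi : R -> R) :
  measurable C -> measurable_fun [set: Omega] D -> measurable_fun [set: R] phi ->
  (forall x, `|phi x| <= 1) ->
  (forall B, measurable B -> P (C `&` (D @^-1` B)) = (P C * P (D @^-1` B))%E) ->
  EE P (fun w => \1_C w * phi (D w)) = fine (P C) * EE P (fun w => phi (D w)).
Proof.
move=> mC mD mphi phi1 CD.
have bphi : bounded_rv (fun w => phi (D w)).
  by split; [exact: measurableT_comp|exists 1].
have bC := brv_indic (R := R) mC.
pose Gen := preimage_set_system [set: Omega] D measurable.
have GenE A : <<s Gen >> A -> exists2 B, measurable B & A = D @^-1` B.
  move=> sA; have : Gen A.
    move: A sA; apply: smallest_sub => //.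
    exact: sigma_algebra_preimage (sigma_algebra_measurable R).
  by case=> B mB <-; exists B; rewrite ?setTI.
have Gm : Gen `<=` measurable by move=> _ [B mB <-]; exact: mD.
suff : EE P (fun w => phi (D w) * (\1_C w - fine (P C))) = 0.
  rewrite (_ : (fun w => _) = (fun w => \1_C w * phi (D w) - fine (P C) * phi (D w))); last first.
    by apply/funext => w; ring.
  rewrite EEB; [|exact: brvM|exact: brvZ].
  by rewrite EEZ// => /eqP; rewrite subr_eq0 => /eqP.
apply: (@sub_orthogonal _ _ _ P Gen Gm (fun w => \1_C w - fine (P C))).
- by apply: brvB => //; exact: brv_cst.
- move=> A /GenE[B mB AE].
  have mA : measurable A by rewrite AE -[X in measurable X]setTI; exact: mD.
  have bA := brv_indic (R := R) mA.
  rewrite (_ : (fun w => _) = (fun w => \1_(C `&` A) w - fine (P C) * \1_A w)); last first.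
    by apply/funext => w; rewrite indicI /=; ring.
  rewrite EEB; [|by apply: brv_indic; exact: measurableI|exact: brvZ].
  rewrite EEZ// !EE_indic//; last exact: measurableI.
  by rewrite AE CD// -AE fineM ?fin_num_measure// subrr.
- apply: measurableT_comp => //= _ B mB; rewrite setTI.
  by apply: sub_sigma_algebra; exists B => //; rewrite setTI.
- by exists 1.
Qed.

Lemma EE_law (D D' : Omega -> R) (phi : R -> R) :
  measurable_fun [set: Omega] D -> measurable_fun [set: Omega] D' ->
  measurable_fun [set: R] phi -> (forall x, `|phi x| <= 1) ->
  (forall B, measurable B -> P (D @^-1` B) = P (D' @^-1` B)) ->
  EE P (fun w => phi (D w)) = EE P (fun w => phi (D' w)).
Proof.
move=> mD mD' mphi phi1 law.
have mE : measurable_fun [set: R] (EFin \o phi) by exact/measurable_EFinP.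
have int (g : Omega -> R) : measurable_fun [set: Omega] g ->
    P.-integrable (g @^-1` [set: R]) ((EFin \o phi) \o g).
  move=> mg; rewrite preimage_setT; apply: brv_integrable; split; last by exists 1.
  exact: measurableT_comp.
have h := integral_pushforward mD mE (int _ mD) measurableT.
have h' := integral_pushforward mD' mE (int _ mD') measurableT.
rewrite !preimage_setT in h h'.
rewrite /EE /Rintegral; congr fine; transitivity (\int[P]_x ((EFin \o phi) \o D) x)%E => //.
rewrite -h; transitivity (\int[P]_x ((EFin \o phi) \o D') x)%E => //.
rewrite -h'; apply: eq_measure_integral => A mA _; exact: law.
Qed.

Lemma incr_char s t g : 0 <= s <= t ->
  EE P (fun w => cos (incr L s t g w)) = expR (- ((t - s) * `|g| `^ alpha)) /\
  EE P (fun w => sin (incr L s t g w)) = 0.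
Proof.
move=> /andP[s0 st]; have ts : 0 <= t - s by rewrite subr_ge0.
have [h1 h2] := stableL g ts.
have law B : measurable B -> P (incr L s t g @^-1` B) = P (L (t - s) g @^-1` B).
  move=> mB; have [_ _ _ Xst _] := levyL.2 1%N (fun=> g).
  have st' : 0 <= s <= t by rewrite s0.
  have := Xst s t [set x | B (x 0 ord0)] st' (borel_coord _ mB).
  rewrite /preimage /=; under eq_set do rewrite !mxE.
  by under [in RHS]eq_set do rewrite !mxE.
split.
- rewrite (EE_law (D' := L (t - s) g) _ _ _ (@cos_max R) law)//.
  + by rewrite /EE /Rintegral; move: h1; rewrite unlock => ->.
  + exact: measurable_incr.
  + apply: continuous_measurable_fun; exact: continuous_cos.
- rewrite (EE_law (D' := L (t - s) g) _ _ _ (@sin_max R) law)//.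
  + by rewrite /EE /Rintegral; move: h2; rewrite unlock => ->.
  + exact: measurable_incr.
  + apply: continuous_measurable_fun; exact: continuous_sin.
Qed.

Lemma incr_cond s t g C : 0 <= s <= t -> levy_filtration L s C ->
  EE P (fun w => \1_C w * cos (incr L s t g w)) =
    fine (P C) * expR (- ((t - s) * `|g| `^ alpha)) /\
  EE P (fun w => \1_C w * sin (incr L s t g w)) = 0.
Proof.
move=> st FC; have mC := levy_filtration_measurable FC.
have [h1 h2] := incr_char g st.
have ind := fun B mB => @incr_indep _ _ _ _ _ _ levyL s t g B C st mB FC.
split; rewrite indep_expectation//; try exact: measurable_incr.
- by rewrite h1.
- apply: continuous_measurable_fun; exact: continuous_cos.
- exact: cos_max.
- by rewrite h2 mulr0.
- apply: continuous_measurable_fun; exact: continuous_sin.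
- exact: sin_max.
Qed.

End conditional_law.

(** * Step processes as processes with finitely many values *)

Section simple_maps.
Context {d} {Omega : measurableType d} {R : realType} {P : probability Omega R}.
Context {G : hilbertType R} (L : R -> G -> {RV P >-> R}).

(** Factoring through a finite type makes this notion visibly stable under all
    pointwise operations. *)
Definition simple (V : Type) (t : R) (Op : set V) (f : Omega -> V) :=
  exists (J : finType) (p : Omega -> J) (c : J -> V),
    [/\ forall i, levy_filtration L t (p @^-1` [set i]), forall i, Op (c i) &
        forall w, f w = c (p w)].

Lemma levy_filtrationI t A B : levy_filtration L t A -> levy_filtration L t B ->
  levy_filtration L t (A `&` B).
Proof. exact: (@measurableI _ (g_sigma_algebraType (levy_gen L t))). Qed.

Lemma levy_filtrationC t A : levy_filtration L t A -> levy_filtration L t (~` A).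
Proof. exact: (@measurableC _ (g_sigma_algebraType (levy_gen L t))). Qed.

Lemma levy_filtrationT t : levy_filtration L t setT.
Proof. exact: (@measurableT _ (g_sigma_algebraType (levy_gen L t))). Qed.

Lemma levy_filtration0 t : levy_filtration L t set0.
Proof. exact: (@measurable0 _ (g_sigma_algebraType (levy_gen L t))). Qed.

Lemma levy_filtration_fin (J : finType) t (F : J -> set Omega) :
  (forall i, levy_filtration L t (F i)) -> levy_filtration L t [set w | forall i, F i w].
Proof.
move=> hF; have -> : [set w | forall i, F i w] = \bigcap_(i in [set: J]) F i.
  by apply/seteqP; split=> [w h i _|w h i]; [exact: h|exact: (h i I)].
apply: (@fin_bigcap_measurable _ (g_sigma_algebraType (levy_gen L t))).
  exact: finite_finset.
by move=> i _; exact: hF.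
Qed.

Lemma levy_filtration_finU (J : finType) t (F : J -> set Omega) :
  (forall i, levy_filtration L t (F i)) -> levy_filtration L t [set w | exists i, F i w].
Proof.
move=> hF; have -> : [set w | exists i, F i w] = ~` [set w | forall i, (~` F i) w].
  apply/seteqP; split=> [w [i Fi] h|w h]; first exact: (h i).
  by apply: contrapT => h'; apply: h => i Fi; apply: h'; exists i.
apply: levy_filtrationC; apply: levy_filtration_fin => i; exact: levy_filtrationC.
Qed.

Lemma simple_mono (V : Type) s t (Op : set V) f : s <= t -> simple s Op f -> simple t Op f.
Proof.
move=> st [J [p [c [h1 h2 h3]]]]; exists J, p, c; split=> // i.
exact: levy_filtration_mono st _ (h1 i).
Qed.

Lemma simple_map2 (V1 V2 V3 : Type) t (O1 : set V1) (O2 : set V2) (O3 : set V3)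
    (h : V1 -> V2 -> V3) f g : (forall x y, O1 x -> O2 y -> O3 (h x y)) ->
  simple t O1 f -> simple t O2 g -> simple t O3 (fun w => h (f w) (g w)).
Proof.
move=> hO [J [p [c [h1 h2 h3]]]] [J' [p' [c' [h1' h2' h3']]]].
exists (J * J')%type, (fun w => (p w, p' w)), (fun k => h (c k.1) (c' k.2)).
split=> [[i j]|k|w /=]; last by rewrite h3 h3'.
  rewrite (_ : _ @^-1` _ = (p @^-1` [set i]) `&` (p' @^-1` [set j])).
    exact: levy_filtrationI.
  by apply/seteqP; split=> [w [/= -> ->]|w [/= -> ->]].
exact: hO.
Qed.

Lemma simple_map (V1 V2 : Type) t (O1 : set V1) (O2 : set V2) (h : V1 -> V2) f :
  (forall x, O1 x -> O2 (h x)) -> simple t O1 f -> simple t O2 (h \o f).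
Proof.
move=> hO [J [p [c [h1 h2 h3]]]]; exists J, p, (h \o c).
by split=> // [i|w /=]; [exact: hO|rewrite h3].
Qed.

Lemma simple_cst (V : Type) t (Op : set V) (x : V) : Op x -> simple t Op (fun=> x).
Proof.
move=> Ox; exists unit, (fun=> tt), (fun=> x); split=> // -[].
by rewrite preimage_cst mem_set//; exact: levy_filtrationT.
Qed.

(** A simple map into the events of R is measurable in the past. *)
Lemma simple_preimage (V : Type) t (Op : set V) f (Q : set V) :
  simple t Op f -> levy_filtration L t (f @^-1` Q).
Proof.
move=> [J [p [c [h1 h2 h3]]]].
have -> : f @^-1` Q = [set w | exists i : {i : J | `[< Q (c i) >]}, p w = val i].
  apply/seteqP; split=> [w|w [[i /asboolP Qi] /= pw]]; rewrite /preimage /= h3.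
    by move=> Qw; exists (exist _ (p w) (asboolT Qw)).
  by rewrite pw.
by apply: levy_filtration_finU => i; exact: h1.
Qed.

Lemma simple_sub_meas t (f : Omega -> R) : simple t setT f ->
  sub_meas (levy_gen L t) f /\ exists M : R, forall w, `|f w| <= M.
Proof.
move=> sf; split; first by move=> _ B _; rewrite setTI; exact: simple_preimage sf.
case: sf => J [p [c [_ _ h]]]; exists (\sum_(j : J) `|c j|) => w.
by rewrite h (bigD1 (p w))//= lerDl sumr_ge0.
Qed.

Lemma simple_brv t (f : Omega -> R) : simple t setT f -> bounded_rv f.
Proof.
move=> /simple_sub_meas[mf bf]; split => //.
by apply: sub_meas_measurable mf; exact: levy_gen_measurable.
Qed.

Lemma ae_simple (V : Type) t (Op : set V) f (Q : V -> Omega -> Prop) :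
  simple t Op f -> (forall x, Op x -> {ae P, forall w, Q x w}) ->
  {ae P, forall w, Q (f w) w}.
Proof.
move=> [J [p [c [_ h2 h3]]]] hQ.
have : {ae P, forall w, forall j : J, Q (c j) w}.
  by apply: filter_forall => j; exact: hQ.
by apply: filterS => w; rewrite h3; exact.
Qed.

End simple_maps.

Section grids.
Context {R : realType}.

Definition grid (T : R) (s : seq R) := path <%R 0 s /\ last 0 s = T.

Definition node (s : seq R) (j : nat) : R := nth 0 (0 :: s) j.

Variables (T : R) (s : seq R).
Hypothesis gs : grid T s.

Lemma node0 : node s 0 = 0. Proof. by []. Qed.

Lemma nodeS j : node s j.+1 = nth 0 s j. Proof. by []. Qed.

Lemma node_last : node s (size s) = T.
Proof. by rewrite -gs.2 (last_nth 0). Qed.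

Lemma node_lt i j : (i < j)%N -> (j <= size s)%N -> node s i < node s j.
Proof.
move=> ij js; have := sorted_ltn_nth lt_trans 0 (s := 0 :: s) gs.1.
by apply=> //; rewrite inE /= ltnS// (leq_trans (ltnW ij)).
Qed.

Lemma node_le i j : (i <= j)%N -> (j <= size s)%N -> node s i <= node s j.
Proof. by rewrite leq_eqVlt => /orP[/eqP ->//|ij] js; exact/ltW/node_lt. Qed.

Lemma node_in j : (j < size s)%N -> node s j.+1 \in s.
Proof. by move=> js; rewrite nodeS mem_nth. Qed.

Lemma node_in0 j : (j <= size s)%N -> node s j \in 0 :: s.
Proof. by move=> js; rewrite /node mem_nth. Qed.

Lemma node_ge0 j : (j <= size s)%N -> 0 <= node s j.
Proof. by move=> js; rewrite -node0; exact: node_le. Qed.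

Lemma node_leT j : (j <= size s)%N -> node s j <= T.
Proof. by move=> js; rewrite -node_last; exact: node_le. Qed.

Lemma node_gt0 j : (j < size s)%N -> 0 < node s j.+1.
Proof. by move=> js; rewrite -[ltLHS]node0; exact: node_lt. Qed.

Lemma in_node x : x \in 0 :: s -> exists2 j, (j <= size s)%N & x = node s j.
Proof.
by move=> xs; exists (index x (0 :: s)); rewrite ?/node ?nth_index// -ltnS index_mem.
Qed.

Lemma grid_in x : x \in 0 :: s -> 0 <= x <= T.
Proof. by move=> /in_node[j js ->]; rewrite node_ge0 ?node_leT. Qed.

Lemma grid_locate t : 0 < t <= T -> exists2 j, (j < size s)%N &
  node s j < t <= node s j.+1.
Proof.
move=> /andP[t0 tT]; pose j := find (fun x => t <= x) (0 :: s).
have hs : has (fun x => t <= x) (0 :: s).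
  by apply/hasP; exists T => //; rewrite -node_last; exact: node_in0.
have tj := nth_find 0 hs; rewrite -/j in tj.
have jlt : (j < (size s).+1)%N by rewrite /j -has_find.
case E : j => [|k]; first by move: tj; rewrite E /= leNgt t0.
exists k; first by rewrite -E in jlt * => //; move: jlt; rewrite E ltnS.
rewrite /node -E tj andbT ltNge.
by have /negbT := @before_find _ 0 (fun x => t <= x) (0 :: s) k ltac:(by rewrite -/j E).
Qed.

Lemma grid_locate_uniq t i j : (i < size s)%N -> (j < size s)%N ->
  node s i < t <= node s i.+1 -> node s j < t <= node s j.+1 -> i = j.
Proof.
wlog ij : i j / (i <= j)%N.
  by move=> h; case: (leqP i j) => [/h//|/ltnW/h h'] *; apply/esym/h'.
move=> si sj /andP[_ ti] /andP[tj _]; apply/eqP; rewrite eqn_leq ij /= leqNgt.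
apply/negP => ij'; have := node_le ij' (ltnW sj).
by rewrite leNgt (lt_le_trans tj ti).
Qed.

End grids.

Section grid_sums.
Context {R : realType} (V : zmodType).

Definition grid_sum (f : R -> R -> V) (x : R) (s : seq R) : V :=
  \sum_(j < size s) f (nth 0 (x :: s) j) (nth 0 s j).

Lemma grid_sum_cons f x y s : grid_sum f x (y :: s) = f x y + grid_sum f y s.
Proof. by rewrite /grid_sum big_ord_recl. Qed.

(** Sums of increments of phi y are not affected by grid points where the
    integrand phi does not change. *)
Lemma grid_sum_refine (phi : R -> R -> V) x s s' :
  path <%R x s -> path <%R x s' -> {subset s <= s'} -> last x s = last x s' ->
  (forall t t', x < t <= last x s -> x < t' <= last x s ->
     (forall z, z \in s -> (z < t) = (z < t')) -> phi t = phi t') ->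
  grid_sum (fun y z => phi z z - phi z y) x s =
  grid_sum (fun y z => phi z z - phi z y) x s'.
Proof.
elim: s' x s => [|y' s' IH] x s.
  by case: s => // y s _ _ /(_ y (mem_head _ _)).
case: s => [_ /= /andP[xy' py'] _ lE|y s].
  have : x < last y' s'.
    have : path <%R x (y' :: s') by rewrite /= xy'.
    rewrite path_sortedE; last exact: lt_trans.
    by move=> /andP[/allP/(_ (last y' s') (mem_last _ _))].
  by rewrite -lE ltxx.
move=> /= /andP[xy py] /andP[xy' py'] sub lE hphi.
have gty z : z \in s -> y < z.
  move: py; rewrite path_sortedE; last exact: lt_trans.
  by move=> /andP[/allP h _] /h.
have gty' z : z \in s' -> y' < z.
  move: py'; rewrite path_sortedE; last exact: lt_trans.
  by move=> /andP[/allP h _] /h.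
have yl : y <= last y s.
  by have := mem_last y s; rewrite inE => /orP[/eqP -> //|/gty/ltW].
have [E|yN] := eqVneq y' y.
  subst y'; rewrite !grid_sum_cons; congr (_ + _); apply: IH => //.
    move=> z zs; have := sub z; rewrite !inE zs orbT => /(_ isT) /orP[/eqP zy|//].
    by have := gty _ zs; rewrite zy ltxx.
  move=> t t' /andP[t1 t2] /andP[t'1 t'2] h; apply: hphi.
  - by rewrite t2 (lt_trans xy t1).
  - by rewrite t'2 (lt_trans xy t'1).
  - by move=> z; rewrite inE => /orP[/eqP ->|/h//]; rewrite t1 t'1.
have y'y : y' < y.
  have := sub y (mem_head _ _); rewrite inE eq_sym (negPf yN) /=; exact: gty'.
have sep : phi y' = phi y.
  apply: hphi; rewrite ?xy ?xy' ?yl ?(le_trans (ltW y'y) yl)// => z.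
  rewrite inE => /orP[/eqP ->|/gty yz]; first by rewrite ltxx ltNge (ltW y'y).
  by rewrite ltNge (ltW (lt_trans y'y yz)) ltNge (ltW yz).
rewrite [RHS]grid_sum_cons -(IH y' (y :: s)).
- by rewrite !grid_sum_cons sep addrA [X in _ = X + _]addrC addrA subrK.
- by rewrite /= y'y.
- by [].
- move=> z zs; have := sub z zs; rewrite inE => /orP[/eqP zy'|//].
  move: zs; rewrite zy' inE => /orP[/eqP E|/gty]; first by rewrite E ltxx in y'y.
  by rewrite ltNge (ltW y'y).
- by [].
- move=> t t' /andP[t1 t2] /andP[t'1 t'2] h; apply: hphi => //.
  + by rewrite t2 (lt_trans xy' t1).
  + by rewrite t'2 (lt_trans xy' t'1).
Qed.

End grid_sums.

(** * Representing step processes *)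

Section step_on.
Context {d} {Omega : measurableType d} {R : realType} {P : probability Omega R}.
Context {G H : hilbertType R} (L : R -> G -> {RV P >-> R}) (T : R).
Hypothesis T0 : 0 < T.

(** Being a step process over a grid, in a form that is evidently preserved when
    the grid is refined. *)
Definition step_on (V : Type) (Op : set V) (s : seq R) (Th : Omega -> R -> V) :=
  [/\ simple L 0 Op (fun w => Th w 0),
      forall t, 0 < t <= T -> exists x,
        [/\ x \in 0 :: s, x < t & simple L x Op (fun w => Th w t)] &
      forall w t t', 0 < t <= T -> 0 < t' <= T ->
        (forall x, x \in s -> (x < t) = (x < t')) -> Th w t = Th w t'].

Lemma step_on_refine (V : Type) (Op : set V) s s' Th : {subset s <= s'} ->
  step_on Op s Th -> step_on Op s' Th.
Proof.
move=> ss [h1 h2 h3]; split=> [//|t tT|w t t' tT t'T h].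
  have [x [xs xt sx]] := h2 t tT; exists x; split=> //.
  by move: xs; rewrite !inE => /orP[->//|/ss ->]; rewrite orbT.
by apply: h3 => // x /ss; exact: h.
Qed.

Lemma step_on_map2 (V1 V2 V3 : Type) (O1 : set V1) (O2 : set V2) (O3 : set V3)
    (h : V1 -> V2 -> V3) s Th Th' : (forall x y, O1 x -> O2 y -> O3 (h x y)) ->
  grid T s -> step_on O1 s Th -> step_on O2 s Th' ->
  step_on O3 s (fun w t => h (Th w t) (Th' w t)).
Proof.
move=> hO gs [h1 h2 h3] [h1' h2' h3']; split.
- exact: simple_map2 hO h1 h1'.
- move=> t tT; have [x [xs xt sx]] := h2 t tT; have [y [ys yt sy]] := h2' t tT.
  exists (Num.max x y); split.
  + by rewrite /Num.max; case: ifP.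
  + by rewrite gt_max xt.
  + apply: simple_map2 hO _ _; [apply: simple_mono sx|apply: simple_mono sy];
    by rewrite le_max lexx ?orbT.
- by move=> w t t' tT t'T e; rewrite (h3 w t t')// (h3' w t t').
Qed.

Lemma step_on_node (V : Type) (Op : set V) s Th j : grid T s -> step_on Op s Th ->
  (j < size s)%N -> simple L (node s j) Op (fun w => Th w (node s j.+1)).
Proof.
move=> gs [_ h _] js.
have jT : 0 < node s j.+1 <= T by rewrite (node_gt0 gs)//= (node_leT gs).
have [x [xs xj sx]] := h _ jT; apply: simple_mono sx.
have [i si xE] := in_node xs; rewrite xE in xj *.
apply: (node_le gs); last exact: ltnW.
by rewrite -ltnS ltnNge; apply/negP => ji; have := node_le gs ji si; rewrite leNgt xj.
Qed.

Lemma step_on_at (V : Type) (Op : set V) s Th j t w : grid T s -> step_on Op s Th ->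
  (j < size s)%N -> node s j < t <= node s j.+1 -> Th w t = Th w (node s j.+1).
Proof.
move=> gs [_ _ h] js /andP[jt tj].
have j0 : 0 <= node s j by apply: (node_ge0 gs); exact: ltnW.
apply: h; first by rewrite (le_lt_trans j0 jt) (le_trans tj) ?(node_leT gs).
  by rewrite (node_gt0 gs)//= (node_leT gs).
move=> x xs; have [i si xE] := @in_node _ s x ltac:(by rewrite inE xs orbT).
rewrite xE; case: (leqP i j) => ij.
  by rewrite (le_lt_trans (node_le gs ij (ltnW js)) jt) (node_lt gs).
have h2 := node_le gs ij si.
by rewrite ltNge (le_trans tj h2)/= ltNge h2.
Qed.

Lemma step_on_in (V : Type) (Op : set V) s Th w t : step_on Op s Th ->
  0 <= t <= T -> Op (Th w t).
Proof.
move=> [h1 h2 _] /andP[]; rewrite le_eqVlt => /orP[/eqP <- _|t0 tT].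
  by case: h1 => J [p [c [_ h ->]]].
by have [|x [_ _ [J [p [c [_ h ->]]]]]] := h2 t; first by rewrite t0.
Qed.

(** ** Common refinements *)

Definition merge_grid (s s' : seq R) := sort <=%R (undup (s ++ s')).

Lemma merge_gridP s s' : grid T s -> grid T s' ->
  [/\ grid T (merge_grid s s'), {subset s <= merge_grid s s'} &
      {subset s' <= merge_grid s s'}].
Proof.
move=> gs gs'; have mE x : (x \in merge_grid s s') = (x \in s) || (x \in s').
  by rewrite mem_sort mem_undup mem_cat.
have gt0 q x : grid T q -> x \in q -> 0 < x.
  move=> [+ _] xq; rewrite path_sortedE; last exact: lt_trans.
  by move=> /andP[/allP/(_ _ xq)].
have so : sorted <%R (merge_grid s s').
  by rewrite lt_sorted_uniq_le sort_uniq undup_uniq sort_sorted//; exact: le_total.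
have pa : path <%R 0 (merge_grid s s').
  rewrite path_sortedE; last exact: lt_trans.
  rewrite so andbT; apply/allP => x; rewrite mE => /orP[]; exact: gt0.
split; [|by move=> x xs; rewrite mE xs|by move=> x xs; rewrite mE xs orbT].
split => //; set q := merge_grid s s' in pa mE so *.
have gq : grid (last 0 q) q by [].
have Ts : T \in s.
  have := mem_last 0 s; rewrite gs.2 inE => /orP[/eqP T00|//].
  by have := T0; rewrite T00 ltxx.
have Tq : T \in 0 :: q by rewrite inE mE Ts orbT.
have /andP[_ h1] := grid_in gq Tq.
apply/eqP; rewrite eq_le h1 andbT.
have := mem_last 0 q; rewrite inE mE => /orP[/eqP ->|/orP[]xs]; first exact: ltW.
  by have /andP[] := @grid_in _ _ _ gs (last 0 q) ltac:(by rewrite inE xs orbT).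
by have /andP[] := @grid_in _ _ _ gs' (last 0 q) ltac:(by rewrite inE xs orbT).
Qed.

(** ** From representations to grids and back *)

Section op.
Context {U : normedModType R} (Op : set (U -> H)).
Hypothesis Op0 : Op (fun=> 0).
Hypothesis OpD : forall F F', Op F -> Op F' -> Op (fun x => F x + F' x).

Definition step_piece (S : step (Omega := Omega) (R := R) (U -> H)) i w : U -> H :=
  fun u => \sum_(k < step_N S i) \1_(step_A S i k) w *: step_F S i k u.

Lemma op_sum (N : nat) (F : 'I_N -> U -> H) (b : 'I_N -> bool) :
  (forall k, Op (F k)) -> Op (fun u => \sum_(k < N) (b k)%:R *: F k u).
Proof.
move=> hF; elim: N F b hF => [|N IH] F b hF.
  by rewrite (_ : (fun _ => _) = (fun=> 0))//; apply/funext => u; rewrite big_ord0.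
rewrite (_ : (fun _ => _) = (fun u => \sum_(k < N) (b (widen_ord (leqnSn N) k))%:R *: F (widen_ord (leqnSn N) k) u
   + (b ord_max)%:R *: F ord_max u)); last by apply/funext => u; rewrite big_ord_recr.
apply: OpD; first by apply: IH.
case: (b _); last by under eq_fun do rewrite scale0r.
by under eq_fun do rewrite scale1r.
Qed.

Lemma simple_piece (N : nat) (F : nat -> U -> H) (A : nat -> set Omega) t :
  (forall k, (k < N)%N -> Op (F k)) ->
  (forall k, (k < N)%N -> levy_filtration L t (A k)) ->
  simple L t Op (fun w u => \sum_(k < N) \1_(A k) w *: F k u).
Proof.
move=> hF hA; exists {ffun 'I_N -> bool}, (fun w => [ffun k : 'I_N => w \in A k]),
  (fun (b : {ffun 'I_N -> bool}) u => \sum_(k < N) (b k)%:R *: F k u).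
split=> [b|b|w]; last 2 first.
- by apply: op_sum => k; exact: hF.
- by apply/funext => u; apply: eq_bigr => k _; rewrite ffunE indicE.
rewrite (_ : _ @^-1` _ = [set w | forall k : 'I_N, (if b k then A k else ~` A k) w]).
  apply: levy_filtration_fin => k; case: (b k); last apply: levy_filtrationC; exact: hA.
apply/seteqP; split=> [w /= <- k|w /= h]; first rewrite ffunE.
  by case: ifP; rewrite ?inE// => /negP; rewrite inE.
apply/ffunP => k; rewrite ffunE; have := h k; case: (b k) => hk; first by rewrite mem_set.
by rewrite memNset.
Qed.

Lemma simple_pieceV t f : simple L t Op f -> exists (N : nat) (F : nat -> U -> H) (A : nat -> set Omega),
  [/\ forall k, (k < N)%N -> Op (F k), forall k, (k < N)%N -> levy_filtration L t (A k) &
      forall w u, f w u = \sum_(k < N) \1_(A k) w *: F k u].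
Proof.
move=> [J [p [c [h1 h2 h3]]]].
pose F k := if insub k is Some i then c (@enum_val J predT i) else fun=> 0.
pose A k := if insub k is Some i then p @^-1` [set (@enum_val J predT i)] else set0.
exists #|J|, F, A; split=> [k kN|k kN|w u]; rewrite /F /A.
- by case: insubP => // i _ _; exact: h2.
- by case: insubP => [i _ _|]; [exact: h1|rewrite kN].
have iE (i : 'I_#|J|) : insub (i : nat) = Some i by exact: valK.
rewrite h3 (bigD1 (enum_rank (p w)))//= iE enum_rankK indicE mem_set// scale1r.
rewrite big1 ?addr0// => i ip; rewrite iE indicE memNset ?scale0r//= => pi.
by move/negP : ip; apply; rewrite pi enum_valK.
Qed.

Definition step_grid (S : step (Omega := Omega) (R := R) (U -> H)) :=
  [seq step_t S i.+1 | i <- index_iota 1 (step_n S)].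

Lemma size_step_grid S : size (step_grid S) = (step_n S).-1.
Proof. by rewrite size_map size_iota subn1. Qed.

Lemma node_step_grid S j : adapted_step L T Op S -> (j < step_n S)%N ->
  node (step_grid S) j = step_t S j.+1.
Proof.
move=> [[t1 _ _] _]; case: j => [|j] jn; first by rewrite t1.
rewrite nodeS (nth_map 0%N); first by rewrite nth_iota ?add1n// subn1 -ltnS prednK// (leq_ltn_trans _ jn).
by rewrite size_iota subn1 -ltnS prednK// (leq_ltn_trans _ jn).
Qed.

Lemma step_grid_grid S : adapted_step L T Op S -> grid T (step_grid S).
Proof.
move=> aS; have [[t1 tn n1] [tlt _ _ _]] := aS.
have szE := size_step_grid S.
have n0 : (0 < step_n S)%N by exact: ltn_trans n1.
split.
  apply/(pathP 0) => j; rewrite szE => jn.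
  have jn' : (j.+1 < step_n S)%N by rewrite -ltn_predRL.
  rewrite -/(node _ j) -nodeS !node_step_grid//; last exact: ltn_trans jn'.
  by apply: tlt; rewrite /=.
by rewrite (last_nth 0) -/(node _ _) szE node_step_grid// prednK// tn.
Qed.

Lemma step_value0 S w u : adapted_step L T Op S -> step_value S w 0 u = step_piece S 0 w u.
Proof.
move=> aS; rewrite /step_value indicE mem_set// scale1r big_nat.
rewrite [X in _ + X]big1 ?addr0// => i /andP[i1 iS].
rewrite indicE memNset ?scale0r//= in_itv/= => /andP[+ _].
have gs := step_grid_grid aS.
case: i i1 iS => // i _ iS; have := node_step_grid aS (ltnW iS) => <-.
by rewrite ltNge (node_ge0 gs)// size_step_grid -ltnS prednK ?(leq_ltn_trans _ iS)// ltnW.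
Qed.

Lemma step_value_at S w t j u : adapted_step L T Op S -> (j < size (step_grid S))%N ->
  node (step_grid S) j < t <= node (step_grid S) j.+1 ->
  step_value S w t u = step_piece S j.+1 w u.
Proof.
move=> aS js jt; have gs := step_grid_grid aS.
have n1 : (1 < step_n S)%N by case: aS => -[].
have nS : (step_n S).-1.+1 = step_n S by rewrite prednK// ltnW.
rewrite /step_value indicE memNset ?scale0r ?add0r//=; last first.
  move=> t0; move: jt; rewrite t0 => /andP[+ _].
  by rewrite ltNge (node_ge0 gs)// ltnW.
have js' : (j.+1 < step_n S)%N by rewrite -nS ltnS -size_step_grid.
rewrite (bigD1_seq j.+1) ?mem_index_iota ?iota_uniq//=.
rewrite indicE mem_set/=; last first.
  by rewrite in_itv/= -!(node_step_grid aS)// ltnW.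
rewrite scale1r [X in _ + X]big_seq_cond [X in _ + X]big1 ?addr0// => i; rewrite mem_index_iota => /andP[/andP[i1 iS] ij].
rewrite indicE memNset ?scale0r//= in_itv/= => it.
case: i i1 iS ij it => // i _ iS ij it; move/eqP : ij; apply.
congr _.+1; apply: (grid_locate_uniq gs) jt => //; first by rewrite size_step_grid -ltnS nS.
by rewrite !(node_step_grid aS)// ltnW.
Qed.

Lemma represents_piece0 S (Th : Omega -> R -> U -> H) w : adapted_step L T Op S ->
  represents T S Th -> Th w 0 = step_piece S 0 w.
Proof.
by move=> aS rS; rewrite rS ?lexx ?ltW//; apply/funext => u; exact: step_value0.
Qed.

Lemma represents_piece S (Th : Omega -> R -> U -> H) w j : adapted_step L T Op S ->
  represents T S Th -> (j < size (step_grid S))%N ->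
  Th w (node (step_grid S) j.+1) = step_piece S j.+1 w.
Proof.
move=> aS rS js; have gs := step_grid_grid aS.
rewrite rS; last by rewrite (node_ge0 gs)// (node_leT gs).
by apply/funext => u; apply: step_value_at => //; rewrite lexx (node_lt gs).
Qed.

Lemma step_on_of_step S (Th : Omega -> R -> U -> H) : adapted_step L T Op S ->
  represents T S Th -> step_on Op (step_grid S) Th.
Proof.
move=> aS rS; have gs := step_grid_grid aS.
have [[t1 tn n1] [tlt hOp hA0 hA]] := aS.
have nS : (step_n S).-1.+1 = step_n S by rewrite prednK// ltnW.
have val w t j : (j < size (step_grid S))%N ->
    node (step_grid S) j < t <= node (step_grid S) j.+1 -> Th w t = step_piece S j.+1 w.
  move=> js jt; rewrite rS; last first.
    have /andP[h1 h2] := jt.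
    rewrite (le_trans h2 (node_leT gs _))// (le_trans _ (ltW h1))// (node_ge0 gs)//.
    exact: ltnW.
  by apply/funext => u; exact: step_value_at.
split.
- have -> : (fun w => Th w 0) = step_piece S 0.
    by apply/funext => w; exact: represents_piece0.
  apply: simple_piece => k kN; first by apply: hOp => //; exact: ltnW.
  exact: hA0.
- move=> t tT; have [j js jt] := grid_locate gs tT.
  exists (node (step_grid S) j); split.
  + by apply: node_in0; exact: ltnW.
  + by case/andP: jt.
  have js' : (j.+1 < step_n S)%N by rewrite -nS ltnS -size_step_grid.
  have -> : (fun w => Th w t) = step_piece S j.+1.
    by apply/funext => w; exact: val.
  apply: simple_piece => k kN; first exact: hOp.
  by rewrite node_step_grid ?(ltnW js')//; exact: hA.
- move=> w t t' tT t'T h; have [j js jt] := grid_locate gs tT.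
  rewrite (val w t j)// (val w t' j)//; have /andP[h1 h2] := jt.
  apply/andP; split; last first.
    by rewrite leNgt -h ?node_in// -leNgt.
  case: (j) js h1 => [_ _|i iS h1]; first by case/andP: t'T.
  by rewrite -h// node_in// ltnW.
Qed.

Lemma step_of_step_on s (Th : Omega -> R -> U -> H) : grid T s -> step_on Op s Th ->
  exists S, adapted_step L T Op S /\ represents T S Th.
Proof.
move=> gs sT; pose time i := if i is i'.+1 then node s i' else 0.
pose rtime i := if i is 0 then 0 else node s i.
have /choice[D hD] : forall i, exists D : nat * (nat -> U -> H) * (nat -> set Omega),
    (i <= size s)%N -> [/\ forall k, (k < D.1.1)%N -> Op (D.1.2 k),
      forall k, (k < D.1.1)%N -> levy_filtration L (time i) (D.2 k) &
      forall w u, Th w (rtime i) u = \sum_(k < D.1.1) \1_(D.2 k) w *: D.1.2 k u].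
  move=> i; have [is_|] := leqP i (size s); last first.
    by exists (0%N, (fun _ _ => 0), fun=> set0).
  have : simple L (time i) Op (fun w => Th w (rtime i)).
    case: i is_ => [_|i is_]; first by case: sT.
    exact: (step_on_node gs sT).
  by move=> /simple_pieceV[N [F [A ?]]]; exists (N, F, A).
have s0 : (0 < size s)%N.
  by have [j] := @grid_locate _ _ _ gs T ltac:(by rewrite T0 lexx); case: (size s).
pose S := Step (Omega := Omega) (size s).+1 time (fun i => (D i).1.1)
  (fun i => (D i).1.2) (fun i => (D i).2).
have aS : adapted_step L T Op S.
  split; split=> //=.
  - exact: (node_last gs).
  - by case=> // i iS; exact: (node_lt gs).
  - by move=> i k iS kN; have [+ _ _] := hD i iS; apply.
  - by move=> k kN; have [_ + _] := hD 0%N isT; apply.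
  - by move=> i k /andP[_ iS] kN; have [_ + _] := hD i iS; apply.
exists S; split=> // w t /andP[]; rewrite le_eqVlt => /orP[/eqP <- _|t0 tT].
  apply/funext => u; rewrite step_value0//; have [_ _ h] := hD 0%N isT.
  exact: h.
have szE : size (step_grid S) = size s by rewrite size_step_grid.
have nodeE j : (j < (size s).+1)%N -> node (step_grid S) j = node s j.
  by move=> js; rewrite node_step_grid.
have [j js jt] := grid_locate gs (t := t) ltac:(by rewrite t0).
apply/funext => u; rewrite (@step_value_at _ _ _ j)//; last 2 first.
- by rewrite szE.
- by rewrite !nodeE// ltnW.
rewrite (step_on_at w gs sT js jt).
by have [_ _ h] := hD j.+1 js; exact: h.
Qed.

End op.
End step_on.

(** * Increments of the integral of a step process *)

Section average_expectation.
Context {d} {Omega : measurableType d} {R : realType} (P : probability Omega R).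
Context {H : hilbertType R}.

Lemma brv_savg (f : H -> Omega -> R) (q : seq H) x :
  (forall h, bounded_rv (f h)) ->
  bounded_rv (fun w => savg (f^~ w) q x) /\
  EE P (fun w => savg (f^~ w) q x) = savg (fun h => EE P (f h)) q x.
Proof.
move=> bf; elim: q x => [|v q IH] x //=.
have [b1 e1] := IH (x + v); have [b2 e2] := IH (x - v).
rewrite -e1 -e2 -EED// mulrC -EEZ; last exact: brvD.
split.
  have := brvZ (2^-1) (brvD b1 b2); congr bounded_rv.
  by apply/funext => w; rewrite mulrC.
by congr (EE P _); apply/funext => w; rewrite mulrC.
Qed.

(** Averaging a linear family of cosines over signs turns the cosine of a sum
    into a product of cosines. *)
Lemma savg_EE_cos (X : H -> Omega -> R) (Z : Omega -> R) (q : seq H) x :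
  (forall h, measurable_fun [set: Omega] (X h)) ->
  (forall c h k, {ae P, forall w, X (c *: h + k) w = c * X h w + X k w}) ->
  bounded_rv Z ->
  savg (fun h => EE P (fun w => Z w * cos (X h w))) q x =
  EE P (fun w => Z w * (cos (X x w) * \prod_(v <- q) cos (X v w))).
Proof.
move=> mX lX bZ.
have bprod (r : seq H) : bounded_rv (fun w => \prod_(v <- r) cos (X v w)).
  elim: r => [|v r IH]; first by under eq_fun do rewrite big_nil; exact: brv_cst.
  by under eq_fun do rewrite big_cons; apply: brvM => //; exact: brv_cos.
have bX h := brv_cos (mX h).
elim: q x => [|v q IH] x /=.
  by congr (EE P _); apply/funext => w; rewrite big_nil mulr1.
have b3 h : bounded_rv (fun w => Z w * (cos (X h w) * \prod_(v <- q) cos (X v w))).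
  by apply: brvM => //; exact: brvM.
rewrite !IH -EED// mulrC -EEZ; last exact: brvD.
apply: EE_ae; first exact/brvZ/brvD.
  by under eq_fun do rewrite big_cons; do !apply: brvM.
have h1 := lX 1 v x; have h2 := lX (-1) v x.
apply: filterS2 h1 h2 => w; rewrite scale1r scaleN1r mul1r mulN1r addrC => ->.
rewrite [- v + x]addrC => ->; rewrite [- X v w + _]addrC (addrC (X v w)) big_cons cosD cosB; by field.
Qed.

(** A bound for every choice of signs bounds the average. *)
Lemma savg_EE_le (f : H -> R) (eta : R) n (y : nat -> Omega -> H) (x : Omega -> H) :
  (forall b : nat -> R, (forall j, b j = 1 \/ b j = -1) ->
    bounded_rv (fun w => f (x w + \sum_(j < n) b j *: y j w)) /\
    EE P (fun w => f (x w + \sum_(j < n) b j *: y j w)) <= eta) ->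
  bounded_rv (fun w => savg f (mkseq (y^~ w) n) (x w)) /\
  EE P (fun w => savg f (mkseq (y^~ w) n) (x w)) <= eta.
Proof.
elim: n y x => [|n IH] y x hb.
  have := hb (fun=> 1) (fun=> or_introl erefl).
  by under eq_fun do rewrite big_ord0 addr0.
have key (c : R) : c = 1 \/ c = -1 ->
    bounded_rv (fun w => savg f (mkseq ((fun j => y j.+1)^~ w) n) (x w + c *: y 0%N w)) /\
    EE P (fun w => savg f (mkseq ((fun j => y j.+1)^~ w) n) (x w + c *: y 0%N w)) <= eta.
  move=> hc; apply: IH => b hb'.
  have := hb (fun j => if j is j'.+1 then b j' else c) ltac:(by case).
  under eq_fun do rewrite big_ord_recl addrA.
  by [].
have [b1 e1] := key 1 (or_introl erefl); have [b2 e2] := key (-1) (or_intror erefl).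
have E : (fun w => savg f (mkseq (y^~ w) n.+1) (x w)) =
  (fun w => 2^-1 * (savg f (mkseq ((fun j => y j.+1)^~ w) n) (x w + 1 *: y 0%N w) +
            savg f (mkseq ((fun j => y j.+1)^~ w) n) (x w + -1 *: y 0%N w))).
  apply/funext => w; rewrite scale1r scaleN1r /mkseq /= mulrC.
  by rewrite (iotaDl 1 0) -map_comp.
rewrite E; split; first exact/brvZ/brvD.
rewrite EEZ; last exact: brvD.
by rewrite EED//; lra.
Qed.

End average_expectation.

Section increments.
Context {d} {Omega : measurableType d} {R : realType} (P : probability Omega R).
Context {G H : hilbertType R} (sepG : separable G).
Context (a : set G) (ba : orthonormal_basis a) (e : nat -> H) (te : total_seq e).
Context (alpha : R).
Hypotheses (alpha0 : 0 < alpha) (alpha2 : alpha < 2).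
Context (L : R -> G -> {RV P >-> R}).
Hypothesis levyL : cylindrical_levy_process L.
Hypothesis stableL : canonical_stable alpha L.
Context (T : R) (s : seq R) (gs : grid T s).
Context (Th : Omega -> R -> G -> H).
Hypothesis sTh : step_on L T (hs_op a) s Th.

Let n := size s.

Definition at_node j w : G -> H := Th w (node s j.+1).

(** The coordinate along h of the increment over the j-th interval. *)
Definition dI j h w := incr L (node s j) (node s j.+1) (adjoint (at_node j w) h) w.

Definition dt j := node s j.+1 - node s j.

Definition vh h j w := dt j * `|adjoint (at_node j w) h| `^ alpha.

Definition vv j w := dt j * hsn a (at_node j w) `^ alpha.

Definition vN N j w := dt j * hsq e (at_node j w) N `^ (alpha / 2).

Lemma at_node_simple j : (j < n)%N -> simple L (node s j) (hs_op a) (at_node j).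
Proof. exact: (step_on_node gs sTh). Qed.

Lemma at_node_hs j w : (j < n)%N -> hs_op a (at_node j w).
Proof. by move=> /at_node_simple[J [p [c [_ h ->]]]]. Qed.

Lemma at_node_bdd j w : (j < n)%N -> bounded_op (at_node j w).
Proof. by move=> /(at_node_hs w)[]. Qed.

Lemma dt_gt0 j : (j < n)%N -> 0 < dt j.
Proof. by move=> jn; rewrite subr_gt0 (node_lt gs). Qed.

Lemma nodes_le j : (j < n)%N -> 0 <= node s j <= node s j.+1.
Proof.
by move=> jn; rewrite (node_ge0 gs) ?(ltnW jn)// (node_le gs).
Qed.

Lemma vh_ge0 h j w : (j < n)%N -> 0 <= vh h j w.
Proof. by move=> jn; rewrite mulr_ge0 ?powR_ge0// ltW// dt_gt0. Qed.

Lemma vv_ge0 j w : (j < n)%N -> 0 <= vv j w.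
Proof. by move=> jn; rewrite mulr_ge0 ?powR_ge0// ltW// dt_gt0. Qed.

Lemma vN_ge0 N j w : (j < n)%N -> 0 <= vN N j w.
Proof. by move=> jn; rewrite mulr_ge0 ?powR_ge0// ltW// dt_gt0. Qed.

Lemma fun_of_node (psi : (G -> H) -> R) j : (j < n)%N ->
  simple L (node s j) setT (fun w => psi (at_node j w)).
Proof. by move=> jn; exact: (simple_map (h := psi)) (at_node_simple jn). Qed.

Lemma brv_node (psi : (G -> H) -> R) j : (j < n)%N ->
  bounded_rv (fun w => psi (at_node j w)).
Proof. by move=> jn; exact: simple_brv (fun_of_node psi jn). Qed.

Lemma sub_meas_mono t t' (f : Omega -> R) : t <= t' ->
  sub_meas (levy_gen L t) f -> sub_meas (levy_gen L t') f.
Proof.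
move=> tt' mf _ B mB; rewrite setTI; apply: (levy_filtration_mono tt').
by have := mf measurableT B mB; rewrite setTI.
Qed.

Lemma sub_meas_node (psi : (G -> H) -> R) i j : (i < n)%N -> (i <= j)%N -> (j <= n)%N ->
  sub_meas (levy_gen L (node s j)) (fun w => psi (at_node i w)).
Proof.
move=> ilt ij jn; apply: (sub_meas_mono (node_le gs ij jn)).
by have [] := simple_sub_meas (fun_of_node psi ilt).
Qed.

Lemma dI_sub_meas j h : (j < n)%N -> sub_meas (levy_gen L (node s j.+1)) (dI j h).
Proof.
move=> jn; have [J [p [c [h1 h2 h3]]]] := at_node_simple jn.
have /andP[j0 jj] := nodes_le jn.
have -> : dI j h = fun w => \sum_(i : J) \1_(p @^-1` [set i]) w *
    incr L (node s j) (node s j.+1) (adjoint (c i) h) w.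
  apply/funext => w; rewrite (bigD1 (p w))//= indicE mem_set// mul1r /dI h3.
  rewrite big1 ?addr0// => i ip; rewrite indicE memNset ?mul0r//= => pi.
  by move: ip; rewrite pi eqxx.
apply: measurable_sum => i; apply: measurable_funM.
  apply: measurable_indic; exact: levy_filtration_mono jj _ (h1 i).
by apply: measurable_funB; apply: levy_sub_meas; rewrite ?lexx ?j0 ?jj ?(le_trans j0 jj).
Qed.

Lemma measurable_dI j h : (j < n)%N -> measurable_fun [set: Omega] (dI j h).
Proof. by move=> /(dI_sub_meas h); apply: sub_meas_measurable; exact: levy_gen_measurable. Qed.

Lemma incr_lin t t' c g k : 0 <= t -> 0 <= t' ->
  {ae P, forall w, incr L t t' (c *: g + k) w = c * incr L t t' g w + incr L t t' k w}.
Proof.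
move=> t0 t'0; have [h1 _] := levyL.1 _ t0; have [h2 _] := levyL.1 _ t'0.
apply: filterS2 (h1 c g k) (h2 c g k) => w e1 e2.
rewrite /incr e1 e2; ring.
Qed.

Lemma dI_lin j c h k : (j < n)%N ->
  {ae P, forall w, dI j (c *: h + k) w = c * dI j h w + dI j k w}.
Proof.
move=> jn; have /andP[j0 jj] := nodes_le jn.
pose D (F : G -> H) h' w := incr L (node s j) (node s j.+1) (adjoint F h') w.
have := @ae_simple _ _ _ P _ L _ _ _ _
  (fun F w => D F (c *: h + k) w = c * D F h w + D F k w) (at_node_simple jn).
apply=> F [bF _].
rewrite /D adjoint_linear//; exact: incr_lin j0 (le_trans j0 jj).
Qed.

Lemma dI_cond j h C : (j < n)%N -> levy_filtration L (node s j) C ->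
  EE P (fun w => \1_C w * cos (dI j h w)) = EE P (fun w => \1_C w * expR (- vh h j w)) /\
  EE P (fun w => \1_C w * sin (dI j h w)) = 0.
Proof.
move=> jn FC; have [J [p [c [h1 h2 h3]]]] := at_node_simple jn.
have jj := nodes_le jn.
have mF i : measurable (p @^-1` [set i]) by exact: levy_filtration_measurable (h1 i).
have mC := levy_filtration_measurable FC.
have FCi i := levy_filtrationI FC (h1 i).
have split (phi : Omega -> R) : bounded_rv phi ->
    EE P (fun w => \1_C w * phi w) =
    \sum_(i : J) EE P (fun w => \1_(C `&` p @^-1` [set i]) w * phi w).
  move=> bphi; rewrite -EE_sum; last first.
    by move=> i; apply: brvM => //; apply: brv_indic; exact: measurableI.
  congr (EE P _); apply/funext => w; rewrite (bigD1 (p w))//=.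
  rewrite big1 ?addr0 => [|i ip]; first by rewrite !indicE in_setI [X in _ && X]mem_set// andbT.
  rewrite indicE memNset ?mul0r// => -[_ /= pi]; by move: ip; rewrite pi eqxx.
have on_i i (phi : R -> R) : (fun w => \1_(C `&` p @^-1` [set i]) w * phi (dI j h w)) =
    (fun w => \1_(C `&` p @^-1` [set i]) w *
       phi (incr L (node s j) (node s j.+1) (adjoint (c i) h) w)).
  apply/funext => w; rewrite indicE; case: (boolP (_ \in _)); last by rewrite !mul0r.
  by rewrite inE => -[_ /= pi]; rewrite /dI h3 pi.
have bvh : bounded_rv (fun w => expR (- vh h j w)).
  exact: (brv_node (fun F => expR (- (dt j * `|adjoint F h| `^ alpha))) jn).
split.
  rewrite split; last exact/brv_cos/measurable_dI.
  rewrite split//; apply: eq_bigr => i _; rewrite on_i.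
  have [-> _] := incr_cond levyL stableL (adjoint (c i) h) jj (FCi i).
  rewrite -EE_indic; last exact: measurableI.
  rewrite mulrC -EEZ; last by apply: brv_indic; exact: measurableI.
  congr (EE P _); apply/funext => w; rewrite indicE.
  have [CFw|nCFw] := pselect ((C `&` p @^-1` [set i]) w); last first.
    by rewrite memNset// mulr0 mul0r.
  by rewrite mem_set// mulr1 mul1r /vh h3 CFw.2.
rewrite split; last exact/brv_sin/measurable_dI.
apply: big1 => i _; rewrite on_i.
by have [_ ->] := incr_cond levyL stableL (adjoint (c i) h) jj (FCi i).
Qed.

Lemma dI0 j : (j < n)%N -> {ae P, forall w, dI j 0 w = 0}.
Proof.
move=> jn; apply: filterS (dI_lin 1 0 0 jn) => w.
by rewrite scaler0 addr0 mul1r; lra.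
Qed.

End increments.

(** * Upper bound for the integral of a step process *)

Section dominated_expectation.
Context {d} {Omega : measurableType d} {R : realType} (P : probability Omega R).

Lemma EE_cvg (f : nat -> Omega -> R) (g : Omega -> R) (M : R) :
  (forall m, bounded_rv (f m)) -> bounded_rv g ->
  (forall m w, `|f m w| <= M) -> {ae P, forall w, f m w @[m --> \oo] --> g w} ->
  EE P (f m) @[m --> \oo] --> EE P g.
Proof.
move=> bf bg fM fg.
have [_ _ h] := @dominated_convergence _ _ _ P setT measurableT
  (fun m => EFin \o f m) (EFin \o g) (EFin \o cst M)
  (fun m => (measurable_EFinP setT (f m)).2 (brv_meas (bf m)))
  ((measurable_EFinP setT g).2 (brv_meas bg))
  ltac:(by apply: filterS fg => w h _; apply: cvg_EFin => //; exact: nearW)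
  (finite_measure_integrable_cst P M measurableT)
  ltac:(by apply: aeW => w m _; rewrite /= lee_fin).
rewrite /EE /Rintegral; apply: fine_cvg; rewrite fineK//.
by apply: integrable_fin_num => //; exact: brv_integrable.
Qed.

End dominated_expectation.

Section upper_bound.
Context {d} {Omega : measurableType d} {R : realType} (P : probability Omega R).
Context {G H : hilbertType R} (sepG : separable G).
Context (a : set G) (ba : orthonormal_basis a) (e : nat -> H) (te : total_seq e).
Context (alpha : R).
Hypotheses (alpha0 : 0 < alpha) (alpha2 : alpha < 2).
Context (L : R -> G -> {RV P >-> R}).
Hypothesis levyL : cylindrical_levy_process L.
Hypothesis stableL : canonical_stable alpha L.
Context (T : R) (s : seq R) (gs : grid T s).
Context (Th : Omega -> R -> G -> H).
Hypothesis sTh : step_on L T (hs_op a) s Th.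

Let n := size s.
Local Notation dI := (dI L s Th).
Local Notation vh := (vh alpha s Th).
Local Notation vv := (vv a alpha s Th).
Local Notation at_node := (at_node s Th).

Definition VV w := \sum_(j < n) vv j w.

Lemma brv_vv j : (j < n)%N -> bounded_rv (vv j).
Proof. by move=> jn; exact: (brv_node gs sTh (fun F => dt s j * hsn a F `^ alpha)). Qed.

Lemma brv_vh h j : (j < n)%N -> bounded_rv (vh h j).
Proof. by move=> jn; exact: (brv_node gs sTh (fun F => dt s j * `|adjoint F h| `^ alpha)). Qed.

Lemma brv_ord_sum (F : nat -> Omega -> R) m : (m <= n)%N ->
  (forall j, (j < n)%N -> bounded_rv (F j)) -> bounded_rv (fun w => \sum_(j < m) F j w).
Proof.
by move=> mn bF; apply: brv_sum => j; apply: bF; exact: leq_trans (ltn_ord j) mn.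
Qed.

Section stopped.
Variable B : nat -> set Omega.
Hypothesis FB : forall j, (j < n)%N -> levy_filtration L (node s j) (B j).

Let mB j : (j < n)%N -> measurable (B j).
Proof. by move=> jn; exact: levy_filtration_measurable (FB jn). Qed.

(** The integral of the process switched off outside the events B j. *)
Definition stopped m h w := \sum_(j < m) \1_(B j) w * dI j h w.

Lemma stopped_sub_meas m h : (m <= n)%N ->
  sub_meas (levy_gen L (node s m)) (stopped m h).
Proof.
move=> mn; apply: measurable_sum => j.
have jn : (j < n)%N := leq_trans (ltn_ord j) mn.
apply: measurable_funM.
  apply: measurable_indic; apply: levy_filtration_mono (FB jn).
  by apply: (node_le gs) => //; exact: ltnW.
by apply: sub_meas_mono (dI_sub_meas gs sTh h jn); exact: (node_le gs).
Qed.

Lemma measurable_stopped m h : (m <= n)%N -> measurable_fun [set: Omega] (stopped m h).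
Proof. by move=> /(stopped_sub_meas h); apply: sub_meas_measurable; exact: levy_gen_measurable. Qed.

Lemma stopped_lin m c h k : (m <= n)%N ->
  {ae P, forall w, stopped m (c *: h + k) w = c * stopped m h w + stopped m k w}.
Proof.
move=> mn; have : {ae P, forall w, forall j : 'I_m, dI j (c *: h + k) w = c * dI j h w + dI j k w}.
  apply: filter_forall => j; apply: (dI_lin sepG levyL gs sTh).
  exact: leq_trans (ltn_ord j) mn.
apply: filterS => w hw; rewrite /stopped mulr_sumr -big_split/=.
by apply: eq_bigr => j _; rewrite hw; ring.
Qed.

(** The sine terms vanish because an increment is conditionally symmetric. *)
Lemma stopped_cos m h : (m <= n)%N ->
  1 - EE P (fun w => \sum_(j < m) \1_(B j) w * vh h j w) <=
  EE P (fun w => cos (stopped m h w)).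
Proof.
elim: m => [_|m IH mn].
  under [X in _ - EE P X]eq_fun do rewrite big_ord0.
  under [X in _ <= EE P X]eq_fun do rewrite /stopped big_ord0 cos0.
  by rewrite !EE_cst; lra.
have mn' := ltnW mn; have bB := brv_indic (R := R) (mB mn).
have mD := measurable_dI gs sTh h mn.
have mS := measurable_stopped h mn'.
have bc := brv_cos mD; have bs := brv_sin mD.
have b1 := brv_cst (Omega := Omega) (1 : R).
have bd1 := brvM bB (brvB b1 bc).
have bcS := brv_cos mS; have bsS := brv_sin mS.
have bv : forall j, (j < n)%N -> bounded_rv (fun w => \1_(B j) w * vh h j w).
  by move=> j jn; apply: brvM; [exact/brv_indic/mB|exact: brv_vh].
under [X in _ - EE P X]eq_fun do rewrite big_ord_recr.
rewrite EED; [|exact: (brv_ord_sum (F := fun j w => \1_(B j) w * vh h j w) mn' bv)|exact: bv].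
have sinm : EE P (fun w => sin (stopped m h w) * (\1_(B m) w * sin (dI m h w))) = 0.
  apply: (sub_orthogonal (@levy_gen_measurable _ _ _ _ _ L (node s m))).
  - exact: brvM.
  - move=> C FC; have FCB := levy_filtrationI FC (FB mn).
    have [_ h0] := dI_cond levyL stableL gs sTh h mn FCB.
    by rewrite -[RHS]h0; congr (EE P _); apply/funext => w; rewrite indicI /= mulrA.
  - apply: measurableT_comp (stopped_sub_meas h mn').
    by apply: continuous_measurable_fun; exact: continuous_sin.
  - by exists 1 => w; exact: sin_max.
have cosm : EE P (fun w => \1_(B m) w * (1 - cos (dI m h w))) <=
    EE P (fun w => \1_(B m) w * vh h m w).
  have [hc _] := dI_cond levyL stableL gs sTh h mn (FB mn).
  have bex : bounded_rv (fun w => expR (- vh h m w)).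
    exact: (brv_node gs sTh (fun F => expR (- (dt s m * `|adjoint F h| `^ alpha))) mn).
  have -> : EE P (fun w => \1_(B m) w * (1 - cos (dI m h w))) =
      EE P (fun w => \1_(B m) w * (1 - expR (- vh h m w))).
    transitivity (EE P \1_(B m) - EE P (fun w => \1_(B m) w * cos (dI m h w))).
      rewrite -EEB//; last exact: brvM.
      by congr (EE P _); apply/funext => w; ring.
    rewrite hc -EEB//; last exact: brvM.
    by congr (EE P _); apply/funext => w; ring.
  apply: EE_le => [||w]; [exact: (brvM bB (brvB b1 bex))|exact: bv|].
  apply: ler_wpM2l; first by rewrite indicE.
  by have := expR_ge1Dx (- vh h m w); lra.
apply: (@le_trans _ _ (EE P (fun w => cos (stopped m h w) -
    \1_(B m) w * (1 - cos (dI m h w)) -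
    sin (stopped m h w) * (\1_(B m) w * sin (dI m h w))))).
  rewrite EEB; [|exact: brvB bcS bd1|exact: (brvM bsS (brvM bB bs))].
  rewrite sinm subr0 EEB//.
  have := IH mn'; lra.
apply: EE_le.
- exact: (brvB (brvB bcS bd1) (brvM bsS (brvM bB bs))).
- exact/brv_cos/measurable_stopped.
move=> w; rewrite [X in _ <= cos X]/stopped big_ord_recr /= -/(stopped m h w) indicE.
case: (w \in B m); rewrite /= ?mulr1n ?mulr0n !(mul1r, mul0r); last first.
  by rewrite addr0; lra.
rewrite (cosD (stopped m h w)).
have := cos_le1 (stopped m h w); have := cos_le1 (dI m h w); nra.
Qed.

(** Rademacher sums over m copies of each basis vector, scaled by the square root
    of m, approximate a Gaussian average of the bound of stopped_cos. *)
Lemma stopped_prod N m : (0 < m)%N ->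
  1 - EE P (fun w => \sum_(j < n) \1_(B j) w * (2 * vv j w)) <=
  EE P (fun w => \prod_(k < N) cos ((Num.sqrt m%:R)^-1 * stopped n (e k) w) ^+ m).
Proof.
move=> m0; set c := (Num.sqrt m%:R)^-1.
have c2 : c ^+ 2 *+ m = 1.
  by rewrite /c exprVn sqr_sqrtr ?ler0n// -mulr_natr mulVf// pnatr_eq0 -lt0n.
pose q := flatten [seq nseq m (c *: e k) | k <- iota 0 N].
have bigq (F : H -> R) idx (op : Monoid.com_law idx) :
    \big[op/idx]_(v <- q) F v = \big[op/idx]_(k < N) iterop m op (F (c *: e k)) idx.
  rewrite big_flatten big_map -(big_mkord predT (fun k => iterop m op (F (c *: e k)) idx)).
  rewrite /index_iota subn0; apply: eq_bigr => k _; rewrite big_nseq.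
  by rewrite Monoid.iteropE.
have qcos w : \prod_(v <- q) cos (stopped n v w) = \prod_(k < N) cos (stopped n (c *: e k) w) ^+ m.
  by rewrite bigq.
have qsqr w j : (j < n)%N ->
    \sum_(v <- q) `|adjoint (at_node j w) v| ^+ 2 = hsq e (at_node j w) N.
  move=> jn; have bF := at_node_bdd gs sTh w jn.
  rewrite bigq; apply: eq_bigr => k _; rewrite -/(GRing.natmul _ _).
  by rewrite adjointZr// normrZ exprMn real_normK ?num_real// -mulrnAl c2 mul1r.
have mX h := measurable_stopped h (leqnn n).
have lX c' h k := stopped_lin c' h k (leqnn n).
have X0 : {ae P, forall w, stopped n 0 w = 0}.
  by apply: filterS (lX 1 0 0) => w; rewrite scaler0 addr0 mul1r; lra.
have bprod : bounded_rv (fun w => \prod_(k < N) cos (c * stopped n (e k) w) ^+ m).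
  have bexp (f : Omega -> R) i : bounded_rv f -> bounded_rv (fun w => f w ^+ i).
    move=> bf; elim: i => [|i IHi]; first by under eq_fun do rewrite expr0; exact: brv_cst.
    by under eq_fun do rewrite exprS; exact: brvM.
  have hb (r : seq 'I_N) : bounded_rv (fun w => \prod_(k <- r) cos (c * stopped n (e k) w) ^+ m).
    elim: r => [|k r IHr]; first by under eq_fun do rewrite big_nil; exact: brv_cst.
    under eq_fun do rewrite big_cons; apply: brvM => //; apply: bexp; apply: brv_cos.
    exact: measurable_funM.
  exact: hb.
have bprod' : bounded_rv (fun w => \prod_(v <- q) cos (stopped n v w)).
  elim: (q) => [|v r IHr]; first by under eq_fun do rewrite big_nil; exact: brv_cst.
  by under eq_fun do rewrite big_cons; apply: brvM => //; exact: brv_cos.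
have -> : EE P (fun w => \prod_(k < N) cos (c * stopped n (e k) w) ^+ m) =
    savg (fun h => EE P (fun w => 1 * cos (stopped n h w))) q 0.
  rewrite (savg_EE_cos _ _ mX lX (brv_cst _)).
  apply: EE_ae => //; first by apply: brvM; [exact: brv_cst|apply: brvM => //; exact: brv_cos].
  have : {ae P, forall w, forall k : 'I_N, stopped n (c *: e k) w = c * stopped n (e k) w}.
    apply: filter_forall => k; apply: filterS2 X0 (lX c (e k) 0) => w h0.
    by rewrite addr0 h0 addr0.
  apply: filterS2 X0 => w h0 hk; rewrite h0 cos0 !mul1r qcos.
  by apply: eq_bigr => k _; rewrite hk.
pose f h w := \sum_(j < n) \1_(B j) w * vh h j w.
have bf h : bounded_rv (f h).
  apply: (brv_ord_sum (F := fun j w => \1_(B j) w * vh h j w)) => // j jn.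
  by apply: brvM; [exact/brv_indic/mB|exact: brv_vh].
apply: (@le_trans _ _ (savg (fun h => -1 * EE P (f h) + 1) q 0)); last first.
  apply: savg_le => h.
  have -> : EE P (fun w => 1 * cos (stopped n h w)) = EE P (fun w => cos (stopped n h w)).
    by congr (EE P _); apply/funext => w; rewrite mul1r.
  by have := stopped_cos h (leqnn n); rewrite mulN1r addrC.
have [bs es] := brv_savg P q 0 bf.
rewrite savg_affine -es mulN1r addrC lerD2r lerN2.
apply: EE_le => // [|w].
  apply: (brv_ord_sum (F := fun j w => \1_(B j) w * (2 * vv j w))) => // j jn.
  by apply: brvM; [exact/brv_indic/mB|exact/brvZ/brv_vv].
rewrite (savg_sum _ (fun j : 'I_n => \1_(B j) w) (fun (j : 'I_n) h => vh h j w)).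
apply: ler_sum => j _; apply: ler_wpM2l; first by rewrite indicE.
have jn := ltn_ord j; have bF := at_node_bdd gs sTh w jn.
have dj := ltW (dt_gt0 gs jn).
rewrite (eq_savg (g := fun h => dt s j * `|adjoint (at_node j w) h| `^ alpha + 0)); last first.
  by move=> h; rewrite addr0.
rewrite savg_affine addr0 /(vv _) mulrCA ler_wpM2l//.
have := @savg_map R _ _ (adjoint (at_node j w)) (fun g => `|g| `^ alpha) q 0.
move=> -> ; [|by move=> *; exact: adjointDr|by move=> *; exact: adjointNr].
rewrite adjoint0r//.
apply: le_trans (savg_powR_le alpha0 alpha2 _) _.
rewrite big_map qsqr// ler_wpM2l//.
rewrite -[leRHS](@powR_half R alpha _ (hsn_ge0 a (at_node j w))).
have [b0 _] := andP (powR_half_le1 alpha0 alpha2).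
apply: ge0_ler_powR => //; rewrite ?nnegrE ?hsq_ge0 ?sqr_ge0//.
apply: (hsq_le sepG ba te); exact: (at_node_hs gs sTh).
Qed.

Lemma stopped_exp N : 1 - EE P (fun w => \sum_(j < n) \1_(B j) w * (2 * vv j w)) <=
  EE P (fun w => expR (- ((\sum_(k < N) stopped n (e k) w ^+ 2) / 4))).
Proof.
pose S w := \sum_(k < N) stopped n (e k) w ^+ 2.
have S0 w : 0 <= S w by apply: sumr_ge0 => k _; exact: sqr_ge0.
have mS : measurable_fun [set: Omega] S.
  by apply: measurable_sum => k; apply: measurable_funX; exact: measurable_stopped.
have bg : bounded_rv (fun w => expR (- (S w / 4))).
  apply: brv_expRN => [|w]; last by rewrite divr_ge0.
  exact: measurable_funM.
pose f m w := \prod_(k < N) cos ((Num.sqrt m.+1%:R)^-1 * stopped n (e k) w) ^+ m.+1.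
have f1 m w : `|f m w| <= 1.
  apply: (oneB_prod_le _ (c := fun k : 'I_N => _ ^+ _) _).1 => k.
  by rewrite normrX exprn_ile1// cos_max.
have mf m : measurable_fun [set: Omega] (f m).
  apply: measurable_prod => k _; apply: measurable_funX.
  have : bounded_rv (fun w => cos ((Num.sqrt m.+1%:R)^-1 * stopped n (e k) w)).
    by apply: brv_cos; apply: measurable_funM => //; exact: measurable_stopped.
  by case.
have bf m : bounded_rv (f m) by split; [exact: mf|exists 1 => w; exact: f1].
pose h m w := Num.max (f m w) (expR (- (S w / 4))).
have g1 w : expR (- (S w / 4)) <= 1.
  by rewrite -[leRHS]expR0 ler_expR oppr_le0 divr_ge0.
have h1 m w : `|h m w| <= 1.
  have h0 : 0 <= h m w by rewrite le_max expR_ge0 orbT.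
  rewrite ger0_norm// ge_max g1 andbT.
  by have := f1 m w; rewrite ler_norml => /andP[].
have bh m : bounded_rv (h m).
  split; last by exists 1 => w; exact: h1.
  by apply: measurable_maxr; [exact: mf|exact: brv_meas bg].
have hle m : 1 - EE P (fun w => \sum_(j < n) \1_(B j) w * (2 * vv j w)) <= EE P (h m).
  apply: le_trans (stopped_prod N (ltn0Sn m)) _.
  by apply: EE_le => [||w]; [exact: bf|exact: bh|rewrite le_max lexx].
have hcvg w : h m w @[m --> \oo] --> expR (- (S w / 4)).
  apply/cvgrPdist_lt => r r0; exists (Num.truncn (S w)) => // m /= mS'.
  suff -> : h m w = expR (- (S w / 4)) by rewrite subrr normr0.
  apply/max_idPr.
  have Sm : S w <= m.+1%:R.
    by rewrite ltW// (lt_le_trans (truncnS_gt _))// ler_nat ltnS.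
  have m0 : 0 < m.+1%:R :> R by rewrite ltr0n.
  have -> : expR (- (S w / 4)) =
      \prod_(k < N) expR (- (stopped n (e k) w ^+ 2 / 4)).
    by rewrite -expR_sum sumrN -mulr_suml.
  apply: ler_prod => k _; set x := stopped n (e k) w.
  set z := _ * x.
  have z2 : z ^+ 2 = x ^+ 2 / m.+1%:R.
    by rewrite /z exprMn exprVn sqr_sqrtr ?ltW// mulrC.
  have xS : x ^+ 2 <= S w.
    by rewrite /S (bigD1 k)//= lerDl sumr_ge0// => i _; exact: sqr_ge0.
  have z1 : z ^+ 2 <= 1 by rewrite z2 ler_pdivrMr// mul1r (le_trans xS).
  have [c0 c1] := cos_small z1; rewrite exprn_ge0//=.
  have -> : expR (- (x ^+ 2 / 4)) = expR (- (z ^+ 2 / 4)) ^+ m.+1.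
    rewrite -expRM_natl z2; congr expR; field; rewrite gt_eqF//.
  by rewrite ler_pXn2r ?nnegrE// expR_ge0.
have cv := EE_cvg bh bg h1 (aeW P hcvg).
rewrite -(cvg_lim _ cv)//; apply: limr_ge; first by apply/cvg_ex; eexists; exact: cv.
exact: nearW.
Qed.

End stopped.

(** Switching the process off when the accumulated intensity exceeds delta. *)
Lemma step_upper N (delta : R) : 0 < delta ->
  EE P (fun w => 1 - expR (- ((\sum_(k < N) (\sum_(j < n) dI j (e k) w) ^+ 2) / 4))) <=
  2 * delta + EE P \1_[set w | delta < VV w].
Proof.
move=> d0; pose W m w := \sum_(l < m) vv l w.
pose B j := [set w | W j.+1 w <= delta].
have mW m : (m <= n)%N -> measurable_fun [set: Omega] (W m).
  move=> mn; have [] // := brv_ord_sum mn brv_vv.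
have FB j : (j < n)%N -> levy_filtration L (node s j) (B j).
  move=> jn.
  have mWj : sub_meas (levy_gen L (node s j)) (W j.+1).
    apply: measurable_sum => l.
    apply: (sub_meas_node gs sTh (fun F => dt s l * hsn a F `^ alpha)) => //.
    - exact: leq_trans (ltn_ord l) jn.
    - by rewrite -ltnS.
    - exact: ltnW.
  have := @measurable_fun_ler _ (g_sigma_algebraType (levy_gen L (node s j))) R setT (W j.+1) (cst delta).
  move=> /(_ mWj (measurable_cst _) measurableT [set true] I).
  by rewrite setTI.
have mB j (jn : (j < n)%N) : measurable (B j) := levy_filtration_measurable (FB j jn).
have W0 m w : (m <= n)%N -> 0 <= W m w.
  by move=> mn; apply: sumr_ge0 => l _; apply: (vv_ge0 a alpha gs); exact: leq_trans (ltn_ord l) mn.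
have WS m w : W m.+1 w = W m w + vv m w by rewrite /W big_ord_recr.
have Sle m w : (m <= n)%N ->
    \sum_(j < m) \1_(B j) w * vv j w <= W m w /\ \sum_(j < m) \1_(B j) w * vv j w <= delta.
  elim: m => [|m IH] mn; first by rewrite /W !big_ord0 (ltW d0).
  have [h1 h2] := IH (ltnW mn); rewrite !big_ord_recr /= WS indicE.
  have v0 := vv_ge0 a alpha gs Th w mn.
  have [wB|wB] := pselect (B m w); last by rewrite memNset// mul0r addr0; split=> //; lra.
  rewrite mem_set// mul1r; move: wB; rewrite /B /= WS => wB; split; lra.
have mII h : measurable_fun [set: Omega] (fun w => \sum_(j < n) dI j h w).
  by apply: measurable_sum => j; exact: (measurable_dI gs sTh).
have mA : measurable [set w | delta < VV w].
  have := @measurable_fun_ltr _ Omega R setT (cst delta) (W n) (measurable_cst _) (mW n (leqnn n)) measurableT [set true] I.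
  by rewrite setTI.
have bX (X : nat -> Omega -> R) : (forall k, measurable_fun [set: Omega] (X k)) ->
    bounded_rv (fun w => expR (- ((\sum_(k < N) X k w ^+ 2) / 4))).
  move=> mX; apply: brv_expRN => [|w].
    by apply: measurable_funM => //; apply: measurable_sum => k; exact: measurable_funX.
  by rewrite divr_ge0// sumr_ge0// => k _; exact: sqr_ge0.
have b1 := bX _ (fun k => mII (e k)).
have b2 := bX _ (fun k => measurable_stopped FB (e k) (leqnn n)).
have bA := brv_indic (R := R) mA.
have bone := brv_cst (Omega := Omega) (1 : R).
apply: (@le_trans _ _ (EE P (fun w => (1 - expR (- ((\sum_(k < N) stopped B n (e k) w ^+ 2) / 4))) +
    \1_[set w | delta < VV w] w))).
  apply: EE_le => [||w]; [exact: brvB|exact/brvD/bA/brvB|].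
  rewrite indicE; have [dV|Vd] := ltP delta (VV w).
    rewrite mem_set//=.
    have : 0 <= 1 - expR (- ((\sum_(k < N) stopped B n (e k) w ^+ 2) / 4)).
      rewrite subr_ge0 -[leRHS]expR0 ler_expR oppr_le0 divr_ge0// sumr_ge0// => k _; exact: sqr_ge0.
    have := expR_ge0 (- ((\sum_(k < N) (\sum_(j < n) dI j (e k) w) ^+ 2) / 4)).
    by move=> h1 h2; rewrite mulr1n; lra.
  rewrite memNset/=; last by move=> h; move: Vd; rewrite leNgt h.
  have E k : stopped B n (e k) w = \sum_(j < n) dI j (e k) w.
    apply: eq_bigr => j _; rewrite indicE mem_set ?mul1r//= /B /=.
    apply: le_trans Vd; rewrite /VV /W -!(big_mkord predT (fun l => vv l w)).
    rewrite [leRHS](@big_cat_nat _ _ _ j.+1 _ n)//= lerDl big_nat sumr_ge0// => l /andP[_ ln].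
    exact: (vv_ge0 a alpha gs).
  by under eq_bigr do rewrite -E; rewrite addr0.
rewrite EED//; last exact: brvB.
rewrite lerD2r EEB// EE_cst.
have := stopped_exp FB N.
have : EE P (fun w => \sum_(j < n) \1_(B j) w * (2 * vv j w)) <= 2 * delta.
  rewrite -(EE_cst P (2 * delta)); apply: EE_le => [||w]; last 1 first.
  - under eq_bigr do rewrite mulrCA; rewrite -mulr_sumr ler_wpM2l//.
    by have [] := Sle n w (leqnn n).
  - apply: (brv_ord_sum (F := fun j w => \1_(B j) w * (2 * vv j w))) => // j jn.
    by apply: brvM; [exact/brv_indic/mB|exact/brvZ/brv_vv].
  - exact: brv_cst.
lra.
Qed.

End upper_bound.

(** * Lower bound for the integral of a step process *)

Section limits.
Context {R : realType}.

Lemma cvg_sum_seq (I : Type) (r : seq I) (f : I -> nat -> R) (l : I -> R) :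
  (forall i, f i @ \oo --> l i) ->
  \sum_(i <- r) f i N @[N --> \oo] --> \sum_(i <- r) l i.
Proof.
move=> fl; elim: r => [|i r IH].
  by rewrite big_nil; under eq_fun do rewrite big_nil; exact: cvg_cst.
by rewrite big_cons; under eq_fun do rewrite big_cons; exact: cvgD.
Qed.

Lemma cvg_min1 (u : nat -> R) (l : R) : u @ \oo --> l ->
  Num.min (u N) 1 @[N --> \oo] --> Num.min l 1.
Proof.
move=> /cvgrPdist_lt ul; apply/cvgrPdist_lt => r r0.
apply: filterS (ul r r0) => N; apply: le_lt_trans.
rewrite !ler_norml; have [h1|h1] := leP l 1; have [h2|h2] := leP (u N) 1;
  have := ler_norm (l - u N); have := ler_norm (- (l - u N)); rewrite normrN => h3 h4;
  apply/andP; split; lra.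
Qed.

Lemma cvg_powR_below (u : nat -> R) (S b : R) : 0 <= b -> b <= 1 ->
  (forall N, 0 <= u N <= S) -> u @ \oo --> S -> u N `^ b @[N --> \oo] --> S `^ b.
Proof.
move=> b0 b1 uS cu.
have S0 : 0 <= S by have /andP[h] := uS 0%N; exact: le_trans.
have up N : u N `^ b <= S `^ b.
  by have /andP[h1 h2] := uS N; apply: ge0_ler_powR; rewrite ?nnegrE.
have [SE|SN] := eqVneq S 0.
  have -> : (fun N => u N `^ b) = (fun=> S `^ b).
    apply/funext => N; congr (_ `^ _); have := uS N; rewrite SE -eq_le => /eqP <- //.
  exact: cvg_cst.
have Sp : 0 < S by rewrite lt_def SN.
apply: (@squeeze_cvgr _ _ _ _ (fun N => S `^ b * (u N / S)) (fun=> S `^ b)).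
- apply: nearW => N; rewrite up andbT; have /andP[h1 h2] := uS N.
  have [->|uN] := eqVneq (u N) 0; first by rewrite mul0r mulr0 powR_ge0.
  have -> : u N `^ b = S `^ b * (u N / S) `^ b.
    by rewrite -powRM ?divr_ge0//; congr (_ `^ _); field.
  rewrite ler_wpM2l ?powR_ge0// ger1_powR// ler_pdivrMr// mul1r h2 andbT.
  by rewrite divr_gt0// lt_def uN.
- rewrite -[X in _ --> X]mulr1; apply: cvgMr; rewrite -(divff SN).
  exact: cvgMl.
- exact: cvg_cst.
Qed.

End limits.

Section lower_bound.
Context {d} {Omega : measurableType d} {R : realType} (P : probability Omega R).
Context {G H : hilbertType R} (sepG : separable G).
Context (a : set G) (ba : orthonormal_basis a) (e : nat -> H) (te : total_seq e).
Context (alpha : R).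
Hypotheses (alpha0 : 0 < alpha) (alpha2 : alpha < 2).
Context (L : R -> G -> {RV P >-> R}).
Hypothesis levyL : cylindrical_levy_process L.
Hypothesis stableL : canonical_stable alpha L.
Context (T : R) (s : seq R) (gs : grid T s).
Context (Th : Omega -> R -> G -> H).
Hypothesis sTh : step_on L T (hs_op a) s Th.

Let n := size s.
Local Notation dI := (dI L s Th).
Local Notation vh := (vh alpha s Th).
Local Notation vv := (vv a alpha s Th).
Local Notation vN := (vN e alpha s Th).
Local Notation at_node := (at_node s Th).
Local Notation VV := (VV a alpha s Th).

Section truncated.
Variable N : nat.

Definition dI2 j w := \sum_(k < N) dI j (e k) w ^+ 2.

Definition qq j w := Num.min (dI2 j w) 1.

Lemma dI2_ge0 j w : 0 <= dI2 j w.
Proof. by apply: sumr_ge0 => k _; exact: sqr_ge0. Qed.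

Lemma qq_ge0 j w : 0 <= qq j w.
Proof. by rewrite le_min dI2_ge0 ler01. Qed.

Lemma qq_le1 j w : qq j w <= 1.
Proof. by rewrite ge_min lexx orbT. Qed.

Lemma dI2_sub_meas j : (j < n)%N -> sub_meas (levy_gen L (node s j.+1)) (dI2 j).
Proof.
by move=> jn; apply: measurable_sum => k; apply: measurable_funX; exact: (dI_sub_meas gs sTh _ jn).
Qed.

Lemma qq_sub_meas j : (j < n)%N -> sub_meas (levy_gen L (node s j.+1)) (qq j).
Proof. by move=> jn; apply: measurable_minr => //; exact: dI2_sub_meas. Qed.

Lemma measurable_dI2 j : (j < n)%N -> measurable_fun [set: Omega] (dI2 j).
Proof. by move=> /dI2_sub_meas; apply: sub_meas_measurable; exact: levy_gen_measurable. Qed.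

Lemma brv_qq j : (j < n)%N -> bounded_rv (qq j).
Proof. by move=> jn; apply: brv_min1; [exact: measurable_dI2|exact: dI2_ge0]. Qed.

Lemma brv_vN j : (j < n)%N -> bounded_rv (vN N j).
Proof. by move=> jn; exact: (brv_node gs sTh (fun F => dt s j * hsq e F N `^ (alpha / 2))). Qed.

Lemma brv_minvN j : (j < n)%N -> bounded_rv (fun w => Num.min (vN N j w) 1).
Proof.
by move=> jn; exact: (brv_node gs sTh (fun F => Num.min (dt s j * hsq e F N `^ (alpha / 2)) 1)).
Qed.

(** Conditionally on the past, an increment is at least as large as its
    intensity: average 1 - cos over the signs in a vector of the basis. *)
Lemma increment_lower j C : (j < n)%N -> levy_filtration L (node s j) C ->
  EE P (fun w => \1_C w * Num.min (vN N j w) 1) / 12 <= EE P (fun w => \1_C w * qq j w).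
Proof.
move=> jn FC; have mC := levy_filtration_measurable FC.
have bC := brv_indic (R := R) mC; have bone := brv_cst (Omega := Omega) (1 : R).
have mX h := measurable_dI gs sTh h jn.
have lX c h k := dI_lin sepG levyL gs sTh c h k jn.
pose q := mkseq e N.
have b0 := brv_cos (mX 0); have bqj := brv_qq jn.
have bprod : bounded_rv (fun w => \prod_(v <- q) cos (dI j v w)).
  elim: (q) => [|v r IHr]; first by under eq_fun do rewrite big_nil; exact: brv_cst.
  by under eq_fun do rewrite big_cons; apply: brvM => //; exact: brv_cos.
have bexp h : bounded_rv (fun w => expR (- vh h j w)).
  exact: (brv_node gs sTh (fun F => expR (- (dt s j * `|adjoint F h| `^ alpha))) jn).
have bCexp h := brvM bC (brvB bone (bexp h)).
pose A := savg (fun h => EE P (fun w => \1_C w * cos (dI j h w))) q 0.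
have A1 : EE P \1_C - A <= 2 * EE P (fun w => \1_C w * qq j w).
  rewrite /A (savg_EE_cos _ _ mX lX bC) -EEB//; last by apply: brvM => //; exact: brvM.
  rewrite -EEZ; last exact: brvM.
  rewrite (@EE_ae _ _ _ P _ (fun w => \1_C w * (1 - \prod_(v <- q) cos (dI j v w)))).
  - apply: EE_le => [||w]; [exact/brvM/brvB|exact/brvZ/brvM|].
    rewrite mulrCA; apply: ler_wpM2l; first by rewrite indicE.
    have [h1 h2] := oneB_prod_le q (c := fun v => cos (dI j v w)) (fun v => cos_max _).
    have h3 : \sum_(v <- q) (1 - cos (dI j v w)) <= dI2 j w / 2.
      rewrite big_map /dI2 -(big_mkord predT (fun k => dI j (e k) w ^+ 2)) /index_iota subn0.
      rewrite mulr_suml; apply: ler_sum => k _; exact: oneB_cos_le.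
    rewrite /qq; have := dI2_ge0 j w; have [_|_] := leP (dI2 j w) 1; first lra.
    by move: h1; rewrite ler_norml => /andP[h4 _]; lra.
  - by apply: brvB => //; do !apply: brvM => //.
  - exact/brvM/brvB.
  - apply: filterS (dI0 sepG levyL gs sTh jn) => w ->; rewrite cos0; ring.
have AE : EE P \1_C - A = savg (fun h => EE P (fun w => \1_C w * (1 - expR (- vh h j w)))) q 0.
  rewrite /A -mulN1r addrC -savg_affine; apply: eq_savg => h.
  have [-> _] := dI_cond levyL stableL gs sTh h jn FC.
  rewrite mulN1r addrC -EEB//; last exact: brvM.
  by congr (EE P _); apply/funext => w; ring.
have [_ es] := brv_savg P q 0 bCexp.
have bs := (brv_savg P q 0 bCexp).1.
have : EE P (fun w => \1_C w * Num.min (vN N j w) 1) / 6 <= EE P \1_C - A.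
  rewrite AE -es mulrC -EEZ; last by apply: brvM => //; exact: brv_minvN.
  apply: EE_le => // [|w]; first by apply/brvZ/brvM => //; exact: brv_minvN.
  have bF := at_node_bdd gs sTh w jn.
  rewrite (eq_savg (g := fun h => \1_C w * (1 - expR (- vh h j w)) + 0)); last first.
    by move=> h; rewrite addr0.
  rewrite savg_affine addr0 mulrCA; apply: ler_wpM2l; first by rewrite indicE.
  have := @savg_map R _ _ (adjoint (at_node j w)) (fun g => 1 - expR (- (dt s j * `|g| `^ alpha))) q 0.
  move=> -> ; [|by move=> *; exact: adjointDr|by move=> *; exact: adjointNr].
  rewrite adjoint0r// mulrC.
  apply: le_trans (savg_oneB_expR_ge alpha0 alpha2 _ (ltW (dt_gt0 gs jn))).
  by rewrite !big_map /vN /hsq -(big_mkord predT (fun k => `|adjoint (at_node j w) (e k)| ^+ 2)) /index_iota subn0.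
lra.
Qed.

Lemma min1_sum (I : Type) (r : seq I) (f : I -> R) : (forall i, 0 <= f i) ->
  Num.min (\sum_(i <- r) f i) 1 <= \sum_(i <- r) Num.min (f i) 1.
Proof.
move=> f0; elim: r => [|i r IH]; first by rewrite !big_nil ge_min lexx.
rewrite !big_cons; apply: le_trans (lerD (lexx _) IH).
have S0 : 0 <= \sum_(j <- r) f j by apply: sumr_ge0.
have := f0 i; set x := f i; set y := \sum_(_ <- _) _ in S0 *.
move=> x0; have [h1|h1] := leP (x + y) 1; have [h2|h2] := leP x 1;
  have [h3|h3] := leP y 1; lra.
Qed.

(** Lenglart's inequality: the sum of the conditional expectations of the q_j is
    controlled by their sum. *)
Lemma lenglart :
  EE P (fun w => Num.min (\sum_(j < n) vN N j w) 1) <=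
  25 * EE P (fun w => Num.min (\sum_(j < n) dI2 j w) 1).
Proof.
pose Q m w := \sum_(l < m) qq l w.
pose B j := [set w | Q j w <= 1].
have FB j : (j < n)%N -> levy_filtration L (node s j) (B j).
  move=> jn.
  have mQj : sub_meas (levy_gen L (node s j)) (Q j).
    apply: measurable_sum => l; have ln := ltn_trans (ltn_ord l) jn.
    apply: sub_meas_mono (qq_sub_meas ln); apply: (node_le gs) => //; exact: ltnW.
  have := @measurable_fun_ler _ (g_sigma_algebraType (levy_gen L (node s j))) R setT (Q j) (cst 1).
  move=> /(_ mQj (measurable_cst _) measurableT [set true] I).
  by rewrite setTI.
have mB j (jn : (j < n)%N) : measurable (B j) := levy_filtration_measurable (FB j jn).
have bB j (jn : (j < n)%N) : bounded_rv (\1_(B j) : Omega -> R) := brv_indic (mB j jn).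
have Q0 m w : 0 <= Q m w by apply: sumr_ge0 => l _; exact: qq_ge0.
have mQ : measurable_fun [set: Omega] (Q n).
  by have [] := brv_ord_sum (F := qq) (leqnn n) brv_qq.
have QS m w : Q m.+1 w = Q m w + qq m w by rewrite /Q big_ord_recr.
have bQ : bounded_rv (fun w => Num.min (Q n w) 1) by exact: brv_min1.
have bD : bounded_rv (fun w => Num.min (\sum_(j < n) dI2 j w) 1).
  apply: brv_min1 => [|w]; last by apply: sumr_ge0 => j _; exact: dI2_ge0.
  by apply: measurable_sum => j; exact: measurable_dI2.
have bvn : bounded_rv (fun w => Num.min (\sum_(j < n) vN N j w) 1).
  apply: brv_min1 => [|w]; last by apply: sumr_ge0 => j _; exact: (vN_ge0 e alpha gs).
  by have [] := brv_ord_sum (F := vN N) (leqnn n) brv_vN.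
have bBq := fun j jn => brvM (bB j jn) (brv_qq jn).
have bBv := fun j jn => brvM (bB j jn) (brv_minvN jn).
have bsq := brv_ord_sum (F := fun j w => \1_(B j) w * qq j w) (leqnn n) bBq.
have bsv := brv_ord_sum (F := fun j w => \1_(B j) w * Num.min (vN N j w) 1) (leqnn n) bBv.
have hQD : EE P (fun w => Num.min (Q n w) 1) <= EE P (fun w => Num.min (\sum_(j < n) dI2 j w) 1).
  apply: EE_le => // w; rewrite le_min !ge_min lexx orbT andbT.
  by apply/orP; left; apply: ler_sum => j _; rewrite ge_min lexx.
have h1 : EE P (fun w => \sum_(j < n) \1_(B j) w * qq j w) <=
    2 * EE P (fun w => Num.min (Q n w) 1).
  rewrite -EEZ//; apply: EE_le => [//||w]; first exact: brvZ.
  have : forall m, (m <= n)%N -> \sum_(j < m) \1_(B j) w * qq j w <= Q m w /\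
      \sum_(j < m) \1_(B j) w * qq j w <= 2.
    elim=> [|m IH] mn; first by rewrite /Q !big_ord0.
    have [h1 h2] := IH (ltnW mn); rewrite !big_ord_recr /= QS indicE.
    have q0 := qq_ge0 m w; have q1 := qq_le1 m w.
    have [wB|wB] := pselect (B m w); last by rewrite memNset// mul0r addr0; split=> //; lra.
    rewrite mem_set// mul1r; move: wB; rewrite /B /= => wB; split; lra.
  move=> /(_ n (leqnn n))[h1 h2]; have := Q0 n w.
  have [_|_] := leP (Q n w) 1; lra.
have h2 : EE P (fun w => \sum_(j < n) \1_(B j) w * Num.min (vN N j w) 1) <=
    12 * EE P (fun w => \sum_(j < n) \1_(B j) w * qq j w).
  rewrite (EE_sum _ _ (F := fun (j : 'I_n) w => \1_(B j) w * qq j w)) => [|j]; last exact: bBq.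
  rewrite (EE_sum _ _ (F := fun (j : 'I_n) w => \1_(B j) w * Num.min (vN N j w) 1)) => [|j]; last exact: bBv.
  rewrite mulr_sumr; apply: ler_sum => j _.
  have := increment_lower (ltn_ord j) (FB j (ltn_ord j)); lra.
have h3 : EE P (fun w => Num.min (\sum_(j < n) vN N j w) 1) <=
    EE P (fun w => Num.min (Q n w) 1) + EE P (fun w => \sum_(j < n) \1_(B j) w * Num.min (vN N j w) 1).
  rewrite -EED//; apply: EE_le => [//||w]; first exact: brvD.
  have S0 : 0 <= \sum_(j < n) \1_(B j) w * Num.min (vN N j w) 1.
    apply: sumr_ge0 => j _; rewrite mulr_ge0 ?indicE// le_min ler01 andbT.
    exact: (vN_ge0 e alpha gs).
  have [Q1|Q1] := leP (Q n w) 1; last first.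
    apply: le_trans (_ : 1 <= _); first by rewrite ge_min lexx orbT.
    lra.
  have E : \sum_(j < n) \1_(B j) w * Num.min (vN N j w) 1 = \sum_(j < n) Num.min (vN N j w) 1.
    apply: eq_bigr => j _; rewrite indicE mem_set ?mul1r//= /B /=.
    apply: le_trans Q1; rewrite /Q -!(big_mkord predT (fun l => qq l w)).
    have jn := ltnW (ltn_ord j).
    rewrite [leRHS](@big_cat_nat _ _ _ j _ n)//= lerDl sumr_ge0// => l _.
    exact: qq_ge0.
  rewrite E; apply: le_trans (lerD (Q0 n w) (lexx _)); rewrite add0r.
  by apply: min1_sum => j; exact: (vN_ge0 e alpha gs).
have : 0 <= EE P (fun w => Num.min (Q n w) 1).
  by apply: EE_ge0 => w; rewrite le_min Q0 ler01.
lra.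
Qed.

(** Averaging over the signs of the increments decouples their sum. *)
Lemma sign_lower (eta : R) :
  (forall b : nat -> R, (forall j, b j = 1 \/ b j = -1) ->
    EE P (fun w => Num.min (\sum_(k < N) (\sum_(j < n) b j * dI j (e k) w) ^+ 2) 1) <= eta) ->
  EE P (fun w => Num.min (\sum_(j < n) dI2 j w) 1) <= 3 * eta.
Proof.
move=> heta; have mX k j (jn : (j < n)%N) := measurable_dI gs sTh (e k) jn.
pose y j w := \sum_(k < N) dI j (e k) w *: e k.
pose f (h : H) := Num.min (`|h| ^+ 2) 1.
have normE (c : nat -> R) : `|\sum_(k < N) c k *: e k| ^+ 2 =
    \sum_(k < N) c k ^+ 2 * inner (e k) (e k).
  rewrite -(big_mkord predT (fun k => c k *: e k)).
  rewrite -(big_mkord predT (fun k => c k ^+ 2 * inner (e k) (e k))).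
  by apply: (sqr_norm_orth_sum te.1); rewrite ?iota_uniq.
have ysum (b : nat -> R) w : \sum_(j < n) b j *: y j w =
    \sum_(k < N) (\sum_(j < n) b j * dI j (e k) w) *: e k.
  under eq_bigr do rewrite scaler_sumr.
  rewrite exchange_big /=; apply: eq_bigr => k _; rewrite scaler_suml.
  by apply: eq_bigr => j _; rewrite scalerA.
have m_sum (b : nat -> R) k : measurable_fun [set: Omega] (fun w => \sum_(j < n) b j * dI j (e k) w).
  by apply: measurable_sum => j; apply: measurable_funM => //; exact: mX.
have bf (b : nat -> R) : bounded_rv (fun w => f (\sum_(j < n) b j *: y j w)).
  have -> : (fun w => f (\sum_(j < n) b j *: y j w)) = (fun w => Num.min
      (\sum_(k < N) (\sum_(j < n) b j * dI j (e k) w) ^+ 2 * inner (e k) (e k)) 1).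
    by apply/funext => w; rewrite /f ysum (normE (fun k => \sum_(j < n) b j * dI j (e k) w)).
  apply: brv_min1 => [|w]; last first.
    by apply: sumr_ge0 => k _; rewrite mulr_ge0 ?sqr_ge0// inner_normE sqr_ge0.
  apply: measurable_sum => k; apply: measurable_funM => //; exact: measurable_funX.
have inner01 k : 0 <= inner (e k) (e k) <= 1.
  by case: (te.1.2 k I) => ->; rewrite ?lexx ?ler01.
have [bs es] : bounded_rv (fun w => savg f (mkseq (y^~ w) n) 0) /\
    EE P (fun w => savg f (mkseq (y^~ w) n) 0) <= eta.
  apply: (savg_EE_le (x := fun=> 0)) => b hb.
  have -> : (fun w => f (0 + \sum_(j < n) b j *: y j w)) = (fun w => f (\sum_(j < n) b j *: y j w)).
    by apply/funext => w; rewrite add0r.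
  split=> //; apply: le_trans (heta b hb); apply: EE_le => [//||w].
    apply: brv_min1 => [|w]; last by apply: sumr_ge0 => k _; exact: sqr_ge0.
    by apply: measurable_sum => k; apply: measurable_funX.
  rewrite /f ysum (normE (fun k => \sum_(j < n) b j * dI j (e k) w)).
  rewrite le_min !ge_min lexx orbT andbT; apply/orP; left; apply: ler_sum => k _.
  by have /andP[_ h] := inner01 k; rewrite -[leRHS]mulr1 ler_wpM2l ?sqr_ge0.
have bD : bounded_rv (fun w => Num.min (\sum_(j < n) dI2 j w) 1).
  apply: brv_min1 => [|w]; last by apply: sumr_ge0 => j _; exact: dI2_ge0.
  by apply: measurable_sum => j; exact: measurable_dI2.
have bD' : bounded_rv (fun w => Num.min (\sum_(j < n) `|y j w| ^+ 2) 1).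
  apply: brv_min1 => [|w]; last by apply: sumr_ge0 => j _; exact: sqr_ge0.
  apply: measurable_sum => j; rewrite /y.
  under eq_fun do rewrite (normE (fun k => dI j (e k) _)).
  apply: measurable_sum => k; apply: measurable_funM => //; apply: measurable_funX; exact: mX.
have -> : EE P (fun w => Num.min (\sum_(j < n) dI2 j w) 1) =
    EE P (fun w => Num.min (\sum_(j < n) `|y j w| ^+ 2) 1).
  apply: EE_ae => //.
  have h0 : {ae P, forall w, forall (j : 'I_n) (k : 'I_N), e k = 0 -> dI j (e k) w = 0}.
    apply: filter_forall => j; apply: filter_forall => k.
    apply: filterS (dI0 sepG levyL gs sTh (ltn_ord j)) => w h -> //.
  apply: filterS h0 => w h0; congr (Num.min _ _); apply: eq_bigr => j _.
  rewrite (normE (fun k => dI j (e k) w)); apply: eq_bigr => k _.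
  case: (te.1.2 k I) => E; last by rewrite E mulr1.
  have ek : e k = 0 by apply/eqP; rewrite -normr_eq0 -sqrf_eq0 -inner_normE E.
  by rewrite h0// ek inner0l mulr0 expr0n.
have : EE P (fun w => Num.min (\sum_(j < n) `|y j w| ^+ 2) 1) / 3 <=
    EE P (fun w => savg f (mkseq (y^~ w) n) 0).
  rewrite mulrC -EEZ//; apply: EE_le => [||w]; [exact: brvZ|by []|].
  rewrite mulrC; apply: le_trans (savg_min1 _).
  rewrite big_map -(big_mkord predT (fun j => `|y j w| ^+ 2)) /index_iota subn0.
  exact: lexx.
lra.
Qed.

End truncated.

Lemma step_lower (eta : R) :
  (forall N (b : nat -> R), (forall j, b j = 1 \/ b j = -1) ->
    EE P (fun w => Num.min (\sum_(k < N) (\sum_(j < n) b j * dI j (e k) w) ^+ 2) 1) <= eta) ->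
  EE P (fun w => Num.min (VV w) 1) <= 75 * eta.
Proof.
move=> heta.
have hN N : EE P (fun w => Num.min (\sum_(j < n) vN N j w) 1) <= 75 * eta.
  apply: le_trans (lenglart N) _.
  by have := sign_lower (heta N); lra.
have v0 j w (jn : (j < n)%N) := vv_ge0 a alpha gs Th w jn.
have bV : bounded_rv (fun w => Num.min (VV w) 1).
  apply: brv_min1 => [|w]; last by apply: sumr_ge0 => j _; exact: v0.
  by have [] := brv_ord_sum (F := vv) (leqnn n) (brv_vv alpha gs sTh).
have bVN N : bounded_rv (fun w => Num.min (\sum_(j < n) vN N j w) 1).
  apply: brv_min1 => [|w]; last by apply: sumr_ge0 => j _; exact: (vN_ge0 e alpha gs).
  by have [] := brv_ord_sum (F := vN N) (leqnn n) (brv_vN N).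
have cv : EE P (fun w => Num.min (\sum_(j < n) vN N j w) 1) @[N --> \oo] -->
    EE P (fun w => Num.min (VV w) 1).
  apply: (EE_cvg (M := 1)) => // [N w|].
    rewrite ger0_norm ?ge_min ?lexx ?orbT// le_min ler01 andbT.
    by apply: sumr_ge0 => j _; exact: (vN_ge0 e alpha gs).
  apply: aeW => w; apply: cvg_min1.
  apply: (cvg_sum_seq (f := fun (j : 'I_n) N => vN N j w)) => j.
  apply: cvgMr; rewrite -(@powR_half R alpha _ (hsn_ge0 a (at_node j w))).
  have [b0 b1] := andP (powR_half_le1 alpha0 alpha2).
  have hF := at_node_hs gs sTh w (ltn_ord j).
  apply: cvg_powR_below => // [N|]; last exact: (hsq_cvgR sepG ba te).
  by rewrite hsq_ge0 (hsq_le sepG ba te).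
rewrite -(cvg_lim _ cv)//; apply: limr_le; first by apply/cvg_ex; eexists; exact: cv.
exact: nearW.
Qed.

End lower_bound.

(** * Random vectors *)

Section dense_sequence.
Context {R : realType} {H : hilbertType R}.

Lemma separable_seq : separable H -> exists d : nat -> H,
  forall O : set H, O !=set0 -> open O -> exists n, O (d n).
Proof.
case=> D cD dD; have [f fi] := countable_injP _ cD.
exists (fun n => xget 0 [set x | D x /\ f x = n]) => O O0 oO.
have [x [Ox Dx]] := dD O O0 oO; exists (f x).
have [Dy fy] := xgetPex 0 (ex_intro _ x (conj Dx erefl) : exists y, D y /\ f y = f x).
by rewrite (_ : xget _ _ = x)//; apply: fi => //; rewrite inE.
Qed.

End dense_sequence.

Section weak_measurability.
Context {d} {Omega : measurableType d} {R : realType}.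
Context {H : hilbertType R} (sepH : separable H).
Implicit Types X Y : Omega -> H.

Definition wm X := forall h, measurable_fun [set: Omega] (fun w => inner (X w) h).

Lemma wm_cst (x : H) : wm (fun=> x).
Proof. by move=> h; exact: measurable_cst. Qed.

Lemma wmD X Y : wm X -> wm Y -> wm (fun w => X w + Y w).
Proof.
by move=> mX mY h; under eq_fun do rewrite innerDl; exact: measurable_funD.
Qed.

Lemma wmB X Y : wm X -> wm Y -> wm (fun w => X w - Y w).
Proof.
by move=> mX mY h; under eq_fun do rewrite innerBl; exact: measurable_funB.
Qed.

Lemma wmZ (c : Omega -> R) X : measurable_fun [set: Omega] c -> wm X ->
  wm (fun w => c w *: X w).
Proof.
by move=> mc mX h; under eq_fun do rewrite innerZl; exact: measurable_funM.
Qed.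

Lemma wm_sum (I : Type) (r : seq I) (X : I -> Omega -> H) :
  (forall i, wm (X i)) -> wm (fun w => \sum_(i <- r) X i w).
Proof.
move=> mX h; under eq_fun do rewrite inner_suml.
by apply: measurable_sum => i; exact: mX.
Qed.

Lemma wm_norm X : wm X -> measurable_fun [set: Omega] (fun w => `|X w|).
Proof.
move=> mX; have [e te] := separable_total_seq sepH.
have m2 : measurable_fun [set: Omega] (fun w => `|X w| ^+ 2).
  apply: (@measurable_fun_cvg _ _ _ setT (fun N w => \sum_(k < N) inner (X w) (e k) ^+ 2)).
    by move=> N; apply: measurable_sum => k; exact: measurable_funX.
  by move=> w _; exact: (sum_sqr_cvg te).
have -> : (fun w => `|X w|) = (fun w => (`|X w| ^+ 2) `^ (2^-1)).
  by apply/funext => w; rewrite powR12_sqrt ?sqr_ge0// sqrtr_sqr normr_id.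
apply: (@measurableT_comp _ _ _ _ _ _ (fun x : R => x `^ 2^-1)) m2.
exact: measurable_powR.
Qed.

Lemma wm_borel X : wm X -> borel_measurable X.
Proof.
move=> mX; have [f fd] := separable_seq sepH.
have mball c (r : R) : measurable [set w | `|X w - c| < r].
  have mn : measurable_fun [set: Omega] (fun w => `|X w - c|).
    by apply: wm_norm; exact: wmB mX (wm_cst c).
  have := @measurable_fun_ltr _ Omega R setT _ (cst r) mn (measurable_cst _) measurableT [set true] I.
  by rewrite setTI.
move=> B; move: B; apply: (@smallest_sub _ _ _ [set B | measurable (X @^-1` B)]).
  have := @sigma_algebra_image _ _ setT X measurable (sigma_algebra_measurable Omega).
  by rewrite /image_set_system; under eq_fun do rewrite setTI.
move=> O oO; rewrite /=.
pose Q n m := forall y, `|y - f n| < m.+1%:R^-1 -> O y.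
have -> : X @^-1` O = \bigcup_n \bigcup_m
    (if pselect (Q n m) then [set w | `|X w - f n| < m.+1%:R^-1] else set0).
  apply/seteqP; split=> [w Ow|w [n _ [m _]]]; last by case: pselect => // h /= /h.
  have /nbhs_ballP[r /= r0 hr] := (open_nbhs_nbhs (conj oO Ow) : nbhs (X w) O).
  pose m := Num.truncn (2 / r).
  have m0 : 0 < m.+1%:R :> R by rewrite ltr0n.
  have mr : m.+1%:R^-1 < r / 2.
    by rewrite -[ltRHS]invrK invf_div ltf_pV2 ?posrE ?divr_gt0// truncnS_gt.
  have [||n hn] := fd (ball (X w) m.+1%:R^-1).
  - by exists (X w); apply: ballxx; rewrite invr_gt0.
  - exact: ball_open.
  have hn' : `|X w - f n| < m.+1%:R^-1 by move: hn; rewrite -ball_normE.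
  exists n => //; exists m => //; case: pselect => // h; exfalso; apply: h => y hy.
  apply: hr; rewrite -ball_normE /=.
  have -> : X w - y = (X w - f n) - (y - f n) by rewrite opprB addrA subrK.
  by rewrite (splitr r) (le_lt_trans (ler_normB _ _))// ltrD//; [exact: lt_trans hn' mr|exact: lt_trans hy mr].
apply: bigcup_measurable => n _; apply: bigcup_measurable => m _.
by case: pselect => h /=; [exact: mball|exact: measurable0].
Qed.

Lemma borel_wm X : borel_measurable X -> wm X.
Proof.
move=> bX h _ B mB; rewrite setTI.
have -> : (fun w => inner (X w) h) @^-1` B = X @^-1` ((fun x => inner x h) @^-1` B) by [].
apply: bX; apply: borel_preimage; last exact/measurable_borelE.
by move=> x; apply: cvg_inner; exact: cvg_id.
Qed.

Lemma wm_lim (X : nat -> Omega -> H) Y : (forall n, wm (X n)) ->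
  (forall w, X n w @[n --> \oo] --> Y w) -> wm Y.
Proof.
move=> mX XY h; apply: (@measurable_fun_cvg _ _ _ setT (fun n w => inner (X n w) h)).
  by move=> n; exact: mX.
by move=> w _; apply: cvg_inner; exact: XY.
Qed.

End weak_measurability.

Section in_probability.
Context {d} {Omega : measurableType d} {R : realType} (P : probability Omega R).

Lemma EE_min1_cvg0 (X : nat -> Omega -> R) :
  (forall n, measurable_fun [set: Omega] (X n)) -> (forall n w, 0 <= X n w) ->
  (forall r : R, 0 < r -> P [set w | r < X n w] @[n --> \oo] --> 0%E) ->
  EE P (fun w => Num.min (X n w) 1) @[n --> \oo] --> 0.
Proof.
move=> mX X0 hX; apply/cvgrPdist_lt => r r0.
have r2 : 0 < r / 2 by rewrite divr_gt0.
have := hX _ r2 => /fine_cvgP[_ /cvgrPdist_lt/(_ _ r2)].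
apply: filterS => n; rewrite sub0r normrN /= => hn.
rewrite sub0r normrN ger0_norm; last by apply: EE_ge0 => w; rewrite le_min X0 ler01.
have mA : measurable [set w | r / 2 < X n w].
  have := @measurable_fun_ltr _ Omega R setT (cst (r / 2)) _ (measurable_cst _) (mX n) measurableT [set true] I.
  by rewrite setTI.
have bA := brv_indic (R := R) mA; have bc := brv_cst (Omega := Omega) (r / 2).
apply: (@le_lt_trans _ _ (EE P (fun w => r / 2 + \1_[set w | r / 2 < X n w] w))).
  apply: EE_le => [||w]; [exact: brv_min1|exact: brvD|].
  rewrite indicE; have [h|h] := ltP (r / 2) (X n w).
    by rewrite mem_set// ge_min; apply/orP; right; rewrite lerDr ltW.
  by rewrite memNset/= ?addr0 ?ge_min ?h// => h'; move: h; rewrite leNgt h'.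
rewrite EED// EE_cst EE_indic//.
rewrite ger0_norm in hn; last by rewrite fine_ge0.
lra.
Qed.

Lemma EE_min1_eq0 (X : Omega -> R) : measurable_fun [set: Omega] X ->
  (forall w, 0 <= X w) -> EE P (fun w => Num.min (X w) 1) = 0 -> {ae P, forall w, X w = 0}.
Proof.
move=> mX X0 E0; have bX := brv_min1 mX X0.
have := ae_eq_integral_abs P measurableT (f := fun w => (Num.min (X w) 1)%:E).
move=> /(_ ((measurable_EFinP _ _).2 (brv_meas bX))) [h _].
have h' : (\int[P]_(x in [set: Omega]) `|(Num.min (X x) 1)%:E| = 0)%E.
  have := EE_fin P bX; rewrite E0 => /esym h0; rewrite -[RHS]h0.
  apply: eq_integral => w _ /=; congr EFin; rewrite ger0_norm// le_min X0 ler01//.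
apply: filterS (h h') => w /(_ I) [].
by rewrite /=; have := X0 w; have [_ //|_] := leP (X w) 1; lra.
Qed.

Lemma EE_min1_cvg0_inv (X : nat -> Omega -> R) (r : R) :
  (forall n, measurable_fun [set: Omega] (X n)) -> (forall n w, 0 <= X n w) ->
  EE P (fun w => Num.min (X n w) 1) @[n --> \oo] --> 0 -> 0 < r ->
  P [set w | r < X n w] @[n --> \oo] --> 0%E.
Proof.
move=> mX X0 hX r0.
pose c := Num.min r 1; have c0 : 0 < c by rewrite lt_min r0 ltr01.
have c1 : c <= 1 by rewrite ge_min lexx orbT.
have mA (q : R) n : measurable [set w | q < X n w].
  have := @measurable_fun_ltr _ Omega R setT (cst q) _ (measurable_cst _) (mX n) measurableT [set true] I.
  by rewrite setTI.
have h n : fine (P [set w | r < X n w]) <= EE P (fun w => Num.min (X n w) 1) / c.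
  apply: le_trans (EE_min1_markov P (mX n) (X0 n) c0 c1).
  rewrite -(EE_indic P (mA r n)); apply: EE_le => [||w]; [exact: brv_indic|exact: brv_indic|].
  rewrite !indicE; case: (boolP (w \in [set w | r < X n w])) => // h.
  rewrite mem_set//; move: h; rewrite inE /=; apply: le_lt_trans.
  by rewrite ge_min lexx.
have E n : P [set w | r < X n w] = (fine (P [set w | r < X n w]))%:E.
  by rewrite fineK// fin_num_measure.
under eq_fun do rewrite E; apply: cvg_EFin; first exact: nearW.
apply: (@squeeze_cvgr _ _ _ _ (fun=> 0) (fun n => EE P (fun w => Num.min (X n w) 1) / c)).
- by apply: nearW => n; apply/andP; split; [exact: (fine_ge0 (measure_ge0 P _))|exact: h].
- exact: cvg_cst.
- by rewrite -(mul0r c^-1); apply: cvgMl.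
Qed.

End in_probability.

(** * Radonified increments *)

Section radonification.
Context {d} {Omega : measurableType d} {R : realType} (P : probability Omega R).
Context {G H : hilbertType R} (sepG : separable G) (sepH : separable H).
Context (a : set G) (ba : orthonormal_basis a).
Context (alpha : R).
Hypotheses (alpha0 : 0 < alpha) (alpha2 : alpha < 2).
Context (L : R -> G -> {RV P >-> R}).
Hypothesis levyL : cylindrical_levy_process L.
Hypothesis stableL : canonical_stable alpha L.

Lemma adjoint_bounded (F : G -> H) : bounded_op F ->
  exists2 C : R, 0 < C & forall h, `|adjoint F h| <= C * `|h|.
Proof.
move=> bF; have [lF [C C0 hC]] := (bounded_opP F).1 bF; exists C => // h.
have [->|n0] := eqVneq (adjoint F h) 0; first by rewrite normr0 mulr_ge0// ltW.
have np : 0 < `|adjoint F h| by rewrite normr_gt0.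
rewrite -(ler_pM2r np) -expr2 -inner_normE -adjointP//.
apply: le_trans (ler_norm _) _; apply: le_trans (cauchy_schwarz _ _) _.
by rewrite mulrAC ler_wpM2r.
Qed.

Lemma cvg_adjoint (F : G -> H) (u : nat -> H) h : bounded_op F ->
  u @ \oo --> h -> adjoint F (u n) @[n --> \oo] --> adjoint F h.
Proof.
move=> bF uh; have [C C0 hC] := adjoint_bounded bF.
apply/cvgrPdist_lt => r r0; move/cvgrPdist_lt : uh => /(_ _ (divr_gt0 r0 C0)).
apply: filterS => n hn; rewrite -adjointNr// -adjointDr//.
by apply: le_lt_trans (hC _) _; rewrite mulrC -ltr_pdivlMr.
Qed.

Lemma incr0 s t : 0 <= s -> 0 <= t -> {ae P, forall w, incr L s t 0 w = 0}.
Proof.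
move=> s0 t0; apply: filterS (incr_lin levyL 1 0 0 s0 t0) => w.
by rewrite scaler0 addr0 mul1r; lra.
Qed.

Lemma incr_sum s t (I : Type) (r : seq I) (c : I -> R) (g : I -> G) :
  0 <= s -> 0 <= t ->
  {ae P, forall w, incr L s t (\sum_(i <- r) c i *: g i) w =
    \sum_(i <- r) c i * incr L s t (g i) w}.
Proof.
move=> s0 t0; elim: r => [|i r IH].
  by rewrite big_nil; apply: filterS (incr0 s0 t0) => w; rewrite big_nil.
rewrite big_cons; apply: filterS2 IH (incr_lin levyL (c i) (g i) (\sum_(j <- r) c j *: g j) s0 t0).
by move=> w h ->; rewrite h big_cons.
Qed.

Section one_interval.
Context (s t : R) (s0 : 0 <= s) (st : s < t) (F : G -> H) (hF : hs_op a F).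
Context (e : nat -> H) (te : total_seq e).

Let t0 : 0 < t. Proof. exact: le_lt_trans s0 st. Qed.

Let x k w := incr L s t (adjoint F (e k)) w.

Let mx k : measurable_fun [set: Omega] (x k).
Proof. exact: measurable_incr. Qed.

(* the process equal to l *: F on (s, t] *)
Let Th (l : R) (w : Omega) (r : R) : G -> H := if r <= s then fun=> 0 else fun u => l *: F u.

Let gr : seq R := if s == 0 then [:: t] else [:: s; t].

Let gr_grid : grid t gr.
Proof.
rewrite /gr; have [_|sN] := eqVneq s 0; first by split=> //=; rewrite t0.
by split=> //=; rewrite st lt_def sN s0.
Qed.

Let Th_step l : step_on L t (hs_op a) gr (Th l).
Proof.
have hl := (hs_opZ sepG ba te l hF).1.
have h0 : hs_op a (fun _ : G => 0 : H) by exact: hs_op0.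
have hTh r : hs_op a (if r <= s then (fun _ : G => 0 : H) else fun u => l *: F u).
  by case: ifP => _.
split=> [|r /andP[r0 _]|w r r' /andP[r0 _] /andP[r'0 _]].
- exact: simple_cst.
- by exists 0; rewrite mem_head; split=> //; exact: simple_cst.
- rewrite /Th /gr; have [sE|sN] := eqVneq s 0; first by rewrite sE !leNgt r0 r'0.
  by move=> /(_ s); rewrite mem_head => /(_ isT) h; rewrite !leNgt h.
Qed.

Let Th_incr l : {ae P, forall w, forall k : nat,
  \sum_(j < size gr) dI L gr (Th l) j (e k) w = l * x k w}.
Proof.
apply: ae_foralln => k.
have bF := hF.1.
have h1 := incr0 (lexx 0) s0; have h2 := incr_lin levyL l (adjoint F (e k)) 0 s0 (ltW t0).
have h3 := incr0 s0 (ltW t0).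
have Es w : Th l w s = fun=> 0 by rewrite /Th lexx.
have Et w : Th l w t = fun u => l *: F u by rewrite /Th leNgt st.
have at1 : gr = (if s == 0 then [:: t] else [:: s; t]) by [].
move: at1; case: eqVneq => [sE|sN] ->.
  apply: filterS2 h2 h3 => w e2 e3; rewrite big_ord1 /dI /at_node /node /= Et adjointZ//.
  by move: e2 e3; rewrite /x sE addr0 => -> ->; rewrite addr0.
apply: filterS3 h1 h2 h3 => w e1 e2 e3.
rewrite big_ord_recl big_ord1 /dI /at_node /node /= Et Es adjointZ// adjoint_op0//.
by move: e2; rewrite /x e1 add0r addr0 e3 addr0 => ->.
Qed.

Let Th_VV l w : 0 <= l -> VV a alpha gr (Th l) w <= (t - s) * (l * hsn a F) `^ alpha.
Proof.
move=> l0; have [hl hln] := hs_opZ sepG ba te l hF.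
have Es : Th l w s = fun=> 0 by rewrite /Th lexx.
have Et : Th l w t = fun u => l *: F u by rewrite /Th leNgt st.
have ts0 : 0 <= t - s by rewrite subr_ge0 ltW.
have key : (t - s) * hsn a (fun u => l *: F u) `^ alpha <= (t - s) * (l * hsn a F) `^ alpha.
  rewrite ler_wpM2l//; apply: ge0_ler_powR; rewrite ?nnegrE ?hsn_ge0 ?mulr_ge0 ?hsn_ge0//; first exact: ltW.
  by rewrite (le_trans hln)// ger0_norm.
have at1 : gr = (if s == 0 then [:: t] else [:: s; t]) by [].
rewrite /VV; move: at1; case: eqVneq => [sE|sN] ->.
  by rewrite big_ord1 /vv /dt /at_node /node /= Et; move: key; rewrite sE.
rewrite big_ord_recl big_ord1 /vv /dt /at_node /node /= Et Es.
have -> : hsn a (fun _ : G => 0 : H) = 0 by rewrite /hsn hs_norm0.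
by rewrite powR0 ?gt_eqF// mulr0 add0r.
Qed.

Let S N w := \sum_(k < N) x k w ^+ 2.

Let S_ge0 N w : 0 <= S N w. Proof. by apply: sumr_ge0 => k _; exact: sqr_ge0. Qed.

Let mS N : measurable_fun [set: Omega] (S N).
Proof. by apply: measurable_sum => k; exact: measurable_funX. Qed.

Let A := [set w | exists M : nat, forall N, S N w <= M%:R].

Let mA : measurable A.
Proof.
have -> : A = \bigcup_(M : nat) \bigcap_(N : nat) [set w | S N w <= M%:R].
  apply/seteqP; split=> [w [M h]|w [M _ h]]; first by exists M => // N _; exact: h.
  by exists M => N; exact: (h N I).
apply: bigcup_measurable => M _; apply: bigcap_measurable => [|N _]; first by exists 0%N.
have := @measurable_fun_ler _ Omega R setT _ (cst M%:R) (mS N) (measurable_cst _) measurableT [set true] I.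
by rewrite setTI.
Qed.

Let prob_unbounded (delta : R) : 0 < delta -> EE P \1_(~` A) <= 2 * delta.
Proof.
move=> d0.
have [l l0 hl] : exists2 l : R, 0 < l & (t - s) * (l * hsn a F) `^ alpha <= delta.
  have ts0 : 0 < t - s by rewrite subr_gt0.
  have n0 := hsn_ge0 a F.
  pose q := (delta / (t - s)) `^ alpha^-1.
  have q0 : 0 < q by rewrite powR_gt0// divr_gt0.
  exists (q / (hsn a F + 1)); first by rewrite divr_gt0// ltr_wpDl.
  rewrite mulrC -ler_pdivlMr//.
  apply: (@le_trans _ _ (q `^ alpha)).
    have n1 : 0 < hsn a F + 1 by rewrite ltr_wpDl.
    have h1 : q / (hsn a F + 1) * hsn a F <= q.
      by rewrite mulrAC ler_pdivrMr// ler_wpM2l ?(ltW q0)// lerDl.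
    have h2 : 0 <= q / (hsn a F + 1) * hsn a F by rewrite mulr_ge0// divr_ge0// ltW.
    by apply: ge0_ler_powR; rewrite ?nnegrE// ltW.
  by rewrite /q -powRrM mulVf ?gt_eqF// powRr1// divr_ge0// ltW.
pose g N w := 1 - expR (- (l ^+ 2 * S N w / 4)).
have lS0 N w : 0 <= l ^+ 2 * S N w / 4.
  by apply: divr_ge0 => //; apply: mulr_ge0; [exact: sqr_ge0|exact: S_ge0].
have bg N : bounded_rv (g N).
  apply: brvB; first exact: brv_cst.
  apply: brv_expRN => [|w]; last exact: lS0.
  by apply: measurable_funM => //; exact: measurable_funM.
have gle N : EE P (g N) <= 2 * delta.
  have := step_upper sepG ba te alpha0 alpha2 levyL stableL gr_grid (Th_step l) N d0.
  have -> : [set w | delta < VV a alpha gr (Th l) w] = set0.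
    apply/seteqP; split=> // w /=; have := Th_VV w (ltW l0).
    by move=> h1 h2; have := le_lt_trans hl (lt_le_trans h2 h1); rewrite ltxx.
  rewrite [X in _ + X](_ : _ = 0); last first.
    by rewrite EE_indic// measure0.
  rewrite addr0; apply: le_trans.
  rewrite le_eqVlt; apply/orP; left; apply/eqP; apply: EE_ae => //.
    apply: brvB; first exact: brv_cst.
    apply: brv_expRN => [|w]; last by rewrite divr_ge0// sumr_ge0// => k _; exact: sqr_ge0.
    apply: measurable_funM => //; apply: measurable_sum => k; apply: measurable_funX.
    by apply: measurable_sum => j; exact: (measurable_dI gr_grid (Th_step l)).
  apply: filterS (Th_incr l) => w h; rewrite /g /S mulr_sumr; congr (1 - expR (- (_ / 4))).
  by apply: eq_bigr => k _; rewrite h exprMn.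
pose h N w := Num.max (g N w) (\1_A w).
have g01 N w : 0 <= g N w <= 1.
  have e0 := expR_ge0 (- (l ^+ 2 * S N w / 4)).
  have e1 : expR (- (l ^+ 2 * S N w / 4)) <= 1.
    by rewrite -[leRHS]expR0 ler_expR oppr_le0.
  rewrite /g; lra.
have bA := brv_indic (R := R) mA; have bcA := brv_indic (R := R) (measurableC mA).
have hcvg w : \1_(~` A) w * g N w @[N --> \oo] --> (\1_(~` A) w : R).
  rewrite indicE; have [Aw|nA] := pselect (A w).
    rewrite memNset/=; last by move=> /(_ Aw).
    by under eq_fun do rewrite mul0r; exact: cvg_cst.
  rewrite mem_set//=; under eq_fun do rewrite mul1r.
  apply/cvgrPdist_lt => r r0.
  have [N0 hN0] : exists N, 4 / (l ^+ 2 * r) < S N w.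
    apply: contrapT => hn; apply: nA; exists (Num.truncn (4 / (l ^+ 2 * r))).+1 => N.
    rewrite leNgt; apply/negP => h'; apply: hn; exists N.
    by apply: lt_trans h'; rewrite truncnS_gt.
  exists N0 => // N /= NN; have SN : S N0 w <= S N w.
    rewrite /S -!(big_mkord predT (fun k => x k w ^+ 2)).
    rewrite (@big_cat_nat _ _ _ N0 _ N)//= lerDl sumr_ge0// => i _; exact: sqr_ge0.
  rewrite /g opprB addrC subrK ger0_norm ?expR_ge0//.
  have l20 : 0 < l ^+ 2 by rewrite exprn_gt0.
  have h1 : r^-1 < l ^+ 2 * S N w / 4.
    have := lt_le_trans hN0 SN; rewrite ltr_pdivrMr ?mulr_gt0// => h2.
    rewrite ltr_pdivlMr// -ltr_pdivlMl ?invr_gt0// invrK; lra.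
  rewrite expRN -[ltRHS]invrK ltf_pV2 ?posrE ?expR_gt0 ?invr_gt0//.
  have := expR_ge1Dx (l ^+ 2 * S N w / 4); lra.
have bcg N := brvM bcA (bg N).
have cg1 N w : `|\1_(~` A) w * g N w| <= 1.
  have /andP[g0 g1] := g01 N w.
  by rewrite indicE; case: (_ \in _); rewrite ?mul1r ?mul0r ?normr0// ger0_norm.
have cv := EE_cvg bcg bcA cg1 (aeW P hcvg).
rewrite -(cvg_lim _ cv)//; apply: limr_le; first by apply/cvg_ex; eexists; exact: cv.
apply: nearW => N; apply: le_trans (gle N); apply: EE_le => // w.
have /andP[g0 _] := g01 N w.
by rewrite indicE; case: (_ \in _); rewrite ?mul1r ?mul0r.
Qed.

Let ae_bounded : {ae P, forall w, A w}.
Proof.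
have : EE P \1_(~` A) <= 0.
  apply/ler_addgt0Pl => r r0; rewrite addr0.
  have := prob_unbounded (divr_gt0 r0 (ltr0n R 2)).
  by rewrite mulrCA divff// mulr1.
have mcA := measurableC mA; rewrite EE_indic// => h0.
exists (~` A); split => //.
have := measure_ge0 P (~` A); rewrite -[X in (0 <= X)%E -> _]fineK ?fin_num_measure// lee_fin => h1.
by rewrite -[LHS]fineK ?fin_num_measure//; congr EFin; apply/eqP; rewrite eq_le h0.
Qed.

Let x' k w := \1_A w * x k w * inner (e k) (e k).

(** A Hilbert-Schmidt operator radonifies the increment: its coordinates are
    almost surely square summable. *)
Lemma radonification : exists X : Omega -> H, wm X /\
  forall h, {ae P, forall w, inner (X w) h = incr L s t (adjoint F h) w}.
Proof.
have bF := hF.1.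
have inner01 k : inner (e k) (e k) ^+ 2 = inner (e k) (e k).
  by case: (te.1.2 k I) => ->; rewrite ?expr0n ?expr1n.
have x'le w : exists M : R, forall N, \sum_(k < N) x' k w ^+ 2 <= M.
  have [[M hM]|nA] := pselect (A w); last first.
    exists 0 => N'; rewrite big1// => k _.
    by rewrite /x' indicE memNset// !mul0r expr0n.
  exists M%:R => N'; apply: le_trans (hM N'); apply: ler_sum => k _.
  rewrite /x' indicE mem_set; last by exists M.
  rewrite mul1r exprMn inner01 ler_piMr ?sqr_ge0//.
  by case: (te.1.2 k I) => ->.
have cvX w : cvgn (fun N => \sum_(k < N) x' k w *: e k).
  by have [M hM] := x'le w; exact: (orth_series_cvg te (c := fun k => x' k w) hM).
pose X w := limn (fun N => \sum_(k < N) x' k w *: e k).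
have hX w : \sum_(k < N) x' k w *: e k @[N --> \oo] --> X w by exact: cvX.
have mx' k : measurable_fun [set: Omega] (x' k).
  by apply: measurable_funM => //; apply: measurable_funM.
have wX : wm X.
  apply: (wm_lim (X := fun N w => \sum_(k < N) x' k w *: e k)) => // N.
  by apply: wm_sum => k; apply: wmZ => //; exact: wm_cst.
exists X; split=> // h.
have xx' : {ae P, forall w, forall k, x' k w = x k w}.
  apply: ae_foralln => k; apply: filterS2 ae_bounded (incr0 s0 (ltW t0)) => w Aw h0.
  rewrite /x' indicE mem_set// mul1r; case: (te.1.2 k I) => E; last by rewrite E mulr1.
  have ek : e k = 0 by apply/eqP; rewrite -normr_eq0 -sqrf_eq0 -inner_normE E.
  by rewrite E mulr0 /x ek adjoint0r.
have Xe w k : inner (X w) (e k) = x' k w.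
  apply: (orth_series_inner te (c := fun k => x' k w)) => [j|]; last exact: hX.
  by rewrite /x' -[LHS]mulrA -expr2 inner01.
pose hN N := \sum_(k < N) inner h (e k) *: e k.
have hNh : hN @ \oo --> h by exact: expansion_cvg.
pose gN N := adjoint F (hN N); pose g := adjoint F h.
have gNE N : gN N = \sum_(k < N) inner h (e k) *: adjoint F (e k).
  rewrite /gN /hN; elim: N => [|N IH]; first by rewrite !big_ord0 adjoint0r.
  by rewrite !big_ord_recr /= adjointDr// adjointZr// IH.
have eqN : {ae P, forall w, forall N, inner (X w) (hN N) = incr L s t (gN N) w}.
  apply: ae_foralln => N.
  have := incr_sum (index_enum 'I_N) (fun k => inner h (e k)) (fun k : 'I_N => adjoint F (e k)) s0 (ltW t0).
  apply: filterS2 xx' => w e1; rewrite gNE => ->.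
  by rewrite inner_sumr; apply: eq_bigr => k _; rewrite innerZr Xe e1.
have gNg : gN @ \oo --> g by exact: cvg_adjoint.
have Lcv r : 0 <= r -> EE P (fun w => Num.min `|L r (gN N) w - L r g w| 1) @[N --> \oo] --> 0.
  move=> r0; apply: EE_min1_cvg0 => [N|N w|q q0]; [|by []|].
    by apply: measurableT_comp => //; exact: measurable_funB.
  have [_ hc] := levyL.1 r r0; have := hc g q q0.
  by move=> /(cvg_comp _ _ gNg).
pose D N w := Num.min `|inner (X w) h - inner (X w) (hN N)| 1.
have mD N : measurable_fun [set: Omega] (fun w => `|inner (X w) h - inner (X w) (hN N)|).
  by apply: measurableT_comp => //; exact: measurable_funB.
have bD N : bounded_rv (D N) by exact: brv_min1.
have Dcv : EE P (D N) @[N --> \oo] --> 0.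
  rewrite -[X in _ --> X](EE_cst P 0); apply: (EE_cvg (M := 1)) => //; first exact: brv_cst.
    by move=> N w; rewrite ger0_norm ?ge_min ?lexx ?orbT// le_min normr_ge0 ler01.
  apply: aeW => w; have -> : 0 = Num.min (0 : R) 1 by rewrite min_l.
  apply: cvg_min1; apply/norm_cvg0P.
  rewrite -[X in _ --> X](subrr (inner (X w) h)); apply: cvgB; first exact: cvg_cst.
  under eq_fun do rewrite innerC; rewrite innerC; exact: cvg_inner.
pose Z w := `|inner (X w) h - incr L s t g w|.
have mZ : measurable_fun [set: Omega] Z.
  by apply: measurableT_comp => //; apply: measurable_funB => //; exact: measurable_incr.
have EZ : EE P (fun w => Num.min (Z w) 1) = 0.
  apply/eqP; rewrite eq_le EE_ge0 ?andbT; last by move=> w; rewrite le_min normr_ge0 ler01.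
  pose K r N w := Num.min `|L r (gN N) w - L r g w| 1.
  have bK r N : bounded_rv (K r N).
    apply: brv_min1 => //; apply: measurableT_comp => //; exact: measurable_funB.
  have cv : (EE P (D N) + EE P (K t N) + EE P (K s N))%R @[N --> \oo] --> (0 + 0 + 0 : R).
    by apply: cvgD; [apply: cvgD; [exact: Dcv|exact: (Lcv t (ltW t0))]|exact: (Lcv s s0)].
  have -> : (0 : R) = 0 + 0 + 0 by rewrite !addr0.
  rewrite -(cvg_lim _ cv)//.
  apply: limr_ge; first by apply/cvg_ex; eexists; exact: cv.
  apply: nearW => N; rewrite -[X in _ <= X + _]EED// -EED//; last exact: brvD.
  pose Z' w := Num.min `|inner (X w) h - inner (X w) (hN N) + incr L s t (gN N) w - incr L s t g w| 1.
  have bZ' : bounded_rv Z'.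
    apply: brv_min1 => //; apply: measurableT_comp => //.
    apply: measurable_funB; last exact: measurable_incr.
    apply: measurable_funD; last exact: measurable_incr.
    exact: measurable_funB.
  rewrite (@EE_ae _ _ _ P _ Z')//.
  - apply: EE_le => [//||w]; first by do 2?apply: brvD.
    have tri (p q : R) : Num.min `|p + q| 1 <= Num.min `|p| 1 + Num.min `|q| 1.
      have h1 := ler_normD p q; have h2 := normr_ge0 p; have h3 := normr_ge0 q.
      have [h4|h4] := leP `|p + q| 1; have [h5|h5] := leP `|p| 1;
        have [h6|h6] := leP `|q| 1; lra.
    rewrite /Z' /incr -[X in Num.min `|X| 1](_ : inner (X w) h - inner (X w) (hN N) +
      (L t (gN N) w - L t g w) + - (L s (gN N) w - L s g w) = _); last by ring.
    apply: le_trans (tri _ _) _; rewrite normrN lerD2r; exact: tri.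
  - by apply: brv_min1 => // w; exact: normr_ge0.
  - by apply: filterS eqN => w e1; rewrite /Z /Z' e1 subrK.
by apply: filterS (EE_min1_eq0 mZ (fun w => normr_ge0 _) EZ) => w /normr0_eq0/subr0_eq.
Qed.

End one_interval.
End radonification.

(** * The integral of a step process *)

Section step_integrals.
Context {d} {Omega : measurableType d} {R : realType} (P : probability Omega R).
Context {G H : hilbertType R} (sepG : separable G) (sepH : separable H).
Context (a : set G) (ba : orthonormal_basis a).
Context (alpha : R).
Hypotheses (alpha0 : 0 < alpha) (alpha2 : alpha < 2).
Context (L : R -> G -> {RV P >-> R}).
Hypothesis levyL : cylindrical_levy_process L.
Hypothesis stableL : canonical_stable alpha L.
Context (T : R) (T0 : 0 < T).

Lemma radonified_incrementP (F : G -> H) s t : hs_op a F -> 0 <= s -> s < t ->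
  wm (radonified_increment L F s t) /\
  forall h, {ae P, forall w,
    inner (radonified_increment L F s t w) h = incr L s t (adjoint F h) w}.
Proof.
move=> hF s0 st; have [e te] := separable_total_seq sepH.
have [X [wX hX]] := radonification sepG ba alpha0 alpha2 levyL stableL s0 st hF te.
have [bX hX'] := xgetPex (cst 0) (ex_intro _ X (conj (wm_borel sepH wX) hX) :
  exists X, borel_measurable X /\ forall h, {ae P, forall w,
      inner (X w) h = L t (adjoint F h) w - L s (adjoint F h) w}).
by split; [exact: borel_wm bX|exact: hX'].
Qed.

Lemma step_sum_wm (S : step (Omega := Omega) (R := R) (G -> H)) : adapted_step L T (hs_op a) S -> wm (step_sum L S).
Proof.
move=> aS; have [[t1 tn n1] [tlt hOp hA0 hA]] := aS; have gs := step_grid_grid aS.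
have nS : (step_n S).-1.+1 = step_n S by rewrite prednK// ltnW.
have szE := size_step_grid S.
have -> : step_sum L S = fun w => \sum_(j < (step_n S).-1) \sum_(k < step_N S j.+1)
    \1_(step_A S j.+1 k) w *:
      radonified_increment L (step_F S j.+1 k) (step_t S j.+1) (step_t S j.+2) w.
  by apply/funext => w; rewrite /step_sum big_add1 big_mkord.
apply: wm_sum => j; apply: wm_sum => k.
have jn : (j.+1 < step_n S)%N by move: (ltn_ord j); rewrite -ltnS nS.
apply: wmZ.
  by apply: measurable_indic; apply: levy_filtration_measurable; exact: hA.
have [] // := @radonified_incrementP (step_F S j.+1 k) (step_t S j.+1) (step_t S j.+2).
- exact: hOp.
- by rewrite -(node_step_grid aS) ?(ltnW jn)// (node_ge0 gs)// szE ltnW.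
- exact: tlt.
Qed.

Lemma step_sum_coord (S : step (Omega := Omega) (R := R) (G -> H)) (Th : Omega -> R -> G -> H) h : adapted_step L T (hs_op a) S ->
  represents T S Th ->
  {ae P, forall w, inner (step_sum L S w) h =
    \sum_(j < size (step_grid S)) dI L (step_grid S) Th j h w}.
Proof.
move=> aS rS; have gs := step_grid_grid aS.
have [[t1 tn n1] [tlt hOp hA0 hA]] := aS.
have nS : (step_n S).-1.+1 = step_n S by rewrite prednK// ltnW.
have szE := size_step_grid S.
have main : {ae P, forall w, forall j : 'I_(size (step_grid S)),
    inner (\sum_(k < step_N S j.+1) \1_(step_A S j.+1 k) w *:
      radonified_increment L (step_F S j.+1 k) (step_t S j.+1) (step_t S j.+2) w) h =
    dI L (step_grid S) Th j h w}.
  apply: filter_forall => j; have js := ltn_ord j.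
  have jn : (j.+1 < step_n S)%N by rewrite -nS ltnS -szE.
  have j0 : 0 <= step_t S j.+1.
    by rewrite -(node_step_grid aS) ?(ltnW jn)// (node_ge0 gs)// ltnW.
  have jlt : step_t S j.+1 < step_t S j.+2 by apply: tlt.
  have hrad : {ae P, forall w, forall k : 'I_(step_N S j.+1),
      inner (radonified_increment L (step_F S j.+1 k) (step_t S j.+1) (step_t S j.+2) w) h =
      incr L (step_t S j.+1) (step_t S j.+2) (adjoint (step_F S j.+1 k) h) w}.
    apply: filter_forall => k; have hF := hOp _ _ jn (ltn_ord k).
    exact: (radonified_incrementP hF j0 jlt).2.
  have hlin : {ae P, forall w, forall b : {ffun 'I_(step_N S j.+1) -> bool},
      incr L (step_t S j.+1) (step_t S j.+2)
        (\sum_(k < step_N S j.+1) (b k)%:R *: adjoint (step_F S j.+1 k) h) w =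
      \sum_(k < step_N S j.+1) (b k)%:R * incr L (step_t S j.+1) (step_t S j.+2) (adjoint (step_F S j.+1 k) h) w}.
    apply: filter_forall => b; apply: incr_sum => //; exact: le_trans (ltW jlt).
  apply: filterS2 hrad hlin => w e1 e2.
  pose b := [ffun k : 'I_(step_N S j.+1) => w \in step_A S j.+1 k].
  have := e2 b; rewrite /dI /at_node !(node_step_grid aS)//; last exact: ltnW.
  have -> : adjoint (Th w (step_t S j.+2)) h =
      \sum_(k < step_N S j.+1) (b k)%:R *: adjoint (step_F S j.+1 k) h.
    rewrite -(node_step_grid aS)// (represents_piece w aS rS js) /step_piece.
    have bF (k : 'I_(step_N S j.+1)) : bounded_op (fun u => (b k)%:R *: step_F S j.+1 k u).
      by apply: bounded_opZ; have [] := hOp _ _ jn (ltn_ord k).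
    transitivity (\sum_(k < step_N S j.+1) adjoint (fun u => (b k)%:R *: step_F S j.+1 k u) h).
      have [_ <-] := adjoint_sum sepG (index_enum _) h bF.
      congr adjoint; apply/funext => u; apply: eq_bigr => k _.
      by rewrite ffunE indicE.
    apply: eq_bigr => k _; rewrite adjointZ//.
    by have [] := hOp _ _ jn (ltn_ord k).
  move=> ->; rewrite inner_suml; apply: eq_bigr => k _.
  by rewrite innerZl e1 ffunE indicE.
apply: filterS main => w hw; rewrite /step_sum inner_suml.
rewrite big_add1 big_mkord -szE; apply: eq_bigr => j _; exact: hw.
Qed.

(** The sum of the increments does not depend on the grid: on a finer grid it
    telescopes, path by path. *)
Lemma dI_sum_grid s s' (Th : Omega -> R -> G -> H) h w : grid T s -> grid T s' ->
  step_on L T (hs_op a) s Th -> step_on L T (hs_op a) s' Th ->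
  \sum_(j < size s) dI L s Th j h w = \sum_(j < size s') dI L s' Th j h w.
Proof.
move=> gs gs' sT sT'.
pose phi z y := L y (adjoint (Th w z) h) w.
have E q : \sum_(j < size q) dI L q Th j h w = grid_sum (fun y z => phi z z - phi z y) 0 q by [].
have [gm sm s'm] := merge_gridP T0 gs gs'.
have refine q : grid T q -> step_on L T (hs_op a) q Th -> {subset q <= merge_grid s s'} ->
    grid_sum (fun y z => phi z z - phi z y) 0 q =
    grid_sum (fun y z => phi z z - phi z y) 0 (merge_grid s s').
  move=> gq [_ _ hq] qm; apply: grid_sum_refine => //; [exact: gq.1|exact: gm.1|by rewrite gq.2 gm.2|].
  move=> t t'; rewrite gq.2 => tT t'T hz; rewrite /phi.
  by apply/funext => y; rewrite (hq w t t' tT t'T hz).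
by rewrite !E (refine s)// (refine s').
Qed.

Let hs0 : hs_op a (fun _ : G => 0 : H). Proof. exact: hs_op0. Qed.

Let e_of_H := separable_total_seq sepH.

Lemma hs_op_add (F F' : G -> H) : hs_op a F -> hs_op a F' -> hs_op a (fun x => F x + F' x).
Proof. by have [e te] := e_of_H => hF hF'; have [] := hs_opD sepG ba te hF hF'. Qed.

Lemma hs_op_sub (F F' : G -> H) : hs_op a F -> hs_op a F' -> hs_op a (F \- F').
Proof. by have [e te] := e_of_H => hF hF'; have [] := hs_opB sepG ba te hF hF'. Qed.

Lemma step_hsP (Th : Omega -> R -> G -> H) :
  step_hs a L T Th <-> exists2 s, grid T s & step_on L T (hs_op a) s Th.
Proof.
split=> [[S aS rS]|[s gs sT]].
  exists (step_grid S); first exact: step_grid_grid aS.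
  exact: (step_on_of_step T0 hs0 hs_op_add aS rS).
by have [S [aS rS]] := step_of_step_on T0 hs0 gs sT; exists S.
Qed.

(** The coordinates of the integral, for any grid on which the process is a step
    process. *)
Lemma step_integralP s (Th : Omega -> R -> G -> H) : grid T s ->
  step_on L T (hs_op a) s Th ->
  wm (step_integral a L T Th) /\
  forall h, {ae P, forall w, inner (step_integral a L T Th w) h = \sum_(j < size s) dI L s Th j h w}.
Proof.
move=> gs sT; have [S [aS rS]] := step_of_step_on T0 hs0 gs sT.
have [S' [aS' rS' E]] := xgetPex (cst 0) (ex_intro _ (step_sum L S)
    (ex_intro _ S (And3 aS rS erefl)) : exists I : Omega -> H, exists S,
    [/\ adapted_step L T (hs_op a) S, represents T S Th & I = step_sum L S]).
have -> : step_integral a L T Th = step_sum L S' := E.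
split=> [|h]; first exact: step_sum_wm.
apply: filterS (step_sum_coord h aS' rS') => w ->.
apply: dI_sum_grid => //; first exact: step_grid_grid aS'.
exact: (step_on_of_step T0 hs0 hs_op_add aS' rS').
Qed.

Lemma ae_eq_coord (X Y : Omega -> H) :
  (forall h, {ae P, forall w, inner (X w) h = inner (Y w) h}) -> {ae P, forall w, X w = Y w}.
Proof.
have [e te] := e_of_H => XY.
have : {ae P, forall w, forall k, inner (X w) (e k) = inner (Y w) (e k)}.
  by apply: ae_foralln => k; exact: XY.
by apply: filterS => w; exact: (total_inner_eq te).
Qed.

Lemma step_integralB (Th Th' : Omega -> R -> G -> H) : step_hs a L T Th -> step_hs a L T Th' ->
  step_hs a L T (fun w t => Th w t \- Th' w t) /\
  {ae P, forall w, step_integral a L T (fun w t => Th w t \- Th' w t) w =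
     step_integral a L T Th w - step_integral a L T Th' w}.
Proof.
move=> /step_hsP[s gs sT] /step_hsP[s' gs' sT'].
have [gm sm s'm] := merge_gridP T0 gs gs'; set m := merge_grid s s' in gm sm s'm.
have mT := step_on_refine sm sT; have mT' := step_on_refine s'm sT'.
have mB : step_on L T (hs_op a) m (fun w t => Th w t \- Th' w t).
  exact: (step_on_map2 (h := fun F F' => F \- F') hs_op_sub gm mT mT').
split; first by apply/step_hsP; exists m.
apply: ae_eq_coord => h.
have [_ h1] := step_integralP gm mT; have [_ h2] := step_integralP gm mT'.
have [_ h3] := step_integralP gm mB.
have lin : {ae P, forall w, forall j : 'I_(size m),
    dI L m (fun w t => Th w t \- Th' w t) j h w = dI L m Th j h w - dI L m Th' j h w}.
  apply: filter_forall => j; have jm := ltn_ord j.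
  have /andP[j0 jj] := nodes_le gm jm.
  have sj := simple_map2 (h := pair) (O3 := [set FF : (G -> H) * (G -> H) | hs_op a FF.1 /\ hs_op a FF.2])
    (fun _ _ h1 h2 => conj h1 h2) (step_on_node gm mT jm) (step_on_node gm mT' jm).
  pose D (F : G -> H) w := incr L (node m j) (node m j.+1) (adjoint F h) w.
  have := @ae_simple _ _ _ P _ L _ _ _ _
    (fun FF w => D (FF.1 \- FF.2) w = D FF.1 w - D FF.2 w) sj.
  apply=> -[F F'] [/= hF hF'].
  have := incr_lin levyL (-1) (adjoint F' h) (adjoint F h) j0 (le_trans j0 jj).
  apply: filterS => w; rewrite /D => e1.
  have -> : F \- F' = (fun x => F x + (-1 *: F' x)) by apply/funext => x; rewrite scaleN1r.
  rewrite adjointD//; [|exact: hF.1|exact/bounded_opZ/hF'.1].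
  rewrite adjointZ//; last exact: hF'.1.
  by rewrite addrC e1 mulN1r addrC.
apply: filterS2 (filterI (h1 h) (h2 h)) (filterI (h3 h) lin) => w [e1 e2] [e3 e4].
rewrite e3 innerBl e1 e2 -sumrB; apply: eq_bigr => j _; exact: e4.
Qed.

End step_integrals.

(** * Estimates for the integral of a step process *)

Section distance_zero.
Context {d} {Omega : measurableType d} {R : realType} (P : probability Omega R).
Context {H : hilbertType R} (sepH : separable H).
Implicit Types X Y : Omega -> H.

Definition rho X : R := EE P (fun w => Num.min `|X w| 1).

Lemma brv_rho X : wm X -> bounded_rv (fun w => Num.min `|X w| 1).
Proof. by move=> wX; apply: brv_min1 => [|w]; [exact: wm_norm wX|]. Qed.

Lemma rho_ge0 X : 0 <= rho X.
Proof. by apply: EE_ge0 => w; rewrite le_min normr_ge0 ler01. Qed.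

Lemma expect_min1E X : wm X -> expect_min1 P X = (rho X)%:E.
Proof. by move=> wX; rewrite /expect_min1 unlock EE_fin//; exact: brv_rho. Qed.

Lemma rho_ae X Y : wm X -> wm Y -> {ae P, forall w, X w = Y w} -> rho X = rho Y.
Proof.
move=> wX wY XY; apply: EE_ae; [exact: brv_rho|exact: brv_rho|].
by apply: filterS XY => w ->.
Qed.

Lemma rhoD X Y : wm X -> wm Y -> rho (fun w => X w + Y w) <= rho X + rho Y.
Proof.
move=> wX wY; rewrite /rho -EED; [|exact: brv_rho|exact: brv_rho].
apply: EE_le; [by apply: brv_rho; exact: wmD|by apply: brvD; exact: brv_rho|] => w.
move: (ler_normD (X w) (Y w)) (normr_ge0 (X w)) (normr_ge0 (Y w)).
move: `|X w + Y w| `|X w| `|Y w| => z x y h x0 y0.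
have [z1|z1] := leP z 1; have [x1|x1] := leP x 1; have [y1|y1] := leP y 1; try lra.
Qed.

Lemma rhoN X : rho (fun w => - X w) = rho X.
Proof. by rewrite /rho; congr EE; apply/funext => w; rewrite normrN. Qed.

Lemma rhoB X Y : wm X -> wm Y -> rho (fun w => X w - Y w) <= rho X + rho Y.
Proof.
move=> wX wY; rewrite -(rhoN Y); apply: rhoD => //.
by have := wmB (wm_cst 0) wY; under eq_fun do rewrite sub0r.
Qed.

Lemma rho_le X Y : wm X -> wm Y -> (forall w, `|X w| <= `|Y w|) -> rho X <= rho Y.
Proof.
move=> wX wY XY; apply: EE_le; [exact: brv_rho|exact: brv_rho|] => w.
by rewrite le_min ge_min XY /= ge_min lexx orbT.
Qed.

End distance_zero.

Lemma min1_le_expR (R : realType) (x r : R) : 0 <= x -> 0 < r -> r <= 1 ->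
  Num.min x 1 <= r + 8 / r ^+ 2 * (1 - expR (- (x ^+ 2 / 4))).
Proof.
move=> x0 r0 r1; have x2 : 0 <= x ^+ 2 / 4 by rewrite divr_ge0// sqr_ge0.
have e0 := oneB_expR_ge x2.
have r2 : 0 < r ^+ 2 by exact: exprn_gt0.
have [xr|rx] := leP x r.
  apply: (@le_trans _ _ r); first by rewrite ge_min xr.
  rewrite lerDl mulr_ge0 ?divr_ge0 ?(ltW r2)//; apply: le_trans e0.
  by rewrite divr_ge0// le_min x2 ler01.
apply: (@le_trans _ _ 1); first by rewrite ge_min lexx orbT.
have rx2 : r ^+ 2 <= x ^+ 2 by rewrite ler_pXn2r ?nnegrE// ltW.
have r21 : r ^+ 2 <= 1 by rewrite expr_le1// ltW.
have m : r ^+ 2 / 8 <= 1 - expR (- (x ^+ 2 / 4)).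
  apply: le_trans e0; suff : r ^+ 2 / 4 <= Num.min (x ^+ 2 / 4) 1.
    by move: (Num.min _ _) => m; lra.
  by rewrite le_min; apply/andP; split; lra.
have : 8 / r ^+ 2 * (r ^+ 2 / 8) <= 8 / r ^+ 2 * (1 - expR (- (x ^+ 2 / 4))).
  by rewrite ler_wpM2l// divr_ge0// ltW.
have -> : 8 / r ^+ 2 * (r ^+ 2 / 8) = 1 by field; rewrite gt_eqF.
by move=> h; apply: le_trans h _; rewrite lerDr ltW.
Qed.

Section step_bounds.
Context {d} {Omega : measurableType d} {R : realType} (P : probability Omega R).
Context {G H : hilbertType R} (sepG : separable G) (sepH : separable H).
Context (a : set G) (ba : orthonormal_basis a).
Context (alpha : R).
Hypotheses (alpha0 : 0 < alpha) (alpha2 : alpha < 2).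
Context (L : R -> G -> {RV P >-> R}).
Hypothesis levyL : cylindrical_levy_process L.
Hypothesis stableL : canonical_stable alpha L.
Context (T : R) (T0 : 0 < T).

Let stepP := @step_integralP _ _ _ P _ _ sepG sepH _ ba _ alpha0 alpha2 _ levyL stableL _ T0.

Lemma brv_VV s (Th : Omega -> R -> G -> H) : grid T s -> step_on L T (hs_op a) s Th ->
  bounded_rv (VV a alpha s Th).
Proof.
move=> gs sT; exact: (brv_ord_sum (leqnn (size s)) (brv_vv alpha gs sT)).
Qed.

Lemma VV_ge0 s (Th : Omega -> R -> G -> H) w : grid T s -> 0 <= VV a alpha s Th w.
Proof. by move=> gs; apply: sumr_ge0 => j _; exact: (vv_ge0 a alpha gs). Qed.

Lemma step_bound_upper s (Th : Omega -> R -> G -> H) (r c : R) : grid T s ->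
  step_on L T (hs_op a) s Th -> 0 < r -> r <= 1 -> 0 < c -> c <= 1 ->
  rho P (step_integral a L T Th) <=
    r + 8 / r ^+ 2 * (2 * c + EE P (fun w => Num.min (VV a alpha s Th w) 1) / c).
Proof.
move=> gs sT r0 r1 c0 c1; have [e te] := separable_total_seq sepH.
have [wX hX] := stepP gs sT; set X := step_integral a L T Th in wX hX *.
have mV := brv_VV gs sT; have V0 w := VV_ge0 Th w gs.
pose f N w := 1 - expR (- ((\sum_(k < N) inner (X w) (e k) ^+ 2) / 4)).
pose g w := 1 - expR (- (`|X w| ^+ 2 / 4)).
have ms N : measurable_fun [set: Omega] (fun w => (\sum_(k < N) inner (X w) (e k) ^+ 2) / 4).
  apply: measurable_funM => //.
  by apply: measurable_sum => k; apply: measurable_funX; exact: wX.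
have s0 N w : 0 <= (\sum_(k < N) inner (X w) (e k) ^+ 2) / 4.
  by rewrite divr_ge0// sumr_ge0// => k _; exact: sqr_ge0.
have bf N : bounded_rv (f N) by apply: brvB; [exact: brv_cst|exact: brv_expRN].
have bg : bounded_rv g.
  apply: brvB; [exact: brv_cst|apply: brv_expRN => [|w]].
    by apply: measurable_funM => //; apply: measurable_funX; exact: wm_norm wX.
  by rewrite divr_ge0// sqr_ge0.
have fle N : EE P (f N) <= 2 * c + EE P (fun w => Num.min (VV a alpha s Th w) 1) / c.
  have m1 k : measurable_fun [set: Omega] (fun w => \sum_(j < size s) dI L s Th j (e k) w).
    by apply: measurable_sum => j; exact: (measurable_dI gs sT).
  have -> : EE P (f N) = EE P (fun w => 1 - expR (- ((\sum_(k < N)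
      (\sum_(j < size s) dI L s Th j (e k) w) ^+ 2) / 4))).
    apply: EE_ae => //.
      apply: brvB; [exact: brv_cst|apply: brv_expRN => [|w]].
        apply: measurable_funM => //.
        by apply: measurable_sum => k; apply: measurable_funX; exact: m1.
      by rewrite divr_ge0// sumr_ge0// => k _; exact: sqr_ge0.
    have : {ae P, forall w, forall k, inner (X w) (e k) = \sum_(j < size s) dI L s Th j (e k) w}.
      by apply: ae_foralln => k; exact: hX.
    by apply: filterS => w hw; rewrite /f; under eq_bigr do rewrite hw.
  apply: le_trans (step_upper sepG ba te alpha0 alpha2 levyL stableL gs sT N c0) _.
  by rewrite lerD2l; apply: EE_min1_markov => //; exact: brv_meas mV.
have gle : EE P g <= 2 * c + EE P (fun w => Num.min (VV a alpha s Th w) 1) / c.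
  have cv : EE P (f N) @[N --> \oo] --> EE P g.
    apply: (EE_cvg (M := 1) bf bg) => [N w|].
      rewrite /f ger0_norm; first by rewrite lerBlDr lerDl expR_ge0.
      by rewrite subr_ge0 -[leRHS]expR0 ler_expR oppr_le0.
    apply: aeW => w; apply: cvgB; first exact: cvg_cst.
    apply: continuous_cvg; first exact: continuous_expR.
    by apply: cvgN; apply: cvgMl; exact: (sum_sqr_cvg te).
  rewrite -(cvg_lim (@Rhausdorff R) cv); apply: limr_le; first exact: cvgP cv.
  by apply: nearW.
have bb : bounded_rv (fun w => r + 8 / r ^+ 2 * g w) by apply: brvD; [exact: brv_cst|exact: brvZ].
apply: (@le_trans _ _ (EE P (fun w => r + 8 / r ^+ 2 * g w))).
  by apply: EE_le => // [|w]; [exact: brv_rho|exact: min1_le_expR].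
rewrite EED; [|exact: brv_cst|exact: brvZ]; rewrite EE_cst EEZ// lerD2l ler_wpM2l//.
by rewrite divr_ge0// exprn_ge0// ltW.
Qed.

Lemma step_integral_eq (Th Th' : Omega -> R -> G -> H) :
  (forall w t, 0 <= t <= T -> Th w t = Th' w t) ->
  step_integral a L T Th = step_integral a L T Th'.
Proof.
move=> E; rewrite /step_integral; congr xget; apply/seteqP; split=> I [S [aS rS IE]];
  exists S; split=> // w t tT; first by rewrite -E ?rS.
by rewrite E ?rS.
Qed.

Lemma step_hs_eq (Th Th' : Omega -> R -> G -> H) :
  (forall w t, 0 <= t <= T -> Th w t = Th' w t) -> step_hs a L T Th -> step_hs a L T Th'.
Proof. by move=> E [S aS rS]; exists S => // w t tT; rewrite -E ?rS. Qed.

Lemma step_op1P (Gam : Omega -> R -> H -> H) : step_op1 L T Gam <->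
  (exists2 s, grid T s & step_on L T (@bounded_op R H H) s Gam) /\
  forall w t, 0 <= t <= T -> forall x, `|Gam w t x| <= `|x|.
Proof.
have b0 : @bounded_op R H H (fun=> 0) by exact: bounded_op0.
split=> [[[S aS rS] le1]|[[s gs sT] le1]].
  have sT : step_on L T (@bounded_op R H H) (step_grid S) Gam.
    exact: (step_on_of_step T0 b0 (@bounded_opD _ _ _) aS rS).
  split; first by exists (step_grid S) => //; exact: step_grid_grid aS.
  move=> w t tT; apply/op_norm_le1P; last exact: le1.
  by have [] := step_on_in w sT tT.
split=> [|w t tT].
  by have [S [aS rS]] := step_of_step_on T0 b0 gs sT; exists S.
by apply/op_norm_le1P; [have [] := step_on_in w sT tT|exact: le1].
Qed.

Lemma step_op1_bounded (Gam : Omega -> R -> H -> H) w t : step_op1 L T Gam ->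
  0 <= t <= T -> bounded_op (Gam w t).
Proof. by move=> /step_op1P[[s gs sT] _]; exact: (step_on_in w sT). Qed.

Lemma step_op1_le (Gam : Omega -> R -> H -> H) w t x : step_op1 L T Gam ->
  0 <= t <= T -> `|Gam w t x| <= `|x|.
Proof. by move=> /step_op1P[_ h] tT; exact: h. Qed.

Lemma step_op1_comp (Gam Gam' : Omega -> R -> H -> H) : step_op1 L T Gam ->
  step_op1 L T Gam' -> step_op1 L T (fun w t => Gam w t \o Gam' w t).
Proof.
move=> gG gG'; have /step_op1P[[s gs sT] le1] := gG; have /step_op1P[[s' gs' sT'] le1'] := gG'.
apply/step_op1P; split; last first.
  by move=> w t tT x /=; rewrite (le_trans (le1 _ _ tT _))// le1'.
have [gm sm s'm] := merge_gridP T0 gs gs'; exists (merge_grid s s') => //.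
apply: (step_on_map2 (h := fun F F' : H -> H => F \o F') _ gm (step_on_refine sm sT) (step_on_refine s'm sT')).
by move=> F F'; exact: bounded_op_comp.
Qed.

Lemma step_op1_id : step_op1 L T (fun _ _ (x : H) => x).
Proof.
apply/step_op1P; split => //; exists [:: T]; first by split; rewrite //= T0.
have sc t : simple L t (@bounded_op R H H) (fun=> fun x => x) by apply: simple_cst; exact: bounded_op_id.
by split=> // t /andP[t0 _]; exists 0; rewrite mem_head.
Qed.

Lemma step_hs_comp (Gam : Omega -> R -> H -> H) (Th : Omega -> R -> G -> H) :
  step_op1 L T Gam -> step_hs a L T Th -> step_hs a L T (op_comp Gam Th).
Proof.
have [e te] := separable_total_seq sepH.
move=> /step_op1P[[s gs sT] _] /(step_hsP sepG sepH ba L T0)[s' gs' sT'].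
apply/(step_hsP sepG sepH ba L T0).
have [gm sm s'm] := merge_gridP T0 gs gs'; exists (merge_grid s s') => //.
apply: (step_on_map2 (h := fun (F : H -> H) (F' : G -> H) => F \o F') _ gm (step_on_refine sm sT) (step_on_refine s'm sT')).
by move=> F F'; exact: (hs_op_comp sepG ba te).
Qed.

(** The process equal to [b j *: id] on the j-th interval of the grid. *)
Definition sign_process (s : seq R) (b : nat -> R) : Omega -> R -> H -> H :=
  fun w t x => b (count (fun y => y < t) s) *: x.

Lemma count_node s j : grid T s -> (j < size s)%N ->
  count (fun y => y < node s j.+1) s = j.
Proof.
move=> gs js; rewrite -[X in count _ X](cat_take_drop j s) count_cat.
have -> : count (fun y => y < node s j.+1) (drop j s) = 0%N.
  apply/eqP; rewrite -leqn0 leqNgt -has_count; apply/negP => /hasP[y yd].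
  have [i ilt <-] := nthP 0 yd; rewrite size_drop in ilt; rewrite nth_drop -nodeS.
  have jis : (j + i < size s)%N by rewrite -ltn_subRL.
  have h : node s j.+1 <= node s (j + i).+1 by apply: (node_le gs); rewrite ?ltnS ?leq_addr.
  by rewrite ltNge h.
rewrite addn0 -[RHS](size_takel (ltnW js)); apply/eqP; rewrite -all_count.
apply/allP => y yd; have [i ilt <-] := nthP 0 yd; rewrite size_takel ?(ltnW js)// in ilt.
by rewrite nth_take// -nodeS (node_lt gs).
Qed.

Lemma sign_process_op1 s b : grid T s -> (forall j, b j = 1 \/ b j = -1) ->
  step_op1 L T (sign_process s b).
Proof.
move=> gs hb; have sc c t : simple L t (@bounded_op R H H) (fun=> fun x => c *: x).
  by apply: simple_cst; apply: bounded_opZ; exact: bounded_op_id.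
apply/step_op1P; split; last first.
  move=> w t _ x; rewrite /sign_process normrZ.
  by have [->|->] := hb (count (fun y => y < t) s); rewrite ?normrN normr1 mul1r.
exists s => //; split=> [|t /andP[t0 _]|w t t' _ _ h].
- exact: sc.
- by exists 0; rewrite mem_head; split=> //; exact: sc.
- apply/funext => x; rewrite /sign_process; congr (b _ *: x).
  exact: eq_in_count.
Qed.

Lemma step_bound_lower s (Th : Omega -> R -> G -> H) (eta : R) : grid T s ->
  step_on L T (hs_op a) s Th ->
  (forall Gam, step_op1 L T Gam -> rho P (step_integral a L T (op_comp Gam Th)) <= eta) ->
  EE P (fun w => Num.min (VV a alpha s Th w) 1) <= 75 * eta.
Proof.
move=> gs sT heta; have [e te] := separable_total_seq sepH.
apply: (step_lower sepG ba te alpha0 alpha2 levyL stableL gs sT) => N b hb.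
have gG := sign_process_op1 gs hb; apply: le_trans (heta _ gG).
have sGT : step_on L T (hs_op a) s (op_comp (sign_process s b) Th).
  apply: (step_on_map2 (h := fun (F : H -> H) (F' : G -> H) => F \o F') _ gs _ sT).
    by move=> F F'; exact: (hs_op_comp sepG ba te).
  have /step_op1P[_ _] := gG.
  have sc c t : simple L t (@bounded_op R H H) (fun=> fun x => c *: x).
    by apply: simple_cst; apply: bounded_opZ; exact: bounded_op_id.
  split=> [|t /andP[t0 _]|w t t' _ _ h]; first exact: sc.
    by exists 0; rewrite mem_head; split=> //; exact: sc.
  apply/funext => x; rewrite /sign_process; congr (b _ *: x).
  exact: eq_in_count.
have [wX hX] := stepP gs sGT; set X := step_integral _ _ _ _ in wX hX *.
have hd : {ae P, forall w, forall k, forall j : 'I_(size s),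
    dI L s (op_comp (sign_process s b) Th) j (e k) w = b j * dI L s Th j (e k) w}.
  apply: ae_foralln => k; apply: filter_forall => j; have js := ltn_ord j.
  have /andP[j0 jj] := nodes_le gs js.
  pose D (F : G -> H) w := incr L (node s j) (node s j.+1) (adjoint F (e k)) w.
  have E w : op_comp (sign_process s b) Th w (node s j.+1) = fun x => b j *: Th w (node s j.+1) x.
    by rewrite /op_comp /sign_process count_node.
  suff : {ae P, forall w, D (fun x => b j *: Th w (node s j.+1) x) w =
      b j * D (Th w (node s j.+1)) w}.
    by apply: filterS => w; rewrite /dI /at_node E.
  apply: (@ae_simple _ _ _ P _ L _ _ _ _
    (fun F w => D (fun x => b j *: F x) w = b j * D F w) (step_on_node gs sT js)) => F hF.
  have := incr_lin levyL (b j) (adjoint F (e k)) 0 j0 (le_trans j0 jj).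
  have := incr0 levyL j0 (le_trans j0 jj).
  apply: filterS2 => w e0; rewrite addr0 e0 addr0 => <-.
  by rewrite /D adjointZ//; exact: hF.1.
have mb k : measurable_fun [set: Omega] (fun w => \sum_(j < size s) b j * dI L s Th j (e k) w).
  by apply: measurable_sum => j; apply: measurable_funM => //; exact: (measurable_dI gs sT).
have bY : bounded_rv (fun w => Num.min (\sum_(k < N) inner (X w) (e k) ^+ 2) 1).
  apply: brv_min1 => [|w]; last by apply: sumr_ge0 => k _; exact: sqr_ge0.
  by apply: measurable_sum => k; apply: measurable_funX; exact: wX.
rewrite (_ : EE P _ = EE P (fun w => Num.min (\sum_(k < N) inner (X w) (e k) ^+ 2) 1)).
  apply: EE_le => //; first exact: brv_rho.
  move=> w; apply: (@le_trans _ _ (Num.min (`|X w| ^+ 2) 1)).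
    by rewrite le_min !ge_min lexx orbT andbT (total_bessel te).
  rewrite min1_sqr//; set x := Num.min _ _.
  have x0 : 0 <= x by rewrite /x le_min normr_ge0 ler01.
  have x1 : x <= 1 by rewrite /x ge_min lexx orbT.
  by rewrite expr2 ler_piMl.
apply: EE_ae => //.
  apply: brv_min1 => [|w]; last by apply: sumr_ge0 => k _; exact: sqr_ge0.
  by apply: measurable_sum => k; apply: measurable_funX; exact: mb.
have hX' : {ae P, forall w, forall k, inner (X w) (e k) =
    \sum_(j < size s) dI L s (op_comp (sign_process s b) Th) j (e k) w}.
  by apply: ae_foralln => k; exact: hX.
apply: filterS2 hX' hd => w h1 h2; congr Num.min; apply: eq_bigr => k _.
by rewrite h1; congr (_ ^+ 2); apply: eq_bigr => j _; rewrite h2.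
Qed.

End step_bounds.

(** * The truncated modular *)

Section liminf.
Context {R : realType}.
Implicit Types u v : (\bar R)^nat.
Local Open Scope ereal_scope.

Lemma limn_einf_sup_einfs u : limn_einf u = ereal_sup (range (einfs u)).
Proof. by rewrite limn_einf_lim; apply: cvg_lim => //; exact: cvg_einfs_sup. Qed.

Lemma limn_einf_ge0 u : (forall n, 0 <= u n) -> 0 <= limn_einf u.
Proof.
move=> u0; rewrite limn_einf_sup_einfs; apply: ereal_sup_ge; exists (einfs u 0%N) => //.
by apply: le_ereal_inf_tmp => _ [n _ <-]; exact: u0.
Qed.

Lemma limn_einf_le_near u c K : (forall n, (K <= n)%N -> u n <= c) -> limn_einf u <= c.
Proof.
move=> h; rewrite limn_einf_sup_einfs; apply: ge_ereal_sup => _ [n _ <-].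
apply: (@le_trans _ _ (u (maxn K n))); last by apply: h; exact: leq_maxl.
by apply: ereal_inf_lbound; exists (maxn K n) => //=; exact: leq_maxr.
Qed.

Lemma limn_einf_min1 u : mine (limn_einf u) 1 <= limn_einf (fun n => mine (u n) 1).
Proof.
rewrite !limn_einf_sup_einfs.
have le n : mine (einfs u n) 1 <= einfs (fun n => mine (u n) 1) n.
  apply: le_ereal_inf_tmp => _ [m /= nm <-]; rewrite le_min !ge_min lexx orbT andbT.
  by apply/orP; left; apply: ereal_inf_lbound; exists m.
have [s1|s1] := leP (ereal_sup (range (einfs u))) 1.
  apply: ge_ereal_sup => _ [n _ <-].
  apply: (@le_trans _ _ (mine (einfs u n) 1)); last first.
    by apply: le_trans (le n) _; apply: ereal_sup_ubound; exists n.
  rewrite le_min lexx /=; apply: le_trans s1.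
  by apply: ereal_sup_ubound; exists n.
have /ereal_sup_gt[_ [n _ <-] hn] := s1.
apply: le_trans (ereal_sup_ubound (imageT _ n)); apply: le_trans (le n).
by rewrite le_min lexx ltW.
Qed.

End liminf.

Section modular.
Context {d} {Omega : measurableType d} {R : realType} (P : probability Omega R).
Implicit Types f g : Omega * measurableTypeR R -> \bar R.
Local Open Scope ereal_scope.

Definition mass f w : \bar R := \int[@lebesgue_measure R]_t f (w, t).

Definition modular f : \bar R := \int[P]_w mine (mass f w) 1.

Definition admissible f := measurable_fun setT f /\ forall z, 0 <= f z.

Lemma mass_ge0 f w : admissible f -> 0 <= mass f w.
Proof. by move=> [_ f0]; apply: integral_ge0 => t _; exact: f0. Qed.

Lemma measurable_mass f : admissible f -> measurable_fun setT (mass f).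
Proof. by move=> [mf f0]; exact: measurable_fun_fubini_tonelli_F. Qed.

Lemma measurable_slice f w : admissible f -> measurable_fun setT (fun t => f (w, t)).
Proof. by move=> [mf _]; apply: measurableT_comp mf _; exact: pair1_measurable. Qed.

Lemma measurable_mass1 f : admissible f -> measurable_fun setT (fun w => mine (mass f w) 1).
Proof. by move=> af; apply: measurable_mine; [exact: measurable_mass|exact: measurable_cst]. Qed.

Lemma mass1_ge0 f w : admissible f -> 0 <= mine (mass f w) 1.
Proof. by move=> af; rewrite le_min mass_ge0//= lee01. Qed.

Lemma modular_ge0 f : admissible f -> 0 <= modular f.
Proof. by move=> af; apply: integral_ge0 => w _; exact: mass1_ge0. Qed.

Lemma ae_slice (Q : Omega * measurableTypeR R -> Prop) :
  {ae (P \x @lebesgue_measure R), forall z, Q z} ->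
  {ae P, forall w, {ae @lebesgue_measure R, forall t, Q (w, t)}}.
Proof.
case=> A [mA A0 hA].
have m : measurable_fun setT (fun w => @lebesgue_measure R (xsection A w)).
  exact: measurable_fun_xsection.
have [h _] := ae_eq_integral_abs P measurableT m.
have : ae_eq P setT (fun w => @lebesgue_measure R (xsection A w)) (cst 0).
  apply: h; rewrite -[RHS]A0; apply: eq_integral => w _.
  by rewrite gee0_abs.
apply: filterS => w /(_ I) hw; exists (xsection A w).
split=> //; first exact: measurable_xsection.
by move=> t ht; apply/xsectionP; apply: hA.
Qed.

Lemma modular_le f g : admissible f -> admissible g ->
  {ae (P \x @lebesgue_measure R), forall z, f z <= g z} -> modular f <= modular g.
Proof.
move=> af ag fg; apply: ae_ge0_le_integral => //.
- by move=> w _; exact: mass1_ge0.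
- exact: measurable_mass1.
- by move=> w _; exact: mass1_ge0.
- exact: measurable_mass1.
apply: filterS (ae_slice fg) => w hw _.
have h : mass f w <= mass g w.
  apply: ae_ge0_le_integral => //.
  - by move=> t _; exact: af.2.
  - exact: measurable_slice.
  - by move=> t _; exact: ag.2.
  - exact: measurable_slice.
  - by apply: filterS hw => t ht _.
by rewrite le_min !ge_min h lexx orbT.
Qed.

Lemma admissibleD4 f g : admissible f -> admissible g ->
  admissible (fun z => 4%:E * (f z + g z)).
Proof.
move=> [mf f0] [mg g0]; split=> [|z]; last by rewrite mule_ge0 ?adde_ge0// lee_fin.
by apply: measurable_funeM; exact: emeasurable_funD.
Qed.

Lemma modularD4 f g : admissible f -> admissible g ->
  modular (fun z => 4%:E * (f z + g z)) <= 4%:E * (modular f + modular g).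
Proof.
move=> af ag; have [m1 m2] := (measurable_mass1 af, measurable_mass1 ag).
rewrite -ge0_integralD//; [|by move=> w _; exact: mass1_ge0..].
rewrite -ge0_integralZl//; [|exact: emeasurable_funD|by move=> w _; rewrite adde_ge0// mass1_ge0].
apply: ge0_le_integral => //.
- by move=> w _; apply: mass1_ge0; exact: admissibleD4.
- by apply: measurable_mass1; exact: admissibleD4.
- by apply: measurable_funeM; exact: emeasurable_funD.
move=> w _; have -> : mass (fun z => 4%:E * (f z + g z)) w = 4%:E * (mass f w + mass g w).
  rewrite /mass ge0_integralZl//; [|by apply: emeasurable_funD; exact: measurable_slice|
    by move=> t _; rewrite adde_ge0// ?af.2 ?ag.2].
  congr (_ * _); rewrite ge0_integralD//.
  - by move=> t _; exact: af.2.
  - exact: measurable_slice.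
  - by move=> t _; exact: ag.2.
  - exact: measurable_slice.
have := mass_ge0 w af; have := mass_ge0 w ag.
move: (mass f w) (mass g w) => x y y0 x0.
have [x1|x1] := leP x 1; have [y1|y1] := leP y 1.
- by rewrite ge_min lexx.
- rewrite ge_min; apply/orP; right; apply: (@le_trans _ _ (4%:E * 1)).
    by rewrite mule1 lee_fin; lra.
  by rewrite lee_pmul2l ?lte_fin// leeDr.
- rewrite ge_min; apply/orP; right; apply: (@le_trans _ _ (4%:E * 1)).
    by rewrite mule1 lee_fin; lra.
  by rewrite lee_pmul2l ?lte_fin// leeDl.
- rewrite ge_min; apply/orP; right; apply: (@le_trans _ _ (4%:E * 1)).
    by rewrite mule1 lee_fin; lra.
  by rewrite lee_pmul2l ?lte_fin// leeDl.
Qed.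

Lemma admissible_liminf (F : nat -> Omega * measurableTypeR R -> \bar R) :
  (forall n, admissible (F n)) -> admissible (fun z => limn_einf (F ^~ z)).
Proof.
move=> aF; split=> [|z]; last by apply: limn_einf_ge0 => n; exact: (aF n).2.
have -> : (fun z => limn_einf (F ^~ z)) = (fun z => - limn_esup (fun n => - F n z)).
  by apply/funext => z; rewrite -[LHS]oppeK -limn_esupN.
apply: measurableT_comp => //; apply: measurable_fun_limn_esup => n.
by apply: measurableT_comp => //; exact: (aF n).1.
Qed.

(** Fatou on each path, then on the sample space. *)
Lemma modular_liminf (F : nat -> Omega * measurableTypeR R -> \bar R) K c :
  (forall n, admissible (F n)) -> (forall n, (K <= n)%N -> modular (F n) <= c) ->
  modular (fun z => limn_einf (F ^~ z)) <= c.
Proof.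
move=> aF hF; have al := admissible_liminf aF.
apply: (@le_trans _ _ (\int[P]_w limn_einf (fun n => mine (mass (F n) w) 1))).
  apply: ge0_le_integral => //.
  - by move=> w _; exact: mass1_ge0.
  - exact: measurable_mass1.
  - have -> : (fun w => limn_einf (fun n => mine (mass (F n) w) 1)) =
        (fun w => - limn_esup (fun n => - mine (mass (F n) w) 1)).
      by apply/funext => z; rewrite -[LHS]oppeK -limn_esupN.
    apply: measurableT_comp => //; apply: measurable_fun_limn_esup => n.
    by apply: measurableT_comp => //; exact: measurable_mass1.
  move=> w _; apply: le_trans (limn_einf_min1 _).
  have h : mass (fun z => limn_einf (F ^~ z)) w <= limn_einf (fun n => mass (F n) w).
    apply: fatou => // [n|n t _]; first exact: measurable_slice.
    exact: (aF n).2.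
  by rewrite le_min !ge_min h lexx orbT.
apply: (@le_trans _ _ (limn_einf (fun n => modular (F n)))).
  by apply: fatou => // [n|n w _]; [exact: measurable_mass1|exact: mass1_ge0].
exact: limn_einf_le_near hF.
Qed.

End modular.

(** * The intensity of a process *)

Lemma cvge0P (R : realType) (I : Type) (F : set_system I) {FF : Filter F} (u : I -> \bar R) :
  (forall x, (0 <= u x)%E) ->
  u @ F --> 0%E <-> forall r : R, 0 < r -> \forall x \near F, (u x <= r%:E)%E.
Proof.
move=> u0; split=> [h r r0|h A].
  apply: (h [set y | (y <= r%:E)%E]); exists r => //= x; rewrite /ball/= sub0r normrN.
  by move=> /ltW xr; rewrite lee_fin (le_trans _ xr)// ler_norm.
move=> [r /= r0 hA]; have r2 : 0 < r / 2 by rewrite divr_gt0.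
apply: filterS (h _ r2) => x; rewrite /preimage /=; have := u0 x; case: (u x) => //= y; rewrite !lee_fin => y0 yr.
apply: hA; rewrite /ball/= sub0r normrN ger0_norm//.
by apply: le_lt_trans yr _; rewrite ltr_pdivrMr// ltr_pMr// ltr1n.
Qed.

Lemma powR_D4 (R : realType) (alpha x y : R) : 0 < alpha -> alpha < 2 -> 0 <= x -> 0 <= y ->
  (x + y) `^ alpha <= 4 * (x `^ alpha + y `^ alpha).
Proof.
move=> a0 a2; wlog xy : x y / x <= y.
  move=> h x0 y0; case: (leP x y) => [|/ltW] xy; first exact: h.
  by rewrite addrC [_ `^ _ + _]addrC; exact: h.
move=> x0 y0; apply: (@le_trans _ _ ((2 * y) `^ alpha)).
  by apply: ge0_ler_powR; rewrite ?nnegrE ?addr_ge0 ?mulr_ge0 ?(ltW a0)//; lra.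
rewrite powRM//; apply: (@le_trans _ _ (4 * y `^ alpha)).
  rewrite ler_wpM2r ?powR_ge0//; apply: (@le_trans _ _ (2 `^ 2)).
    by apply: ler_powR; [rewrite ler1n|exact: ltW].
  by rewrite powR_mulrn// expr2; lra.
by rewrite ler_pM2l// lerDr powR_ge0.
Qed.

Section intensity.
Context {d} {Omega : measurableType d} {R : realType} (P : probability Omega R).
Context {G H : hilbertType R} (sepG : separable G) (sepH : separable H).
Context (a : set G) (ba : orthonormal_basis a).
Context (alpha : R).
Hypotheses (alpha0 : 0 < alpha) (alpha2 : alpha < 2).
Context (L : R -> G -> {RV P >-> R}) (T : R) (T0 : 0 < T).
Implicit Types Th Psi : Omega -> R -> G -> H.

Definition hs_power Th (z : Omega * measurableTypeR R) : R :=
  (if 0 <= z.2 <= T then hsn a (Th z.1 z.2) else 0) `^ alpha.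

Definition intensity Th z := (hs_power Th z)%:E.

Lemma hs_power_ge0 Th z : 0 <= hs_power Th z. Proof. exact: powR_ge0. Qed.

Lemma hs_powerE Th w t : 0 <= t <= T -> hs_power Th (w, t) = hsn a (Th w t) `^ alpha.
Proof. by rewrite /hs_power /= => ->. Qed.

Lemma hs_power_out Th w t : ~~ (0 <= t <= T) -> hs_power Th (w, t) = 0.
Proof. by rewrite /hs_power /= => /negbTE ->; rewrite powR0// gt_eqF. Qed.

Lemma admissible_intensity Th : measurable_fun setT (hs_power Th) -> admissible (intensity Th).
Proof.
move=> mi; split=> [|z]; last by rewrite lee_fin hs_power_ge0.
exact/measurable_EFinP.
Qed.

Lemma hs_power_contract Th Psi w t : (0 <= t <= T -> hs_op a (Psi w t) /\ hs_op a (Th w t)) ->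
  (0 <= t <= T -> forall x, `|Th w t x| <= `|Psi w t x|) -> hs_power Th (w, t) <= hs_power Psi (w, t).
Proof.
case: (boolP (0 <= t <= T)) => [tT /(_ isT)[hP hT] /(_ isT) le|/hs_power_out h _ _]; last by rewrite !h.
rewrite !hs_powerE// ge0_ler_powR ?nnegrE ?hsn_ge0 ?(ltW alpha0)//.
by rewrite -lee_fin -!hs_opE//; exact: hs_norm_contract.
Qed.

Lemma hs_powerD4 Th Psi Phi w t : (0 <= t <= T -> hs_op a (Psi w t) /\ hs_op a (Phi w t)) ->
  (0 <= t <= T -> Th w t = fun x => Psi w t x + Phi w t x) ->
  hs_power Th (w, t) <= 4 * (hs_power Psi (w, t) + hs_power Phi (w, t)).
Proof.
have [e te] := separable_total_seq sepH.
case: (boolP (0 <= t <= T)) => [tT /(_ isT)[hP hT] /(_ isT) E|/hs_power_out h _ _]; last first.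
  by rewrite !h addr0 mulr0.
have [hD le] := hs_opD sepG ba te hP hT.
rewrite !hs_powerE// E; apply: le_trans (powR_D4 alpha0 alpha2 (hsn_ge0 _ _) (hsn_ge0 _ _)).
by rewrite ge0_ler_powR ?nnegrE ?addr_ge0 ?hsn_ge0 ?(ltW alpha0).
Qed.

Lemma hs_powerB4 Th Psi Phi w t : (0 <= t <= T -> hs_op a (Psi w t) /\ hs_op a (Phi w t)) ->
  (0 <= t <= T -> Th w t = Psi w t \- Phi w t) ->
  hs_power Th (w, t) <= 4 * (hs_power Psi (w, t) + hs_power Phi (w, t)).
Proof.
have [e te] := separable_total_seq sepH.
case: (boolP (0 <= t <= T)) => [tT /(_ isT)[hP hT] /(_ isT) E|/hs_power_out h _ _]; last first.
  by rewrite !h addr0 mulr0.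
have [hD le] := hs_opB sepG ba te hP hT.
rewrite !hs_powerE// E; apply: le_trans (powR_D4 alpha0 alpha2 (hsn_ge0 _ _) (hsn_ge0 _ _)).
by rewrite ge0_ler_powR ?nnegrE ?addr_ge0 ?hsn_ge0 ?(ltW alpha0).
Qed.

Lemma predictable_measurable C : predictable_sigma L T C ->
  measurable (C : set (Omega * measurableTypeR R)).
Proof.
have mitv (x y : R) : measurable (`]x, y] : set (measurableTypeR R)) by exact: measurable_itv.
have mD : measurable ((setT `*` `[0, T]%classic) : set (Omega * measurableTypeR R)).
  by apply: measurableX => //; exact: measurable_itv.
apply: smallest_sub.
  split=> [|A mA|A mA]; [exact: measurable0|exact: measurableD|exact: bigcup_measurable].
move=> _ [[s [t [B [_ _ _ hB ->]]]]|[B hB ->]]; apply: measurableX => //.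
- exact: levy_filtration_measurable hB.
- exact: levy_filtration_measurable hB.
Qed.

Lemma hs_open_gt (c : R) : hs_open a [set F : G -> H | hs_op a F /\ c < hsn a F].
Proof.
have [e te] := separable_total_seq sepH; split=> [F []//|F [hF cF]].
exists (hsn a F - c); first by rewrite subr_gt0.
move=> F' hF' lt; split=> //.
have [hB _] := hs_opB sepG ba te hF' hF; have [_ le] := hs_opB sepG ba te hF' hB.
rewrite hs_opE// lte_fin in lt.
have E : (fun x => F' x - (F' \- F) x) = F by apply/funext => x; rewrite subKr.
by rewrite E in le; lra.
Qed.

Lemma measurable_hs_power_predictable Psi : predictable a L T Psi -> measurable_fun setT (hs_power Psi).
Proof.
move=> [hO pO]; apply: (measurableT_comp (measurable_powR alpha)).
apply: (measurability (@RGenOInfty.G R)); first exact: RGenOInfty.measurableE.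
move=> _ [_ [c ->] <-]; rewrite setTI.
have [c0|c0] := ltP c 0.
  rewrite (_ : _ @^-1` _ = setT)//; apply/seteqP; split=> // z _ /=.
  by rewrite in_itv/= andbT (lt_le_trans c0)//; case: ifP => // _; exact: hsn_ge0.
have /predictable_measurable := pO _ (sub_gen_smallest (hs_open_gt c)).
congr measurable; apply/seteqP; split=> z /=; rewrite in_itv/= andbT.
  by move=> [-> []].
case: ifP => [tT h|_ h]; last by move: c0; rewrite leNgt h.
by split=> //; split=> //; exact: hO.
Qed.

Lemma hs_power_stepE s Th w t : grid T s -> step_on L T (hs_op a) s Th ->
  hs_power Th (w, t) = \1_[set 0] t * hsn a (Th w 0) `^ alpha +
    \sum_(j < size s) \1_(`]node s j, node s j.+1]) t * hsn a (at_node s Th j w) `^ alpha.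
Proof.
move=> gs sT; have [tT|tT] := boolP (0 <= t <= T); last first.
  rewrite hs_power_out// indicE memNset ?mul0r ?add0r; last first.
    by move=> /= t0; move: tT; rewrite t0 lexx ltW.
  rewrite big1// => j _; rewrite indicE memNset ?mul0r//= in_itv/= => /andP[h1 h2].
  have js := ltn_ord j; move: tT; rewrite (le_trans (node_ge0 gs (ltnW js)) (ltW h1))/=.
  by rewrite (le_trans h2)// (node_leT gs).
rewrite hs_powerE//; have /andP[] := tT; rewrite le_eqVlt => /orP[/eqP t0 _|t0 tT'].
  rewrite -t0 indicE mem_set// mul1r big1 ?addr0// => j _.
  rewrite indicE memNset ?mul0r//= in_itv/= => /andP[h1 _].
  by move: h1; rewrite ltNge (node_ge0 gs)// ltnW.
have [i si it] := grid_locate gs (t := t) ltac:(by rewrite t0).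
rewrite indicE memNset ?mul0r ?add0r; last by move=> /= E; rewrite E ltxx in t0.
rewrite (bigD1 (Ordinal si))//= big1 ?addr0 => [|j ji]; last first.
  rewrite indicE memNset ?mul0r//= in_itv/= => jt.
  have := grid_locate_uniq gs (ltn_ord j) si jt it.
  by move=> E; move/eqP: ji; apply; exact: val_inj.
rewrite indicE mem_set ?mul1r /=; last by rewrite in_itv.
by rewrite /at_node (step_on_at w gs sT si it).
Qed.

Lemma measurable_hs_power_step s Th : grid T s -> step_on L T (hs_op a) s Th ->
  measurable_fun setT (hs_power Th).
Proof.
move=> gs sT.
have E : hs_power Th = fun z => \1_[set 0] z.2 * hsn a (Th z.1 0) `^ alpha +
    \sum_(j < size s) \1_(`]node s j, node s j.+1]) z.2 * hsn a (at_node s Th j z.1) `^ alpha.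
  by apply/funext => -[w t]; exact: hs_power_stepE gs sT.
have m2 (A : set (measurableTypeR R)) : measurable A ->
    measurable_fun setT (fun z : Omega * measurableTypeR R => \1_A z.2 : R).
  move=> mA; have mi : measurable_fun setT (\1_A : measurableTypeR R -> R) by exact: measurable_indic.
  exact: (measurableT_comp mi (@measurable_snd _ _ Omega (measurableTypeR R))).
have m1 (f : Omega -> R) : bounded_rv f ->
    measurable_fun setT (fun z : Omega * measurableTypeR R => f z.1).
  move=> [mf _].
  exact: (measurableT_comp mf (@measurable_fst _ _ Omega (measurableTypeR R))).
rewrite E; apply: measurable_funD.
  apply: measurable_funM; first by apply: m2; exact: measurable_set1.
  have [h0 _ _] := sT; apply: (m1 (fun w => hsn a (Th w 0) `^ alpha)).
  exact: (simple_brv (simple_map (h := fun F => hsn a F `^ alpha) (O2 := setT) (fun _ _ => I) h0)).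
apply: measurable_sum => j; apply: measurable_funM; first by apply: m2; exact: measurable_itv.
apply: (m1 (fun w => hsn a (at_node s Th j w) `^ alpha)).
exact: (brv_node gs sT (fun F => hsn a F `^ alpha) (ltn_ord j)).
Qed.

Lemma mass_step s Th w : grid T s -> step_on L T (hs_op a) s Th ->
  mass (intensity Th) w = (VV a alpha s Th w)%:E.
Proof.
move=> gs sT; rewrite /mass /intensity.
pose c0 := hsn a (Th w 0) `^ alpha.
pose c j := hsn a (at_node s Th j w) `^ alpha.
have c00 : 0 <= c0 by exact: powR_ge0.
have cc0 j : 0 <= c j by exact: powR_ge0.
have m1 (A : set (measurableTypeR R)) (k : R) : measurable A ->
    measurable_fun setT (fun t : measurableTypeR R => (k%:E * (\1_A t)%:E)%E).
  by move=> mA; apply: measurable_funeM; apply/measurable_EFinP; exact: measurable_indic.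
have p1 (A : set (measurableTypeR R)) (k : R) t : 0 <= k -> (0 <= k%:E * (\1_A t)%:E)%E.
  by move=> k0; rewrite mule_ge0 ?lee_fin// indicE.
have i1 (A : set (measurableTypeR R)) (k : R) : measurable A -> 0 <= k ->
    (\int[@lebesgue_measure R]_t (k%:E * (\1_A t)%:E) = k%:E * @lebesgue_measure R A)%E.
  move=> mA k0; rewrite ge0_integralZl//; first by rewrite integral_indic// setIT.
    by apply/measurable_EFinP; exact: measurable_indic.
have ms (j : 'I_(size s)) : measurable (`]node s j, node s j.+1] : set (measurableTypeR R)).
  exact: measurable_itv.
transitivity (\int[@lebesgue_measure R]_t (c0%:E * (\1_[set 0] t)%:E +
   \sum_(j < size s) (c j)%:E * (\1_(`]node s j, node s j.+1]) t)%:E))%E.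
  apply: eq_integral => t _; rewrite (hs_power_stepE _ _ gs sT) EFinD EFinM muleC -sumEFin.
  by congr (_ + _)%E; apply: eq_bigr => j _; rewrite EFinM muleC.
rewrite ge0_integralD//; last first.
- by apply: emeasurable_sum => j; exact: m1.
- by move=> t _; apply: sume_ge0 => j _; apply: p1; exact: cc0.
- by apply: m1; exact: measurable_set1.
- by move=> t _; exact: p1.
rewrite i1// lebesgue_measure_set1 mule0 add0e ge0_integral_sum//; last first.
- by move=> j t _; apply: p1; exact: cc0.
- by move=> j; exact: m1.
rewrite /VV -sumEFin; apply: eq_bigr => j _.
rewrite i1// lebesgue_measure_itv/= lte_fin (node_lt gs)// -EFinB -EFinM.
by rewrite mulrC.
Qed.

Lemma modular_step s Th : grid T s -> step_on L T (hs_op a) s Th ->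
  modular P (intensity Th) = (EE P (fun w => Num.min (VV a alpha s Th w) 1))%:E.
Proof.
move=> gs sT; rewrite EE_fin.
  apply: eq_integral => w _; rewrite (mass_step w gs sT).
  by rewrite EFin_min.
apply: brv_min1 => [|w]; last exact: (VV_ge0 a alpha Th w gs).
exact: brv_meas (brv_VV alpha gs sT).
Qed.

End intensity.

Section Lalpha.
Context {d} {Omega : measurableType d} {R : realType} (P : probability Omega R).
Context {G H : hilbertType R} (sepG : separable G) (sepH : separable H).
Context (a : set G) (ba : orthonormal_basis a).
Context (alpha : R).
Hypotheses (alpha0 : 0 < alpha) (alpha2 : alpha < 2).
Context (L : R -> G -> {RV P >-> R}) (T : R) (T0 : 0 < T).
Implicit Types Th Psi : Omega -> R -> G -> H.

Lemma mass_intensityE Psi w : (forall t, 0 <= t <= T -> hs_op a (Psi w t)) ->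
  (\int[lebesgue_measure]_(t in `[0%R, T]) (hs_norm a (Psi w t) `^ alpha))%E =
  mass (intensity a alpha T Psi) w.
Proof.
move=> hP; rewrite integral_mkcond; apply: eq_integral => t _; rewrite patchE.
have [tT|tT] := boolP (0 <= t <= T); last first.
  rewrite memNset; last by move=> /=; rewrite in_itv/=; exact/negP.
  by rewrite /intensity hs_power_out.
rewrite mem_set; last by rewrite /= in_itv.
by rewrite /intensity hs_powerE// hs_opE ?poweR_EFin//; exact: hP.
Qed.

Lemma Lalpha_normE Psi w : (forall t, 0 <= t <= T -> hs_op a (Psi w t)) ->
  Lalpha_norm a T alpha (Psi w) =
  (if (1 <= alpha)%R then mass (intensity a alpha T Psi) w `^ alpha^-1
   else mass (intensity a alpha T Psi) w)%E.
Proof. by move=> hP; rewrite /Lalpha_norm mass_intensityE. Qed.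

Let powR1r (r : R) : 1 `^ r = 1. Proof. by rewrite powR1. Qed.

Lemma min1_powR_le (x r : R) : 0 <= x -> 0 < r -> r <= 1 -> 1 <= alpha ->
  Num.min (x `^ alpha^-1) 1 <= r + (r `^ alpha)^-1 * Num.min x 1.
Proof.
move=> x0 r0 r1 a1.
have ra : 0 < r `^ alpha by exact: powR_gt0.
have xx : (x `^ alpha^-1) `^ alpha = x by rewrite -powRrM mulVf ?gt_eqF// powRr1.
have [h|h] := leP (x `^ alpha^-1) r.
  apply: (@le_trans _ _ r); first by rewrite ge_min h.
  by rewrite lerDl mulr_ge0// ?invr_ge0 ?(ltW ra)// le_min x0 ler01.
have rx : r `^ alpha <= x.
  by rewrite -[leRHS]xx ge0_ler_powR ?nnegrE ?powR_ge0 ?(ltW r0) ?(ltW h) ?(ltW alpha0).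
have ra1 : r `^ alpha <= 1 by rewrite -[leRHS](powR1r alpha) ge0_ler_powR ?nnegrE ?(ltW r0) ?(ltW alpha0).
apply: (@le_trans _ _ 1); first by rewrite ge_min lexx orbT.
apply: (@le_trans _ _ ((r `^ alpha)^-1 * Num.min x 1)); last by rewrite lerDr ltW.
by rewrite mulrC ler_pdivlMr// mul1r le_min rx ra1.
Qed.

Lemma measurable_Lalpha_norm Psi : predictable a L T Psi ->
  measurable_fun setT (fun w => mine (Lalpha_norm a T alpha (Psi w)) 1%E).
Proof.
move=> pP; have hP w t : 0 <= t <= T -> hs_op a (Psi w t) by exact: pP.1.
have aI := admissible_intensity (measurable_hs_power_predictable sepG sepH ba alpha pP).
have mm := measurable_mass aI.
apply: measurable_mine; last exact: measurable_cst.
rewrite (_ : (fun w => _) = fun w => (if (1 <= alpha)%R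
    then mass (intensity a alpha T Psi) w `^ alpha^-1
    else mass (intensity a alpha T Psi) w)%E).
  by case: (1 <= alpha) => //; exact: (measurableT_comp (measurable_poweR _) mm).
by apply/funext => w; exact: (Lalpha_normE (hP w)).
Qed.

Lemma modular_le_Lalpha Psi : predictable a L T Psi ->
  (modular P (intensity a alpha T Psi) <= Lalpha_triple_norm P a T alpha Psi)%E.
Proof.
move=> pP; have hP w t : 0 <= t <= T -> hs_op a (Psi w t) by exact: pP.1.
have aI := admissible_intensity (measurable_hs_power_predictable sepG sepH ba alpha pP).
apply: ge0_le_integral => //.
- by move=> w _; exact: mass1_ge0.
- exact: measurable_mass1.
- exact: measurable_Lalpha_norm.
move=> w _; rewrite (Lalpha_normE (hP w)); case: ifP => // a1.
have := mass_ge0 w aI; case: mass => [x| |]; [|move=> _|by []]; last first.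
  by rewrite poweRyr ?invr_eq0 ?gt_eqF.
rewrite lee_fin => x0; rewrite -!EFin_min lee_fin le_min !ge_min lexx orbT andbT.
have [x1|x1] := leP x 1.
  have [->|x00] := eqVneq x 0; first by rewrite powR_ge0.
  by rewrite ger1_powR// ?invf_le1// lt_neqAle eq_sym x00 x0.
apply/orP; right; rewrite -[leLHS](powR1r alpha^-1) ge0_ler_powR ?nnegrE ?ler01 ?invr_ge0 ?(ltW alpha0) ?(ltW x1)//.
Qed.

Lemma Lalpha_le_modular Psi (r : R) : predictable a L T Psi -> 0 < r -> r <= 1 ->
  (Lalpha_triple_norm P a T alpha Psi <=
   r%:E + (r `^ alpha)^-1%:E * modular P (intensity a alpha T Psi))%E.
Proof.
move=> pP r0 r1; have hP w t : 0 <= t <= T -> hs_op a (Psi w t) by exact: pP.1.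
have aI := admissible_intensity (measurable_hs_power_predictable sepG sepH ba alpha pP).
have m1 := measurable_mass1 aI.
have ra : 0 < r `^ alpha by exact: powR_gt0.
have ra1 : r `^ alpha <= 1 by rewrite -[leRHS](powR1r alpha) ge0_ler_powR ?nnegrE ?(ltW r0) ?(ltW alpha0).
have c0 : 0 <= (r `^ alpha)^-1 by rewrite invr_ge0 ltW.
have p0 w : (0 <= (r `^ alpha)^-1%:E * mine (mass (intensity a alpha T Psi) w) 1)%E.
  by rewrite mule_ge0 ?lee_fin//; exact: mass1_ge0.
have mc : measurable_fun setT (fun w =>
    ((r `^ alpha)^-1%:E * mine (mass (intensity a alpha T Psi) w) 1)%E).
  exact: measurable_funeM.
apply: (@le_trans _ _ (\int[P]_w (r%:E +
    (r `^ alpha)^-1%:E * mine (mass (intensity a alpha T Psi) w) 1))%E); last first.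
  rewrite ge0_integralD//; last first.
  - by move=> w _; rewrite lee_fin ltW.
  have PT : P [set: Omega] = 1%E := probability_setT P.
  rewrite integral_cst// [X in (r%:E * X)%E]PT mule1 leeD2l// ge0_integralZl//.
  by move=> w _; exact: mass1_ge0.
apply: ge0_le_integral => //.
- move=> w _; rewrite le_min lee01 andbT (Lalpha_normE (hP w)).
  by case: ifP => _; [exact: poweR_ge0|exact: mass_ge0].
- exact: measurable_Lalpha_norm.
- by apply: emeasurable_funD => //; exact: measurable_cst.
move=> w _; rewrite (Lalpha_normE (hP w)).
have := mass_ge0 w aI; case: mass => [x| |]//=; last first.
  move=> _; apply: (@le_trans _ _ 1%E); first by rewrite ge_min lexx orbT.
  rewrite min_r ?leey// mule1 -EFinD lee_fin; apply: (@le_trans _ _ (r `^ alpha)^-1).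
    by rewrite invf_ge1.
  by rewrite lerDr ltW.
rewrite lee_fin => x0; case: ifP => a1.
  by rewrite -!EFin_min -EFinM -EFinD lee_fin; exact: min1_powR_le.
rewrite -!EFin_min -EFinM -EFinD lee_fin.
have m0 : 0 <= Num.min x 1 by rewrite le_min x0 ler01.
apply: (@le_trans _ _ ((r `^ alpha)^-1 * Num.min x 1)).
  by rewrite ler_peMl// invf_ge1.
by rewrite lerDr ltW.
Qed.

Lemma Lalpha_modular_cvg (Psi : nat -> Omega -> R -> G -> H) :
  (forall n, predictable a L T (Psi n)) ->
  Lalpha_triple_norm P a T alpha (Psi n) @[n --> \oo] --> 0%E <->
  modular P (intensity a alpha T (Psi n)) @[n --> \oo] --> 0%E.
Proof.
move=> pP; have aI n := admissible_intensity (measurable_hs_power_predictable sepG sepH ba alpha (pP n)).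
have m0 n : (0 <= modular P (intensity a alpha T (Psi n)))%E by exact: modular_ge0.
have l0 n : (0 <= Lalpha_triple_norm P a T alpha (Psi n))%E.
  exact: le_trans (m0 n) (modular_le_Lalpha (pP n)).
split=> [/(cvge0P l0) h|/(cvge0P m0) h].
  apply/(cvge0P m0) => r r0.
  by apply: filterS (h r r0) => n; apply: le_trans; exact: modular_le_Lalpha.
apply/(cvge0P l0) => r r0; pose c := Num.min (r / 2) 1.
have c0 : 0 < c by rewrite lt_min ltr01 divr_gt0.
have c1 : c <= 1 by rewrite ge_min lexx orbT.
have cr : c <= r / 2 by rewrite ge_min lexx.
have ca : 0 < c `^ alpha by exact: powR_gt0.
apply: filterS (h (r / 2 * c `^ alpha) _) => [n hn|]; last by rewrite mulr_gt0// divr_gt0.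
apply: le_trans (Lalpha_le_modular (pP n) c0 c1) _.
apply: (@le_trans _ _ ((r / 2)%:E + (r / 2)%:E)%E); last by rewrite -EFinD -splitr.
apply: leeD; first by rewrite lee_fin.
have -> : (r / 2)%:E = ((c `^ alpha)^-1%:E * (r / 2 * c `^ alpha)%:E)%E.
  by rewrite -EFinM [in RHS]mulrC mulfK// gt_eqF.
by rewrite lee_pmul2l// lte_fin invr_gt0.
Qed.

End Lalpha.

(** * Completeness of the convergence in probability *)

Section completeness.
Context {d} {Omega : measurableType d} {R : realType} (P : probability Omega R).
Context {H : hilbertType R} (sepH : separable H).
Implicit Types X : nat -> Omega -> H.

Lemma cvg_in_prob_rho X I : (forall n, wm (X n)) -> wm I ->
  cvg_in_prob P X \oo I <-> rho P (fun w => X n w - I w) @[n --> \oo] --> 0.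
Proof.
move=> wX wI; have mn n : measurable_fun [set: Omega] (fun w => `|X n w - I w|).
  by apply: (wm_norm sepH); exact: wmB.
split=> [h|h r r0]; first by apply: EE_min1_cvg0.
exact: (EE_min1_cvg0_inv mn).
Qed.

Lemma rho_markov (Y : Omega -> H) (c : R) : wm Y -> 0 < c -> c <= 1 ->
  (P [set w | (c < `|Y w|)%R] <= (rho P Y / c)%:E)%E.
Proof.
move=> wY c0 c1; have mY := wm_norm sepH wY.
have mA : measurable [set w | c < `|Y w|].
  have := mY measurableT `]c, +oo[%classic (measurable_itv _); rewrite setTI.
  by congr measurable; apply/seteqP; split=> w /=; rewrite in_itv/= andbT.
have := EE_min1_markov P mY (fun w => normr_ge0 _) c0 c1.
rewrite EE_indic// -lee_fin fineK// fin_num_measure//.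
Qed.

Lemma rho_complete X : (forall n, wm (X n)) ->
  (forall r : R, 0 < r -> exists K, forall m n, (K <= m)%N -> (K <= n)%N ->
     rho P (fun w => X m w - X n w) <= r) ->
  exists2 Y, wm Y & cvg_in_prob P X \oo Y.
Proof.
move=> wX cX; pose q j : R := 2^-1 ^+ j.
have q0 j : 0 < q j by rewrite exprn_gt0// invr_gt0.
have /choice[K hK] : forall j, exists K, forall m n, (K <= m)%N -> (K <= n)%N ->
    rho P (fun w => X m w - X n w) <= q j.+1 ^+ 2.
  by move=> j; apply: cX; rewrite exprn_gt0.
have qc : q j @[j --> \oo] --> 0.
  by apply: cvg_expr; rewrite ger0_norm ?invr_ge0// invf_lt1// ltr1n.
pose nn j := (\sum_(i < j.+1) K i)%N.
have nnS j : nn j.+1 = (nn j + K j.+1)%N by rewrite /nn big_ord_recr.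
have nnK j : (K j <= nn j)%N by rewrite /nn big_ord_recr/= leq_addl.
pose E j := [set w | q j.+1 < `|X (nn j.+1) w - X (nn j) w|].
have wD j : wm (fun w => X (nn j.+1) w - X (nn j) w) by exact: wmB.
have q1 j : q j <= 1 by rewrite exprn_ile1// invf_le1// ler1n.
have PE j : (P (E j) <= (1 / (2 ^ j.+1)%:R)%:E)%E.
  apply: le_trans (rho_markov (wD j) (q0 j.+1) (q1 j.+1)) _.
  have -> : 1 / (2 ^ j.+1)%:R = q j.+1 by rewrite /q div1r natrX exprVn.
  rewrite lee_fin ler_pdivrMr// -expr2; apply: hK => //.
  by rewrite nnS (leq_trans (nnK j))// leq_addr.
have mE j : measurable (E j).
  have := wm_norm sepH (wD j); move=> /(_ measurableT `]q j.+1, +oo[%classic (measurable_itv _)).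
  rewrite setTI; congr measurable; apply/seteqP; split=> w /=; by rewrite in_itv/= andbT.
have E0 : P (lim_sup_set E) = 0%E.
  apply: lim_sup_set_cvg0 => //; apply: (@le_lt_trans _ _ 1%E); last exact: ltry.
  apply: le_trans (epsilon_trick0 xpredT ler01); apply: lee_nneseries => // j _.
  exact: PE.
have mA : measurable (lim_sup_set E).
  by apply: bigcapT_measurable => n; apply: bigcup_measurable => j _.
have cvgX w : ~ lim_sup_set E w -> cvgn (fun j => X (nn j) w).
  move=> nw; have [N hN] : exists N, forall j, (N <= j)%N -> `|X (nn j.+1) w - X (nn j) w| <= q j.+1.
    apply: contrapT => h; apply: nw => n _; apply: contrapT => h'; apply: h; exists n => j nj.
    by rewrite leNgt; apply/negP => lt; apply: h'; exists j.
  have qS j : q j = q j.+1 + q j.+1 by rewrite /q exprS; field.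
  have bound n k : (N <= n)%N -> `|X (nn (n + k)%N) w - X (nn n) w| <= q n - q (n + k)%N.
    move=> Nn; elim: k => [|k IH]; first by rewrite addn0 !subrr normr0.
    rewrite addnS -(subrK (X (nn (n + k)%N) w) (X (nn (n + k).+1) w)) -addrA.
    apply: le_trans (ler_normD _ _) _.
    apply: le_trans (lerD (hN _ (leq_trans Nn (leq_addr k n))) IH) _.
    by have := qS (n + k)%N; lra.
  apply: nat_cauchy_cvg => r r0.
  have /cvgrPdist_lt/(_ (r / 2)) [|M _ hM] := qc; first by rewrite divr_gt0.
  pose n0 := maxn M N; exists n0 => m n mn nn'.
  have sm k : (n0 <= k)%N -> `|X (nn k) w - X (nn n0) w| < r / 2.
    move=> hk; have := bound n0 (k - n0)%N (leq_maxr _ _); rewrite subnKC// => h.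
    apply: le_lt_trans h _; have := hM n0 (leq_maxl _ _).
    by rewrite sub0r normrN (ger0_norm (ltW (q0 n0))); have := q0 k; lra.
  rewrite -(subrK (X (nn n0) w) (X (nn m) w)) -addrA.
  apply: le_lt_trans (ler_normD _ _) _; rewrite (splitr r).
  by apply: ltrD; [exact: sm|rewrite -normrN opprB; exact: sm].
pose Z j w := \1_(~` lim_sup_set E) w *: X (nn j) w.
pose Y w := limn (fun j => Z j w).
have wZ j : wm (Z j) by apply: wmZ => //; apply: measurable_indic; exact: measurableC.
have ZE j w : ~ lim_sup_set E w -> Z j w = X (nn j) w.
  by move=> nw; rewrite /Z indicE mem_set ?scale1r.
have cZ w : Z j w @[j --> \oo] --> Y w.
  have [hw|hw] := pselect (lim_sup_set E w).
    have h : Z j w @[j --> \oo] --> (0 : H).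
      rewrite (_ : (fun j => Z j w) = fun=> 0); first exact: cvg_cst.
      by apply/funext => j; rewrite /Z indicE memNset ?scale0r// => /(_ hw).
    by have := cvgP _ h; exact.
  have -> : (fun j => Z j w) = (fun j => X (nn j) w) by apply/funext => j; exact: ZE.
  have h := cvgX w hw; have YE : Y w = limn (fun j => X (nn j) w).
    by rewrite /Y; congr (limn _); apply/funext => j; exact: ZE.
  by rewrite YE.
have wY : wm Y := wm_lim wZ cZ.
exists Y => //; apply/cvg_in_prob_rho => //.
have aeE : {ae P, forall w, ~ lim_sup_set E w}.
  by exists (lim_sup_set E); split=> // w /= h; apply: contrapT.
have sub0 : rho P (fun w => X (nn j) w - Y w) @[j --> \oo] --> 0.
  have -> : 0 = EE P (fun=> 0) by rewrite EE_cst.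
  apply: (EE_cvg (M := 1)) => [j||j w|].
  - by apply: (brv_rho sepH); exact: wmB.
  - exact: brv_cst.
  - by rewrite ger0_norm ?le_min ?normr_ge0 ?ler01// ge_min lexx orbT.
  apply: filterS aeE => w hw.
  rewrite -(min_l ler01); apply: cvg_min1; rewrite -(normr0 H); apply: cvg_norm.
  rewrite -(subrr (Y w)); apply: cvgB; last exact: cvg_cst.
  by have := cZ w; have -> : (fun j => Z j w) = (fun j => X (nn j) w) by apply/funext => j; exact: ZE.
apply/cvgrPdist_le => r r0; have r2 : 0 < r / 2 by rewrite divr_gt0.
have /cvgrPdist_le/(_ _ r2)[J1 _ h1] := sub0.
have /cvgrPdist_lt/(_ _ r2)[J2 _ h2] := qc.
pose j := maxn J1 J2; exists (K j) => // n /= Kn; rewrite sub0r normrN ger0_norm ?rho_ge0//.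
have -> : (fun w => X n w - Y w) = (fun w => (X n w - X (nn j) w) + (X (nn j) w - Y w)).
  by apply/funext => w; rewrite addrA subrK.
apply: le_trans (rhoD P sepH (wmB (wX _) (wX _)) (wmB (wX _) wY)) _.
rewrite (splitr r); apply: lerD; last first.
  by have := h1 j (leq_maxl _ _); rewrite sub0r normrN ger0_norm ?rho_ge0.
apply: le_trans (hK j _ _ Kn (nnK j)) _.
have := h2 j (leq_maxr _ _); rewrite sub0r normrN (ger0_norm (ltW (q0 j))) => hj.
apply: le_trans (ltW hj); rewrite expr2; have hq := q0 j.+1; have := q1 j.+1.
have : q j = q j.+1 + q j.+1 by rewrite /q exprS; field.
by nra.
Qed.

End completeness.

(** * Approximation by step processes *)

Lemma powR_liminf (R : realType) (alpha S : R) (u : nat -> R) : 0 < alpha -> 0 <= S ->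
  u n @[n --> \oo] --> S -> ((S `^ alpha)%:E <= limn_einf (fun n => (u n `^ alpha)%:E))%E.
Proof.
move=> a0; rewrite le_eqVlt => /orP[/eqP <- _|S0 uS].
  by rewrite powR0 ?gt_eqF//; apply: limn_einf_ge0 => n; rewrite lee_fin powR_ge0.
have c : {for S, continuous (fun x : R => x `^ alpha)}.
  apply: differentiable_continuous; apply/derivable1_diffP.
  by apply: derivable_powR; rewrite in_itv/= andbT.
have h : (u n `^ alpha)%:E @[n --> \oo] --> (S `^ alpha)%:E.
  by apply: cvg_EFin; [exact: nearW|exact: (cvg_comp _ _ uS c)].
by rewrite (cvg_limn_einf_sup h).1.
Qed.

Section approximation.
Context {d} {Omega : measurableType d} {R : realType} (P : probability Omega R).
Context {G H : hilbertType R} (sepG : separable G) (sepH : separable H).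
Context (a : set G) (ba : orthonormal_basis a).
Context (alpha : R).
Hypotheses (alpha0 : 0 < alpha) (alpha2 : alpha < 2).
Context (L : R -> G -> {RV P >-> R}).
Hypothesis levyL : cylindrical_levy_process L.
Hypothesis stableL : canonical_stable alpha L.
Context (T : R) (T0 : 0 < T).
Implicit Types Th Psi : Omega -> R -> G -> H.
Implicit Types Phi : nat -> Omega -> R -> G -> H.
Implicit Types Gam : Omega -> R -> H -> H.

Let hsP Th := @step_hsP _ _ _ P _ _ sepG sepH _ ba L _ T0 Th.

Let I := intensity (Omega := Omega) (H := H) a alpha T.

Let diff Th Psi : Omega -> R -> G -> H := fun w t => Th w t \- Psi w t.

Let SI Th := step_integral a L T Th.

Lemma wm_step_integral Th : step_hs a L T Th -> wm (SI Th).
Proof.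
move=> /hsP[s gs sT].
by have [] := step_integralP sepG sepH ba alpha0 alpha2 levyL stableL T0 gs sT.
Qed.

Lemma step_hs_in Th w t : step_hs a L T Th -> 0 <= t <= T -> hs_op a (Th w t).
Proof. by move=> /hsP[s gs sT]; exact: (step_on_in w sT). Qed.

Lemma step_hsB Th Psi : step_hs a L T Th -> step_hs a L T Psi -> step_hs a L T (diff Th Psi).
Proof.
move=> hT hP.
by have [] := step_integralB sepG sepH ba alpha0 alpha2 levyL stableL T0 hT hP.
Qed.

Lemma rho_step_integralB Th Psi : step_hs a L T Th -> step_hs a L T Psi ->
  rho P (fun w => SI Th w - SI Psi w) = rho P (SI (diff Th Psi)).
Proof.
move=> hT hP; have [hB E] := step_integralB sepG sepH ba alpha0 alpha2 levyL stableL T0 hT hP.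
apply: (rho_ae sepH); [by apply: wmB; exact: wm_step_integral|exact: wm_step_integral|].
by apply: filterS E => w h; exact: esym h.
Qed.

Lemma admissible_step Th : step_hs a L T Th -> admissible (I Th).
Proof.
by move=> /hsP[s gs sT]; apply: admissible_intensity; exact: (measurable_hs_power_step alpha0 T0 gs sT).
Qed.

(** Uniform continuity at zero of the integral with respect to the modular. *)
Lemma step_integral_small (r : R) : 0 < r -> exists2 c : R, 0 < c &
  forall Th, step_hs a L T Th -> (modular P (I Th) <= c%:E)%E -> rho P (SI Th) <= r.
Proof.
move=> r0; pose x := Num.min (r / 2) 1.
have x0 : 0 < x by rewrite lt_min ltr01 divr_gt0.
have x1 : x <= 1 by rewrite ge_min lexx orbT.
have xr : x <= r / 2 by rewrite ge_min lexx.
pose k := 8 / x ^+ 2; have k0 : 0 < k by rewrite divr_gt0// exprn_gt0.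
pose y := Num.min (r / (8 * k)) 1.
have y0 : 0 < y by rewrite lt_min ltr01 divr_gt0// mulr_gt0.
have y1 : y <= 1 by rewrite ge_min lexx orbT.
have yr : y <= r / (8 * k) by rewrite ge_min lexx.
have yk : k * y <= r / 8.
  have -> : r / 8 = k * (r / (8 * k)) by field; rewrite gt_eqF.
  by rewrite ler_wpM2l// ltW.
exists (y ^+ 2); first exact: exprn_gt0.
move=> Th /hsP[s gs sT]; rewrite (modular_step alpha0 T0 gs sT) lee_fin => mle.
have := step_bound_upper sepG sepH ba alpha0 alpha2 levyL stableL T0 gs sT x0 x1 y0 y1.
move=> /le_trans; apply; rewrite -/k.
have : EE P (fun w => Num.min (VV a alpha s Th w) 1) / y <= y.
  by rewrite ler_pdivrMr// -expr2.
move: (EE P _ / y) => z zy.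
have : k * (2 * y + z) <= k * (3 * y) by rewrite ler_wpM2l ?(ltW k0)//; lra.
have -> : k * (3 * y) = 3 * (k * y) by ring.
by move: (k * _) => v h; lra.
Qed.

Lemma modular_step_le (eta : R) Th : step_hs a L T Th ->
  (forall Gam, step_op1 L T Gam -> rho P (SI (op_comp Gam Th)) <= eta) ->
  (modular P (I Th) <= (75 * eta)%:E)%E.
Proof.
move=> /hsP[s gs sT] h; rewrite (modular_step alpha0 T0 gs sT) lee_fin.
exact: (step_bound_lower sepG sepH ba alpha0 alpha2 levyL stableL T0 gs sT).
Qed.

Lemma expect_min1_ge0 (X : Omega -> H) : (0 <= expect_min1 P X)%E.
Proof.
by rewrite /expect_min1 unlock; apply: integral_ge0 => w _; rewrite lee_fin le_min normr_ge0 ler01.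
Qed.

Lemma sup_expect_ge0 (f : (Omega -> R -> H -> H) -> Omega -> H) :
  (0 <= ereal_sup [set expect_min1 P (f Gam) | Gam in step_op1 L T])%E.
Proof.
apply: le_trans (expect_min1_ge0 (f (fun _ _ x => x))) _.
by apply: ereal_sup_ubound; exists (fun _ _ x => x) => //; exact: (step_op1_id L T0).
Qed.

Lemma cauchy_of_approx Phi Psi : approximates a L T Phi Psi -> forall r : R, 0 < r ->
  exists K, forall m n, (K <= m)%N -> (K <= n)%N -> forall Gam, step_op1 L T Gam ->
    rho P (SI (op_comp Gam (diff (Phi m) (Phi n)))) <= r.
Proof.
move=> [sPhi _ /cvge0P h] r r0; have {}h := h (fun=> sup_expect_ge0 _) r r0.
case: h => -[A B] /= [[M _ hM] [N _ hN]] hAB; exists (maxn M N) => m n mK nK Gam gG.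
have sB : step_hs a L T (op_comp Gam (diff (Phi m) (Phi n))).
  by apply: (step_hs_comp sepG sepH ba T0) => //; exact: step_hsB.
rewrite -lee_fin -(expect_min1E P sepH (wm_step_integral sB)).
have mnAB : (A `*` B) (m, n).
  by split; [apply: hM; exact: leq_trans (leq_maxl _ _) mK|apply: hN; exact: leq_trans (leq_maxr _ _) nK].
apply: le_trans (hAB _ mnAB); apply: ereal_sup_ubound; exists Gam => //.
Qed.

(** A measurable substitute for the intensity of [Phi k - Psi]. *)
Definition error Phi k z := limn_einf (fun m => I (diff (Phi k) (Phi m)) z).

Lemma admissible_error Phi k : (forall n, step_hs a L T (Phi n)) -> admissible (error Phi k).
Proof. by move=> sPhi; apply: admissible_liminf => m; apply: admissible_step; exact: step_hsB. Qed.

Lemma error_small Phi Psi : approximates a L T Phi Psi -> forall r : R, 0 < r ->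
  exists K, forall k, (K <= k)%N -> (modular P (error Phi k) <= r%:E)%E.
Proof.
move=> aP r r0; have [sPhi _ _] := aP.
have r75 : 0 < r / 75 by rewrite divr_gt0.
have [K hK] := cauchy_of_approx aP r75; exists K => k kK.
apply: (modular_liminf (K := K)) => [m|m mK]; first by apply: admissible_step; exact: step_hsB.
have -> : r = 75 * (r / 75) by field.
by apply: modular_step_le; [exact: step_hsB|move=> Gam gG; exact: hK].
Qed.

(** The error dominates the intensity of [Phi k - Psi] almost everywhere. *)
Lemma error_ge Phi Psi : approximates a L T Phi Psi ->
  (forall w t, 0 <= t <= T -> hs_op a (Psi w t)) ->
  {ae (P \x @lebesgue_measure R)%E, forall z, forall k, (I (diff (Phi k) Psi) z <= error Phi k z)%E}.
Proof.
have [e te] := separable_total_seq sepH.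
move=> [sPhi aePhi _] hPsi; apply: (@filterS _ _ (ae_filter_ringOfSetsType _)) aePhi => -[w t] /= cv k.
have [tT|tT] := boolP (0 <= t <= T); last first.
  rewrite {1}/I /intensity hs_power_out//; apply: limn_einf_ge0 => m.
  by rewrite lee_fin hs_power_ge0.
have hB m : hs_op a (Phi m w t \- Psi w t).
  by apply: (hs_op_sub sepG sepH ba); [exact: step_hs_in|exact: hPsi].
have hB' m : hs_op a (Phi k w t \- Phi m w t).
  by apply: (hs_op_sub sepG sepH ba); exact: step_hs_in.
have cv0 : hsn a (Phi m w t \- Psi w t) @[m --> \oo] --> 0.
  apply/cvgrPdist_le => r r0; move/(cvge0P (fun m => hs_norm_ge0 a _)) : (cv tT) => /(_ r r0).
  by apply: filterS => m; rewrite hs_opE// lee_fin sub0r normrN ger0_norm// hsn_ge0.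
rewrite /I /intensity hs_powerE// /error.
have -> : (fun m => I (diff (Phi k) (Phi m)) (w, t)) =
    (fun m => (hsn a (Phi k w t \- Phi m w t) `^ alpha)%:E).
  by apply/funext => m; rewrite /I /intensity hs_powerE.
apply: powR_liminf => //; first exact: hsn_ge0.
apply/cvgrPdist_le => r r0; have /cvgrPdist_le/(_ _ r0) := cv0.
apply: filterS => m; rewrite sub0r normrN ger0_norm ?hsn_ge0// => hm.
have [_ h1] := hs_opD sepG ba te (hB' m) (hB m).
have [_ h2] := hs_opB sepG ba te (hB k) (hB m).
have E1 : (fun x => (Phi k w t \- Phi m w t) x + (Phi m w t \- Psi w t) x) =
    Phi k w t \- Psi w t by apply/funext => x /=; rewrite addrA subrK.
have E2 : (fun x => (Phi k w t \- Psi w t) x - (Phi m w t \- Psi w t) x) =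
    Phi k w t \- Phi m w t by apply/funext => x /=; rewrite opprB addrA subrK.
rewrite E1 in h1; rewrite E2 in h2; rewrite ler_norml; apply/andP; split; rewrite /diff; lra.
Qed.

Lemma modular_le4 f g h : admissible f -> admissible g -> admissible h ->
  {ae (P \x @lebesgue_measure R)%E, forall z, (h z <= 4%:E * (f z + g z))%E} ->
  (modular P h <= 4%:E * (modular P f + modular P g))%E.
Proof.
move=> af ag ah le; apply: le_trans (modularD4 P af ag).
by apply: modular_le => //; exact: admissibleD4.
Qed.

Lemma le4_fin (x y z : \bar R) (r s : R) : (x <= 4%:E * (y + z))%E -> (y <= r%:E)%E ->
  (z <= s%:E)%E -> (x <= (4 * (r + s))%:E)%E.
Proof.
move=> h hy hz; apply: le_trans h _; rewrite EFinM (EFinD r s).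
by rewrite lee_pmul2l//; exact: leeD.
Qed.

Lemma approximates_comp Phi Psi Gam : step_op1 L T Gam ->
  (forall w t, 0 <= t <= T -> hs_op a (Psi w t)) -> approximates a L T Phi Psi ->
  approximates a L T (fun n => op_comp Gam (Phi n)) (op_comp Gam Psi).
Proof.
move=> gG hPsi [sPhi aePhi supPhi]; split.
- by move=> n; exact: (step_hs_comp sepG sepH ba T0).
- apply: (@filterS _ _ (ae_filter_ringOfSetsType _)) aePhi => -[w t] /= cv tT.
  have [lG _] := step_op1_bounded T0 w gG tT.
  apply/(cvge0P (fun m => hs_norm_ge0 a _)) => r r0.
  move/(cvge0P (fun m => hs_norm_ge0 a _)) : (cv tT) => /(_ r r0).
  apply: filterS => m; apply: le_trans; apply: hs_norm_contract => x.
  by rewrite /op_comp /= -(linB lG); exact: (step_op1_le T0 w _ gG tT).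
- apply/(cvge0P (fun=> sup_expect_ge0 _)) => r r0.
  move/(cvge0P (fun=> sup_expect_ge0 _)) : supPhi => /(_ r r0).
  apply: filterS => -[m n] /=; apply: le_trans; apply: ge_ereal_sup => _ [Gam' gG' <-].
  apply: ereal_sup_ubound; exists (fun w t => Gam' w t \o Gam w t); first exact: step_op1_comp.
  congr (expect_min1 P _); apply: step_integral_eq => w t tT.
  have [lG _] := step_op1_bounded T0 w gG tT.
  by apply/funext => x; rewrite /op_comp /= (linB lG).
Qed.

Lemma hs_power_comp_le Psi Gam w t : step_op1 L T Gam -> (0 <= t <= T -> hs_op a (Psi w t)) ->
  hs_power a alpha T (op_comp Gam Psi) (w, t) <= hs_power a alpha T Psi (w, t).
Proof.
have [e te] := separable_total_seq sepH.
move=> gG hPsi; apply: hs_power_contract => // [tT|tT x]; last exact: (step_op1_le T0 w _ gG tT).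
split; first exact: hPsi.
by apply: (hs_op_comp sepG ba te); [exact: (step_op1_bounded T0 w gG tT)|exact: hPsi].
Qed.

Lemma stoch_integralP Psi :
  (exists2 Phi, approximates a L T Phi Psi &
     wm (stoch_integral a L T Psi) /\ cvg_in_prob P (fun n => SI (Phi n)) \oo (stoch_integral a L T Psi)) \/
  (stoch_integral a L T Psi = cst 0 /\ forall Phi, ~ approximates a L T Phi Psi).
Proof.
have [[J hJ]|h] := pselect (exists J : Omega -> H, borel_measurable J /\ exists2 Psis,
    approximates a L T Psis Psi & cvg_in_prob P (fun n => step_integral a L T (Psis n)) \oo J).
  have [bJ [Phi aPhi cJ]] := xgetPex (cst 0) (ex_intro _ J hJ : exists J : Omega -> H,
    borel_measurable J /\ exists2 Psis, approximates a L T Psis Psi &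
    cvg_in_prob P (fun n => step_integral a L T (Psis n)) \oo J).
  by left; exists Phi => //; split => //; exact: borel_wm bJ.
right; split.
  by rewrite /stoch_integral; apply: xgetPN => J hJ; apply: h; exists J.
move=> Phi aPhi; have [sPhi _ _] := aPhi.
have wPhi n : wm (SI (Phi n)) by exact: wm_step_integral.
have [|Y wY cY] := rho_complete (P := P) sepH wPhi.
  move=> r r0; have [K hK] := cauchy_of_approx aPhi r0; exists K => m n mK nK.
  rewrite rho_step_integralB//; have := hK _ _ mK nK _ (step_op1_id L T0).
  exact.
by apply: h; exists Y; split; [exact: wm_borel|exists Phi].
Qed.

Lemma stoch_integral_small (r : R) : 0 < r -> exists2 c : R, 0 < c &
  forall Psi, predictable a L T Psi -> (modular P (I Psi) <= c%:E)%E ->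
  forall Gam, step_op1 L T Gam ->
  (expect_min1 P (stoch_integral a L T (op_comp Gam Psi)) <= r%:E)%E.
Proof.
move=> r0; have r2 : 0 < r / 2 by rewrite divr_gt0.
have [c c0 hc] := step_integral_small r2; have c8 : 0 < c / 8 by rewrite divr_gt0.
exists (c / 8) => // Psi pPsi mle Gam gG.
have hPsi w t : 0 <= t <= T -> hs_op a (Psi w t) by exact: pPsi.1.
have aI : admissible (I Psi).
  by apply: admissible_intensity; exact: (measurable_hs_power_predictable sepG sepH ba alpha pPsi).
have [e te] := separable_total_seq sepH.
have hGPsi w t : 0 <= t <= T -> hs_op a (op_comp Gam Psi w t).
  by move=> tT; apply: (hs_op_comp sepG ba te); [exact: (step_op1_bounded T0 w gG tT)|exact: hPsi].
have [[Phi aPhi [wJ cJ]]|[-> _]] := stoch_integralP (op_comp Gam Psi); last first.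
  rewrite expect_min1E//; last exact: wm_cst.
  by rewrite lee_fin /rho (_ : (fun=> _) = fun=> 0) ?EE_cst ?ltW//; apply/funext => w; rewrite normr0 min_l.
set J := stoch_integral _ _ _ _ in wJ cJ *.
have [sPhi _ _] := aPhi; have wPhi n : wm (SI (Phi n)) by exact: wm_step_integral.
rewrite expect_min1E// lee_fin.
have [K hK] := error_small aPhi c8.
have small k : (K <= k)%N -> rho P (SI (Phi k)) <= r / 2.
  move=> kK; apply: hc => //.
  have -> : c = 4 * (c / 8 + c / 8) by field.
  apply: (le4_fin (y := modular P (I Psi)) (z := modular P (error Phi k))); [|exact: mle|exact: hK].
  apply: modular_le4; [exact: aI|exact: admissible_error|exact: admissible_step|].
  have := error_ge aPhi hGPsi.
  apply: (@filterS _ _ (ae_filter_ringOfSetsType _)) => -[w t] /(_ k) le.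
  apply: (@le_trans _ _ (4%:E * (I (op_comp Gam Psi) (w, t) + I (diff (Phi k) (op_comp Gam Psi)) (w, t)))%E).
    rewrite -EFinD -EFinM lee_fin; apply: (hs_powerD4 sepG sepH ba alpha0 alpha2) => tT.
      split; first exact: hGPsi.
      by apply: (hs_op_sub sepG sepH ba); [exact: step_hs_in|exact: hGPsi].
    by apply/funext => x; rewrite /diff /= addrC subrK.
  rewrite lee_pmul2l; [|by []|by []]; apply: leeD; last exact: le.
  by rewrite lee_fin; apply: hs_power_comp_le => //; exact: hPsi.
move/(cvg_in_prob_rho P sepH wPhi wJ) : cJ => /cvgrPdist_le/(_ _ r2)[M _ hM].
pose k := maxn K M.
have -> : J = fun w => SI (Phi k) w - (SI (Phi k) w - J w) by apply/funext => w; rewrite subKr.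
apply: le_trans (rhoB P sepH (wPhi k) (wmB (wPhi k) wJ)) _; rewrite (splitr r); apply: lerD.
  by apply: small; exact: leq_maxl.
by have := hM k (leq_maxr _ _); rewrite sub0r normrN ger0_norm ?rho_ge0.
Qed.

Lemma modular_small (r : R) : 0 < r -> exists2 eta : R, 0 < eta &
  forall Psi, hs_integrable a L T Psi ->
  (forall Gam, step_op1 L T Gam ->
    (expect_min1 P (stoch_integral a L T (op_comp Gam Psi)) <= eta%:E)%E) ->
  (modular P (I Psi) <= r%:E)%E.
Proof.
move=> r0; have k0 : 0 < 4 * (75 * 4 + 1) :> R by lra.
pose eta := r / (4 * (75 * 4 + 1)); have eta0 : 0 < eta by exact: divr_gt0.
have rE : r = 4 * (75 * (4 * eta) + eta) by rewrite /eta; field.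
move: eta eta0 rE => eta eta0 rE; exists eta => //.
move=> Psi [pPsi [Phi aPhi]] heta; have [sPhi _ _] := aPhi.
have [e te] := separable_total_seq sepH.
have hPsi w t : 0 <= t <= T -> hs_op a (Psi w t) by exact: pPsi.1.
have aI : admissible (I Psi).
  by apply: admissible_intensity; exact: (measurable_hs_power_predictable sepG sepH ba alpha pPsi).
have [K1 hK1] := cauchy_of_approx aPhi eta0; have [K2 hK2] := error_small aPhi eta0.
pose k := maxn K1 K2.
suff hk : (modular P (I (Phi k)) <= (75 * (4 * eta))%:E)%E.
  rewrite rE.
  apply: (le4_fin (y := modular P (I (Phi k))) (z := modular P (error Phi k))); [|exact: hk|by apply: hK2; exact: leq_maxr].
  apply: modular_le4; [exact: admissible_step|exact: admissible_error|exact: aI|].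
  have := error_ge aPhi hPsi.
  apply: (@filterS _ _ (ae_filter_ringOfSetsType _)) => -[w t] /(_ k) le.
  apply: (@le_trans _ _ (4%:E * (I (Phi k) (w, t) + I (diff (Phi k) Psi) (w, t)))%E).
    rewrite -EFinD -EFinM lee_fin; apply: (hs_powerB4 sepG sepH ba alpha0 alpha2) => tT.
      split; first exact: step_hs_in.
      by apply: (hs_op_sub sepG sepH ba); [exact: step_hs_in|exact: hPsi].
    by apply/funext => x; rewrite /diff /= subKr.
  by rewrite lee_pmul2l; [apply: leeD; [|exact: le]|by []|by []].
apply: modular_step_le => // Gam gG.
have hGPsi w t : 0 <= t <= T -> hs_op a (op_comp Gam Psi w t).
  by move=> tT; apply: (hs_op_comp sepG ba te); [exact: (step_op1_bounded T0 w gG tT)|exact: hPsi].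
have aGPhi := approximates_comp gG hPsi aPhi.
have sG n : step_hs a L T (op_comp Gam (Phi n)) by exact: (step_hs_comp sepG sepH ba T0).
have [[Phi' aPhi' [wJ cJ]]|[_ h]] := stoch_integralP (op_comp Gam Psi); last by case: (h _ aGPhi).
have := heta _ gG; set J := stoch_integral _ _ _ _ in wJ cJ *.
have [sPhi' _ _] := aPhi'; have wPhi' n : wm (SI (Phi' n)) by exact: wm_step_integral.
rewrite expect_min1E// lee_fin => hJ.
move/(cvg_in_prob_rho P sepH wPhi' wJ) : cJ => /cvgrPdist_le/(_ _ eta0)[M _ hM].
have [c c0 hc] := step_integral_small eta0; have c8 : 0 < c / 8 by rewrite divr_gt0.
have [K3 hK3] := error_small aPhi c8; have [K4 hK4] := error_small aPhi' c8.
pose m := maxn (maxn M K1) (maxn K3 K4).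
have mM : (M <= m)%N by rewrite (leq_trans _ (leq_maxl _ _))// leq_maxl.
have mK1 : (K1 <= m)%N by rewrite (leq_trans _ (leq_maxl _ _))// leq_maxr.
have mK3 : (K3 <= m)%N by rewrite (leq_trans _ (leq_maxr _ _))// leq_maxl.
have mK4 : (K4 <= m)%N by rewrite (leq_trans _ (leq_maxr _ _))// leq_maxr.
have middle : rho P (SI (diff (Phi' m) (op_comp Gam (Phi m)))) <= eta.
  apply: hc; first exact: step_hsB.
  have -> : c = 4 * (c / 8 + c / 8) by field.
  apply: (le4_fin (y := modular P (error Phi' m)) (z := modular P (error Phi m))); last 2 first.
  - exact: hK4.
  - exact: hK3.
  apply: modular_le4; [exact: admissible_error|exact: admissible_error| |].
    by apply: admissible_step; exact: step_hsB.
  apply: (@filterS2 _ _ (ae_filter_ringOfSetsType _) _ _ _ _ (error_ge aPhi' hGPsi) (error_ge aPhi hPsi)).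
  move=> -[w t] /(_ m) le' /(_ m) le.
  apply: (@le_trans _ _ (4%:E * (I (diff (Phi' m) (op_comp Gam Psi)) (w, t) +
      I (op_comp Gam (diff (Phi m) Psi)) (w, t)))%E).
    rewrite -EFinD -EFinM lee_fin; apply: (hs_powerB4 sepG sepH ba alpha0 alpha2) => tT.
      split; first by apply: (hs_op_sub sepG sepH ba); [exact: step_hs_in|exact: hGPsi].
      apply: (hs_op_comp sepG ba te); first exact: (step_op1_bounded T0 w gG tT).
      by apply: (hs_op_sub sepG sepH ba); [exact: step_hs_in|exact: hPsi].
    have [lG _] := step_op1_bounded T0 w gG tT.
    by apply/funext => x; rewrite /diff /op_comp /= (linB lG) opprB addrA subrK.
  rewrite lee_pmul2l; [|by []|by []]; apply: leeD; first exact: le'.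
  apply: le_trans le; rewrite lee_fin; apply: hs_power_comp_le => [//|tT].
  by apply: (hs_op_sub sepG sepH ba); [exact: step_hs_in|exact: hPsi].
have last_ : rho P (SI (diff (op_comp Gam (Phi m)) (op_comp Gam (Phi k)))) <= eta.
  have -> : SI (diff (op_comp Gam (Phi m)) (op_comp Gam (Phi k))) =
      SI (op_comp Gam (diff (Phi m) (Phi k))).
    apply: step_integral_eq => w t tT; have [lG _] := step_op1_bounded T0 w gG tT.
    by apply/funext => x; rewrite /diff /op_comp /= (linB lG).
  by apply: hK1 => //; exact: leq_maxl.
have wG n : wm (SI (op_comp Gam (Phi n))) by exact: wm_step_integral.
rewrite -rho_step_integralB// in middle; rewrite -rho_step_integralB// in last_.
have -> : SI (op_comp Gam (Phi k)) = fun w => ((J w + (SI (Phi' m) w - J w)) -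
    (SI (Phi' m) w - SI (op_comp Gam (Phi m)) w)) -
    (SI (op_comp Gam (Phi m)) w - SI (op_comp Gam (Phi k)) w).
  by apply/funext => w; rewrite (addrC (J w)) subrK subKr subKr.
have w1 : wm (fun w => SI (Phi' m) w - J w) by exact: wmB.
have w2 : wm (fun w => SI (Phi' m) w - SI (op_comp Gam (Phi m)) w) by exact: wmB.
have w3 : wm (fun w => SI (op_comp Gam (Phi m)) w - SI (op_comp Gam (Phi k)) w) by exact: wmB.
have := hM m mM; rewrite sub0r normrN ger0_norm ?rho_ge0// => hm.
have h1 := rhoD P sepH wJ w1; have h2 := rhoB P sepH (wmD wJ w1) w2.
have h3 := rhoB P sepH (wmB (wmD wJ w1) w2) w3.
move: hJ hm middle last_ h1 h2 h3; rewrite /rho; lra.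
Qed.

End approximation.

Theorem corollary6p3 (R : realType) (G H : hilbertType R)
  (sepG : separable G) (sepH : separable H)
  (a : set G) (basis_a : orthonormal_basis a)
  (d : measure_display) (Omega : measurableType d) (P : probability Omega R)
  (completeP : measure_is_complete P)
  (T : R) (T_gt0 : 0 < T) (alpha : R) (alpha_gt0 : 0 < alpha) (alpha_lt2 : alpha < 2)
  (L : R -> G -> {RV P >-> R}) (levyL : cylindrical_levy_process L)
  (stableL : canonical_stable alpha L)
  (Psi : nat -> Omega -> R -> G -> H) (intPsi : forall n, hs_integrable a L T (Psi n)) :
  Lalpha_triple_norm P a T alpha (Psi n) @[n --> \oo] --> 0%E <->
  ereal_sup [set expect_min1 P (stoch_integral a L T (op_comp Gam (Psi n)))
    | Gam in step_op1 L T] @[n --> \oo] --> 0%E.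
Proof.
have pPsi n : predictable a L T (Psi n) by have [] := intPsi n.
have sup0 n := sup_expect_ge0 (H := H) L T_gt0 (fun Gam => stoch_integral a L T (op_comp Gam (Psi n))).
have mod0 n : (0 <= modular P (intensity a alpha T (Psi n)))%E.
  apply: modular_ge0; apply: admissible_intensity.
  exact: (measurable_hs_power_predictable sepG sepH basis_a alpha (pPsi n)).
have [Lm mL] := Lalpha_modular_cvg sepG sepH basis_a alpha_gt0 pPsi.
split=> [/Lm/(cvge0P mod0) h|/(cvge0P sup0) h].
  apply/(cvge0P sup0) => r r0.
  have [c c0 hc] := stoch_integral_small sepG sepH basis_a alpha_gt0 alpha_lt2 levyL stableL T_gt0 r0.
  apply: filterS (h c c0) => n hn; apply: ge_ereal_sup => _ [Gam gG <-].
  exact: (hc _ (pPsi n) hn).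
apply: mL; apply/(cvge0P mod0) => r r0.
have [c c0 hc] := modular_small sepG sepH basis_a alpha_gt0 alpha_lt2 levyL stableL T_gt0 r0.
apply: filterS (h c c0) => n hn; apply: (hc _ (intPsi n)) => Gam gG.
by apply: le_trans hn; apply: ereal_sup_ubound; exists Gam.
Qed.
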